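(* Let $n\ge 2$ and let $H\subset\mathbb{P}(\bigwedge^2\mathbb{C}^{2n+1})$ be a general hyperplane. The automorphism group of $\mathbb{G}(1,2n)\cap H$ is an extension of $(\mathrm{Sp}(2n,\mathbb{C})\times\mathbb{C}^* )/\{1,-1\}$ by $(\mathbb{C}^{2n},+)$ (i.e. it has a normal subgroup isomorphic to $(\mathbb{C}^{2n},+)$ with quotient isomorphic to $(\mathrm{Sp}(2n,\mathbb{C})\times\mathbb{C}^* )/\{1,-1\}$), and it is isomorphic to the group $$\left\{\begin{pmatrix} T & 0\\ a & b\end{pmatrix}\ \middle|\ T\in\mathrm{Sp}(2n,\mathbb{C}),\ a=(a_0,\dots,a_{2n-1})\in\mathbb{C}^{2n}\text{ (a row vector)},\ b\in\mathbb{C}^*\right\}\Big/\{1,-1\}.$$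
   Context: Everything is over $\mathbb{C}$. $\mathbb{G}(1,N)$ is the Grassmannian of lines in $\mathbb{P}_N=\mathbb{P}(\mathbb{C}^{N+1})$, embedded in $\mathbb{P}(\bigwedge^2\mathbb{C}^{N+1})$ by the Plücker embedding $\mathrm{span}\{v,w\}\mapsto\mathbb{P}(v\wedge w)$. A hyperplane $H$ is given by an antisymmetric matrix $A$ of size $2n+1$ (up to scalar), such that the line $p\wedge q$ lies in $H$ iff ${}^tpAq=0$; $H$ is general if $A$ has rank $2n$. $\mathrm{Sp}(2n,\mathbb{C})$ is the group of $T\in\mathrm{GL}(2n,\mathbb{C})$ preserving a nondegenerate antisymmetric form. Here $\pm1$ means $\pm$ the identity (matrix of size $2n+1$ in the matrix group, respectively $\pm(\mathrm{E}_{2n},1)$ in $\mathrm{Sp}(2n,\mathbb{C})\times\mathbb{C}^*$). *)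

(* Defs.v *)
From HB Require Import structures.
From mathcomp Require Import all_boot all_algebra.
From mathcomp Require Import generic_quotient.
From mathcomp Require Import boolp classical_sets.
From mathcomp Require Import mpoly.

Set Implicit Arguments.
Unset Strict Implicit.
Unset Printing Implicit Defensive.

Import GRing.Theory.

Local Open Scope ring_scope.

Definition isomorphic (G H : groupType) : Prop :=
  exists f : {multiplicative G -> H}, bijective f.

Section SubgroupType.
Variables (G : groupType) (S : groupClosed G).

Definition subgroup : Type := {x : G | x \in S}.
HB.instance Definition _ := SubChoice.on subgroup.

Fact subgroup_closed : @group_closed G S.
Proof. by split; [exact: gpred1 | move=> x y xS yS; exact: gpredF]. Qed.
HB.instance Definition _ :=
  SubChoice_isSubGroup.Build G _ subgroup subgroup_closed.

End SubgroupType.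

HB.mixin Record isConjClosed (G : groupType) (S : {pred G}) := {
  gpredJ : forall x y : G, x \in S -> (x ^ y)%g \in S
}.

#[short(type="normalClosed")]
HB.structure Definition NormalClosed (G : groupType) :=
  {S of isConjClosed G S & GroupClosed G S}.

Section QuotientGroup.
Variables (G : groupType) (N : normalClosed G).
Local Open Scope group_scope.
Local Open Scope quotient_scope.

Definition same_coset (x y : G) : bool := x^-1 * y \in N.

Fact same_coset_refl : reflexive same_coset.
Proof. by move=> x; rewrite /same_coset mulVg gpred1. Qed.
Fact same_coset_sym : ssrbool.symmetric same_coset.
Proof.
have sub x y : same_coset x y -> same_coset y x.
  by rewrite /same_coset => /gpredVr; rewrite invgM invgK.
by move=> x y; apply/idP/idP; apply: sub.
Qed.
Fact same_coset_trans : transitive same_coset.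
Proof.
move=> y x z xy yz; rewrite /same_coset.
by rewrite -(mulgK y x^-1) -mulgA gpredM.
Qed.

Canonical same_coset_equiv :=
  EquivRel same_coset same_coset_refl same_coset_sym same_coset_trans.

Definition quotient_group : Type := {eq_quot same_coset_equiv}.
HB.instance Definition _ := Choice.on quotient_group.
HB.instance Definition _ := EqQuotient.on quotient_group.

Definition quo_one : quotient_group := \pi_quotient_group 1.
Definition quo_mul (x y : quotient_group) : quotient_group :=
  \pi_quotient_group (repr x * repr y).
Definition quo_inv (x : quotient_group) : quotient_group :=
  \pi_quotient_group (repr x)^-1.

Fact repr_same_coset x : same_coset (repr (\pi_quotient_group x)) x.
Proof. by have /eqmodP := reprK (\pi_quotient_group x). Qed.

Fact pi_quo_mul x y : quo_mul (\pi_quotient_group x) (\pi_quotient_group y) =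
  \pi_quotient_group (x * y).
Proof.
apply/eqmodP; rewrite /= /same_coset.
move: (repr_same_coset x) (repr_same_coset y); rewrite /same_coset.
set x' := repr (\pi_quotient_group x); set y' := repr (\pi_quotient_group y).
move=> xN yN.
have -> : (x' * y')^-1 * (x * y) = (x'^-1 * x) ^ y' * (y'^-1 * y).
  by rewrite invgM conjgE !mulgA mulgK.
by rewrite gpredM // gpredJ.
Qed.

Fact pi_quo_inv x : quo_inv (\pi_quotient_group x) = \pi_quotient_group x^-1.
Proof.
apply/eqmodP; rewrite /= /same_coset invgK.
move: (repr_same_coset x); rewrite same_coset_sym /same_coset.
move: (repr _) => x' xN.
have -> : x' * x^-1 = (x^-1 * x') ^ x^-1 by rewrite conjgE invgK mulgA mulVKg.
exact: gpredJ.
Qed.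

Fact quo_mulA : associative quo_mul.
Proof.
move=> x y z; rewrite -[x]reprK -[y]reprK -[z]reprK.
rewrite (pi_quo_mul (repr y) (repr z)) (pi_quo_mul (repr x) (repr y)).
by rewrite (pi_quo_mul (repr x)) (pi_quo_mul _ (repr z)) mulgA.
Qed.
Fact quo_mul1 : left_id quo_one quo_mul.
Proof. by move=> x; rewrite -[x]reprK pi_quo_mul mul1g. Qed.
Fact quo_1mul : right_id quo_one quo_mul.
Proof. by move=> x; rewrite -[x]reprK pi_quo_mul mulg1. Qed.
Fact quo_mulV : left_inverse quo_one quo_inv quo_mul.
Proof. by move=> x; rewrite -[x]reprK pi_quo_inv pi_quo_mul mulVg. Qed.
Fact quo_Vmul : right_inverse quo_one quo_inv quo_mul.
Proof. by move=> x; rewrite -[x]reprK pi_quo_inv pi_quo_mul mulgV. Qed.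

HB.instance Definition _ := isGroup.Build quotient_group
  quo_mulA quo_mul1 quo_1mul quo_mulV quo_Vmul.

End QuotientGroup.

Section GeneralLinear.
Variables (F : fieldType) (m : nat).

Definition GL : Type := {M : 'M[F]_m | M \in unitmx}.
HB.instance Definition _ := SubChoice.on GL.

Definition GL_one : GL := exist _ 1%:M (unitmx1 F m).
Fact GL_mul_subproof (M N : GL) : val M *m val N \in unitmx.
Proof. by rewrite unitmx_mul (valP M) (valP N). Qed.
Definition GL_mul (M N : GL) : GL :=
  exist (fun A => is_true (A \in unitmx)) _ (GL_mul_subproof M N).
Fact GL_inv_subproof (M : GL) : invmx (val M) \in unitmx.
Proof. by rewrite unitmx_inv (valP M). Qed.
Definition GL_inv (M : GL) : GL :=
  exist (fun A => is_true (A \in unitmx)) _ (GL_inv_subproof M).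

Fact GL_mulA : associative GL_mul.
Proof. by move=> x y z; apply: val_inj; exact: mulmxA. Qed.
Fact GL_mul1 : left_id GL_one GL_mul.
Proof. by move=> x; apply: val_inj; exact: mul1mx. Qed.
Fact GL_1mul : right_id GL_one GL_mul.
Proof. by move=> x; apply: val_inj; exact: mulmx1. Qed.
Fact GL_mulV : left_inverse GL_one GL_inv GL_mul.
Proof. by move=> x; apply: val_inj; exact: mulVmx (valP x). Qed.
Fact GL_Vmul : right_inverse GL_one GL_inv GL_mul.
Proof. by move=> x; apply: val_inj; exact: mulmxV (valP x). Qed.

HB.instance Definition _ := isGroup.Build GL
  GL_mulA GL_mul1 GL_1mul GL_mulV GL_Vmul.

End GeneralLinear.

Section Units.
Variable F : fieldType.

Definition units : Type := {x : F | x != 0}.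
HB.instance Definition _ := SubChoice.on units.

Definition units_one : units := exist _ 1 (oner_neq0 F).
Fact units_mul_subproof (x y : units) : val x * val y != 0.
Proof. by rewrite mulf_neq0 ?(valP x) ?(valP y). Qed.
Definition units_mul (x y : units) : units :=
  exist (fun x => is_true (x != 0)) _ (units_mul_subproof x y).
Fact units_inv_subproof (x : units) : (val x)^-1 != 0.
Proof. by rewrite invr_eq0 (valP x). Qed.
Definition units_inv (x : units) : units :=
  exist (fun x => is_true (x != 0)) _ (units_inv_subproof x).

Fact units_mulA : associative units_mul.
Proof. by move=> x y z; apply: val_inj; exact: mulrA. Qed.
Fact units_mul1 : left_id units_one units_mul.
Proof. by move=> x; apply: val_inj; exact: mul1r. Qed.
Fact units_1mul : right_id units_one units_mul.
Proof. by move=> x; apply: val_inj; exact: mulr1. Qed.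
Fact units_mulV : left_inverse units_one units_inv units_mul.
Proof. by move=> x; apply: val_inj; exact: mulVf (valP x). Qed.
Fact units_Vmul : right_inverse units_one units_inv units_mul.
Proof. by move=> x; apply: val_inj; exact: mulfV (valP x). Qed.

HB.instance Definition _ := isGroup.Build units
  units_mulA units_mul1 units_1mul units_mulV units_Vmul.

End Units.

Section Symplectic.
Variables (F : fieldType) (m : nat) (J : 'M[F]_m).

Definition preserves_form : {pred GL F m} :=
  [pred T | (val T)^T *m J *m val T == J].

Fact preserves_form1 : 1%g \in preserves_form.
Proof. by rewrite inE /= trmx1 mul1mx mulmx1. Qed.
Fact preserves_formM : mulg_closed preserves_form.
Proof.
move=> S T; rewrite !inE /= => /eqP SJ /eqP TJ.
by rewrite trmx_mul !mulmxA -(mulmxA (val T)^T) -(mulmxA (val T)^T) SJ TJ.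
Qed.
Fact preserves_formV : invg_closed preserves_form.
Proof.
move=> T; rewrite !inE /= => /eqP TJ; rewrite -{1}TJ.
rewrite -!mulmxA (mulmxV (valP T)) mulmx1 mulmxA -trmx_mul.
by rewrite (mulmxV (valP T)) trmx1 mul1mx.
Qed.
HB.instance Definition _ := isMulClosed.Build (GL F m) preserves_form preserves_formM.
HB.instance Definition _ := isMul1Closed.Build (GL F m) preserves_form preserves_form1.
HB.instance Definition _ := isInvClosed.Build (GL F m) preserves_form preserves_formV.

Definition Sp : Type := subgroup preserves_form.
HB.instance Definition _ := SubGroup.on Sp.

Definition odd_symplectic : {pred GL F (m + 1)} :=
  [pred M | `[< exists (T : Sp) (a : 'rV[F]_m) (b : units F),
     val M = block_mx (val (val T)) 0 a (val b)%:M >]].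

Fact odd_symplectic1 : 1%g \in odd_symplectic.
Proof.
rewrite inE; exists 1%g, 0, 1%g.
by rewrite /= -scalar_mx_block.
Qed.
Fact odd_symplecticM : mulg_closed odd_symplectic.
Proof.
move=> M N; rewrite !inE => -[T [a [b eM]]] [T' [a' [b' eN]]].
exists (T * T')%g, (a *m val (val T') + val b *: a'), (b * b')%g.
rewrite /= eM eN mulmx_block !(mul0mx, mulmx0, addr0, add0r).
by rewrite mul_scalar_mx -scalar_mxM.
Qed.
Fact odd_symplecticV : invg_closed odd_symplectic.
Proof.
move=> M; rewrite !inE => -[T [a [b eM]]].
exists T^-1%g, (- (val b)^-1 *: (a *m invmx (val (val T)))), b^-1%g.
rewrite /=; apply: (can_inj (mulKmx (valP M))).
rewrite (mulmxV (valP M)) [X in _ = X *m _]eM mulmx_block.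
rewrite !(mul0mx, mulmx0, addr0, add0r) (mulmxV (valP (val T))) mul_scalar_mx.
rewrite scalerA mulrN (mulfV (valP b)) scaleN1r subrr.
by rewrite -scalar_mxM (mulfV (valP b)) -scalar_mx_block.
Qed.
HB.instance Definition _ := isMulClosed.Build (GL F (m + 1)) odd_symplectic odd_symplecticM.
HB.instance Definition _ := isMul1Closed.Build (GL F (m + 1)) odd_symplectic odd_symplectic1.
HB.instance Definition _ := isInvClosed.Build (GL F (m + 1)) odd_symplectic odd_symplecticV.

Definition OddSp : Type := subgroup odd_symplectic.
HB.instance Definition _ := SubGroup.on OddSp.

Definition OddSp_pm1 : {pred OddSp} :=
  [pred M | (val (val M) == 1%:M) || (val (val M) == - 1%:M)].

Fact OddSp_pm1_1 : 1%g \in OddSp_pm1.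
Proof. by rewrite inE eqxx. Qed.
Fact OddSp_pm1M : mulg_closed OddSp_pm1.
Proof.
move=> M N; rewrite !inE /= => /orP[]/eqP-> /orP[]/eqP->;
  by rewrite !(mul1mx, mulmx1, mulNmx, opprK) eqxx ?orbT.
Qed.
Fact OddSp_pm1J (M N : OddSp) : M \in OddSp_pm1 -> (M ^ N)%g \in OddSp_pm1.
Proof.
rewrite !inE /= => /orP[]/eqP->; rewrite ?mulNmx mul1mx ?mulmxN;
  by rewrite (mulVmx (valP (val N))) eqxx ?orbT.
Qed.
Fact OddSp_pm1V : invg_closed OddSp_pm1.
Proof.
move=> M; rewrite !inE /= => /orP[]/eqP E; move: (mulVmx (valP (val M)));
  by rewrite /= E ?mulmxN mulmx1 => /eqP; rewrite ?eqr_oppLR => ->; rewrite ?orbT.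
Qed.
HB.instance Definition _ := isMulClosed.Build OddSp OddSp_pm1 OddSp_pm1M.
HB.instance Definition _ := isMul1Closed.Build OddSp OddSp_pm1 OddSp_pm1_1.
HB.instance Definition _ := isInvClosed.Build OddSp OddSp_pm1 OddSp_pm1V.
HB.instance Definition _ := isConjClosed.Build OddSp OddSp_pm1 OddSp_pm1J.

Definition SpxUnits : Type := (Sp * units F)%type.
HB.instance Definition _ := Group.on SpxUnits.

Definition SpxUnits_pm1 : {pred SpxUnits} :=
  [pred x | (val (val x.1) == 1%:M) && (val x.2 == 1)
         || (val (val x.1) == - 1%:M) && (val x.2 == - 1)].

Fact SpxUnits_pm1_1 : 1%g \in SpxUnits_pm1.
Proof. by rewrite inE /= !eqxx. Qed.
Fact SpxUnits_pm1M : mulg_closed SpxUnits_pm1.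
Proof.
move=> x y; rewrite !inE /=.
move=> /orP[]/andP[/eqP-> /eqP->] /orP[]/andP[/eqP-> /eqP->];
  by rewrite !(mul1mx, mulmx1, mulNmx, opprK, mul1r, mulr1, mulN1r) !eqxx ?orbT.
Qed.
Fact SpxUnits_pm1J (x y : SpxUnits) :
  x \in SpxUnits_pm1 -> (x ^ y)%g \in SpxUnits_pm1.
Proof.
rewrite !inE /= => /orP[]/andP[/eqP-> /eqP->];
  rewrite ?mulNmx mul1mx ?mulmxN (mulVmx (valP (val y.1)));
  by rewrite ?mulN1r ?mul1r ?mulrN (mulVf (valP y.2)) !eqxx ?orbT.
Qed.
Fact SpxUnits_pm1V : invg_closed SpxUnits_pm1.
Proof.
move=> x; rewrite !inE /= => /orP[]/andP[/eqP E /eqP->];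
  move: (mulVmx (valP (val x.1))); rewrite /= E ?mulmxN mulmx1 => /eqP;
  by rewrite ?eqr_oppLR ?invrN invr1 => ->; rewrite eqxx ?orbT.
Qed.
HB.instance Definition _ := isMulClosed.Build SpxUnits SpxUnits_pm1 SpxUnits_pm1M.
HB.instance Definition _ := isMul1Closed.Build SpxUnits SpxUnits_pm1 SpxUnits_pm1_1.
HB.instance Definition _ := isInvClosed.Build SpxUnits SpxUnits_pm1 SpxUnits_pm1V.
HB.instance Definition _ := isConjClosed.Build SpxUnits SpxUnits_pm1 SpxUnits_pm1J.

End Symplectic.

Arguments OddSp_pm1 {F m} J.
Arguments SpxUnits_pm1 {F m} J.

Section ProjectiveSpace.
Variables (F : fieldType) (V : vectType F).

Definition proj : Type := {L : {vspace V} | \dim L == 1%N}.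
HB.instance Definition _ := SubChoice.on proj.

(** Polynomials on V are polynomials in the coordinates of the basis
    [vbasis {:V}]; the notions defined from them below do not depend on the
    basis. *)
Definition peval (p : {mpoly F[\dim {:V}]}) (v : V) : F :=
  p.@[fun i => coord (vbasis {:V}) i v].

Definition vanishes_at (p : {mpoly F[\dim {:V}]}) (x : proj) : Prop :=
  forall v, v \in val x -> peval p v = 0.

Local Open Scope classical_set_scope.

Definition zariski_closed (Z : set proj) : Prop :=
  exists S : set {mpoly F[\dim {:V}]},
    (forall p, S p -> exists d : nat, p \is d.-homog) /\
    Z = [set x | forall p, S p -> vanishes_at p x].

Definition zariski_open (U : set proj) : Prop := zariski_closed (~` U).

Lemma peval_scale (p : {mpoly F[\dim {:V}]}) d c v :
  p \is d.-homog -> peval p (c *: v) = c ^+ d * peval p v.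
Proof.
move=> /dhomogP hp; rewrite /peval !mevalE mulr_sumr !big_seq.
apply: eq_bigr => m /hp <-; rewrite mulrCA; congr (_ * _).
rewrite /= mdegE -prodrXr -big_split /=; apply: eq_bigr => i _.
by rewrite linearZ /= exprMn.
Qed.

Lemma proj_line (x : proj) (v : V) : v \in val x -> v != 0 -> val x = <[v]>%VS.
Proof.
move=> vx v0; apply/esym/eqP; rewrite eqEdim -memvE vx /=.
by rewrite (eqP (valP x)) dim_vline v0.
Qed.

Lemma proj_ex (x : proj) : exists2 v, v \in val x & v != 0.
Proof.
exists (vpick (val x)); first exact: memv_pick.
by rewrite vpick0 -dimv_eq0 (eqP (valP x)).
Qed.

Lemma vanishes_atP (p : {mpoly F[\dim {:V}]}) d (x : proj) v :
  p \is d.-homog -> v \in val x -> v != 0 ->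
  (vanishes_at p x <-> peval p v = 0).
Proof.
move=> hp vx v0; split=> [|pv w]; first exact.
rewrite (proj_line vx v0) => /vlineP[c ->].
by rewrite (peval_scale _ _ hp) pv mulr0.
Qed.

Lemma zariski_closedU (Y Z : set proj) :
  zariski_closed Y -> zariski_closed Z -> zariski_closed (Y `|` Z).
Proof.
move=> [S [hS ->]] [T [hT ->]].
exists [set r | exists p q, [/\ S p, T q & r = p * q]]; split.
  move=> _ [p [q [/hS[d hp] /hT[e hq] ->]]].
  by exists (d + e)%N; exact: dhomogM.
apply/seteqP; split=> x /=.
  move=> [] h _ [p [q [Sp Tq ->]]] v vx; rewrite /peval mevalM.
    by have := h p Sp v vx; rewrite /peval => ->; rewrite mul0r.
  by have := h q Tq v vx; rewrite /peval => ->; rewrite mulr0.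
move=> h; have [v vx v0] := proj_ex x.
have [|nS] := pselect (forall p, S p -> vanishes_at p x); first by left.
right=> q Tq; have [e hq] := hT q Tq; apply/(vanishes_atP hq vx v0).
have [p Sp npx] : exists2 p, S p & ~ vanishes_at p x.
  apply: contrapT => np; apply: nS => p Sp; apply: contrapT => npx.
  by apply: np; exists p.
have [d hp] := hS p Sp.
have /eqP : peval (p * q) v = 0 by apply: h => //; exists p, q.
rewrite /peval mevalM mulf_eq0 => /orP[/eqP pv|/eqP //].
by case: npx; apply/(vanishes_atP hp vx v0).
Qed.

Lemma zariski_openI (Y Z : set proj) :
  zariski_open Y -> zariski_open Z -> zariski_open (Y `&` Z).
Proof. by rewrite /zariski_open setCI; exact: zariski_closedU. Qed.

Lemma zariski_openT : zariski_open [set: proj].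
Proof.
exists [set 1]; split=> [p ->|]; first by exists 0%N; exact: dhomog1.
rewrite setCT; apply/seteqP; split=> x //= /(_ 1 erefl).
have [v vx _] := proj_ex x.
by move=> /(_ v vx) /eqP; rewrite /peval meval1 oner_eq0.
Qed.

End ProjectiveSpace.

Section PolynomialMap.
Variables (F : fieldType) (V W : vectType F).

Definition poly_map (P : 'I_(\dim {:W}) -> {mpoly F[\dim {:V}]}) (v : V) : W :=
  \sum_i peval (P i) v *: (vbasis {:W})`_i.

Local Open Scope classical_set_scope.

(** A map is regular if, locally for the Zariski topology, it is given by
    homogeneous polynomials of the same degree without common zero. That
    [poly_map P v] is nonzero is implied, as [f y] is a line. *)
Definition regular (X : set (proj V)) (Y : set (proj W)) (f : X -> Y) : Prop :=
  forall x : X, exists (U : set (proj V)) (d : nat)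
      (P : 'I_(\dim {:W}) -> {mpoly F[\dim {:V}]}),
    [/\ zariski_open U, U (val x), (forall i, P i \is d.-homog) &
        forall y : X, U (val y) -> forall v, v \in val (val y) -> v != 0 ->
          val (val (f y)) = <[poly_map P v]>%VS].

Lemma coord_poly_map P v i : coord (vbasis {:W}) i (poly_map P v) = peval (P i) v.
Proof. by rewrite coord_sum_free // (basis_free (vbasisP _)). Qed.

End PolynomialMap.

Section Composition.
Variables (F : fieldType) (V W : vectType F).
Variables (P : 'I_(\dim {:W}) -> {mpoly F[\dim {:V}]}) (d : nat).
Hypothesis hP : forall i, P i \is d.-homog.

Definition pcomp (q : {mpoly F[\dim {:W}]}) : {mpoly F[\dim {:V}]} :=
  comp_mpoly [tuple P i | i < \dim {:W}] q.

Lemma peval_comp q v : peval (pcomp q) v = peval q (poly_map P v).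
Proof.
rewrite /pcomp /peval comp_mpoly_meval; apply: meval_eq => i.
by rewrite tnth_mktuple coord_poly_map.
Qed.

Lemma pcomp_homog q e : q \is e.-homog -> pcomp q \is (e * d).-homog.
Proof.
move=> /dhomogP hq; rewrite /pcomp comp_mpolyEX big_seq.
apply: rpred_sum => m /hq <-; apply: rpredZ; rewrite comp_mpolyX /= mdegE big_distrl /=.
elim/big_rec2: _ => [|i p e' _ hp]; first exact: dhomog1.
by apply: dhomogM => //; rewrite tnth_mktuple mulnC; exact: dhomogMn.
Qed.

End Composition.

Section RegularCategory.
Variables (F : fieldType) (V W Z : vectType F).
Local Open Scope classical_set_scope.

Lemma regular_id (X : set (proj V)) : regular (fun x : X => x).
Proof.
move=> x; exists setT, 1%N, (fun i => 'X_i); split=> // [|i|y _ v vy v0].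
- exact: zariski_openT.
- by rewrite dhomogX /= mdeg1.
- rewrite (proj_line vy v0); congr (<[_]>%VS).
  rewrite {1}(coord_vbasis (memvf v)); apply: eq_bigr => i _.
  by rewrite /peval mevalXU.
Qed.

Lemma poly_map_open (U : set (proj W)) (P : 'I_(\dim {:W}) -> {mpoly F[\dim {:V}]})
    d : (forall i, P i \is d.-homog) -> zariski_open U ->
  exists2 U' : set (proj V), zariski_open U' &
    forall (x : proj V) (y : proj W) v, v \in val x -> v != 0 ->
      val y = <[poly_map P v]>%VS -> (U' x <-> U y).
Proof.
move=> hP [S [hS eU]].
exists (~` [set x | forall p, S p -> vanishes_at (pcomp P p) x]).
  rewrite /zariski_open setCK; exists [set pcomp P p | p in S]; split.
    by move=> _ [p /hS[e hp] <-]; exists (e * d)%N; exact: pcomp_homog.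
  apply/seteqP; split=> x /= h; first by move=> _ [p Sp <-]; exact: h.
  by move=> p Sp; apply: h; exists p.
move=> x y v vx v0 ey.
have Pv : poly_map P v \in val y by rewrite ey memv_line.
have Pv0 : poly_map P v != 0.
  by have /eqP := valP y; rewrite ey dim_vline; case: (_ == 0).
suff E : (forall p, S p -> vanishes_at (pcomp P p) x) <-> (~` U) y.
  split=> [nS|Uy /E /(_ Uy) //]; apply: contrapT => /E; exact: nS.
rewrite eU /=; split=> h p Sp; have [e hp] := hS p Sp; have := h p Sp.
  by move=> /(_ v vx); rewrite peval_comp => /(vanishes_atP hp Pv Pv0).
move=> /(_ _ Pv) pv; apply/(vanishes_atP (pcomp_homog hP hp) vx v0).
by rewrite peval_comp.
Qed.

Lemma regular_comp (A : set (proj V)) (B : set (proj W)) (C : set (proj Z))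
    (g : B -> C) (f : A -> B) :
  regular g -> regular f -> regular (g \o f).
Proof.
move=> rg rf x.
have [U [d [P [oU Ux hP fP]]]] := rf x.
have [U' [e [Q [oU' Ufx hQ gQ]]]] := rg (f x).
have [U'' oU'' hU''] := poly_map_open hP oU'.
exists (U `&` U''), (e * d)%N, (fun i => pcomp P (Q i)); split.
- exact: zariski_openI.
- split=> //; have [v vx v0] := proj_ex (val x).
  by apply/(hU'' _ (val (f x)) v vx v0) => //; exact: fP.
- by move=> i; exact: pcomp_homog.
- move=> y [Uy U''y] v vy v0 /=.
  have ey := fP y Uy v vy v0.
  have -> : poly_map (fun i => pcomp P (Q i)) v = poly_map Q (poly_map P v).
    by apply: eq_bigr => i _; rewrite peval_comp.
  apply: gQ; first exact/(hU'' _ _ v vy v0 ey).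
    by rewrite ey memv_line.
  by have /eqP := valP (val (f y)); rewrite ey dim_vline; case: (_ == 0).
Qed.

End RegularCategory.

Section AutomorphismGroup.
Variables (F : fieldType) (V : vectType F) (X : set (proj V)).

Definition is_automorphism (f : X -> X) : Prop :=
  regular f /\ exists g : X -> X, [/\ regular g, cancel f g & cancel g f].

Definition Aut : Type := {f : X -> X | `[< is_automorphism f >]}.
HB.instance Definition _ := SubChoice.on Aut.

Fact Aut_inv_ex (f : Aut) :
  exists g : Aut, cancel (val f) (val g) /\ cancel (val g) (val f).
Proof.
case: f => f pf; have [rf [g [rg fg gf]]] := asboolW pf.
have pg : `[< is_automorphism g >] by apply/asboolP; split=> //; exists f.
by exists (exist (fun f => is_true `[< is_automorphism f >]) g pg).
Qed.

Definition Aut_inv (f : Aut) : Aut := sval (cid (Aut_inv_ex f)).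

Fact Aut_one_subproof : `[< is_automorphism (fun x : X => x) >].
Proof.
apply/asboolP; split; first exact: regular_id.
by exists (fun x => x); split=> //; exact: regular_id.
Qed.
Definition Aut_one : Aut :=
  exist (fun f => is_true `[< is_automorphism f >]) _ Aut_one_subproof.

Fact Aut_mul_subproof (f g : Aut) : `[< is_automorphism (val f \o val g) >].
Proof.
have [rf [f' [rf' ff' f'f]]] := asboolW (valP f).
have [rg [g' [rg' gg' g'g]]] := asboolW (valP g).
apply/asboolP; split; first exact: regular_comp.
by exists (g' \o f'); split; [exact: regular_comp | exact: can_comp..].
Qed.
Definition Aut_mul (f g : Aut) : Aut :=
  exist (fun f => is_true `[< is_automorphism f >]) _ (Aut_mul_subproof f g).

Fact Aut_mulA : associative Aut_mul.
Proof. by move=> f g h; exact: val_inj. Qed.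
Fact Aut_mul1 : left_id Aut_one Aut_mul.
Proof. by move=> f; exact: val_inj. Qed.
Fact Aut_1mul : right_id Aut_one Aut_mul.
Proof. by move=> f; exact: val_inj. Qed.
Fact Aut_mulV : left_inverse Aut_one Aut_inv Aut_mul.
Proof.
move=> f; apply: val_inj; apply: funext => x; rewrite /Aut_inv.
by case: cid => g /= [fg _]; exact: fg.
Qed.
Fact Aut_Vmul : right_inverse Aut_one Aut_inv Aut_mul.
Proof.
move=> f; apply: val_inj; apply: funext => x; rewrite /Aut_inv.
by case: cid => g /= [_ gf]; exact: gf.
Qed.

HB.instance Definition _ := isGroup.Build Aut
  Aut_mulA Aut_mul1 Aut_1mul Aut_mulV Aut_Vmul.

End AutomorphismGroup.

Section Grassmannian.
Variables (F : fieldType) (m : nat).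

(** The second exterior power of the column space F^m, as the space of
    antisymmetric matrices, with p /\ q := p q^T - q p^T. The entries i < j of
    the matrix p /\ q are the Pluecker coordinates p_i q_j - p_j q_i. Antisymmetric
    is the same as alternating only in characteristic different from 2. *)
Definition antisym : {vspace 'M[F]_m} :=
  lker (\1%VF + linfun (@trmx F m m) : 'End('M[F]_m))%R.

Lemma antisymP (B : 'M[F]_m) : reflect (B^T = - B) (B \in antisym).
Proof.
rewrite memv_ker add_lfunE id_lfunE lfunE /= addrC addr_eq0.
exact: eqP.
Qed.

Definition ext2 := subvs_of antisym.

Fact wedge_subproof (p q : 'cV[F]_m) : p *m q^T - q *m p^T \in antisym.
Proof. by apply/antisymP; rewrite linearB /= !trmx_mul !trmxK opprB. Qed.
Definition wedge (p q : 'cV[F]_m) : ext2 := Subvs (wedge_subproof p q).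

Local Open Scope classical_set_scope.

Definition grassmannian : set (proj ext2) :=
  [set x : proj ext2 | exists L : {vspace 'cV[F]_m}, \dim L = 2%N /\
     exists p q, L = <<[:: p; q]>>%VS /\ val x = <[wedge p q]>%VS].

(** For w = p /\ q the sum is p^T A q, see [hyperplane_wedge]. *)
Definition hyperplane (A : 'M[F]_m) : set (proj ext2) :=
  [set x : proj ext2 | forall w : ext2, w \in val x ->
     \sum_(i < m) \sum_(j < m | (i < j)%N) A i j * vsval w i j = 0].

Lemma hyperplane_wedge (A : 'M[F]_m) (p q : 'cV[F]_m) (x : proj ext2) :
  A^T = - A -> (forall i, A i i = 0) -> val x = <[wedge p q]>%VS ->
  hyperplane A x <-> (p^T *m A *m q) 0 0 = 0.
Proof.
move=> hA hA0 ex.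
pose f (w : ext2) := \sum_(i < m) \sum_(j < m | (i < j)%N) A i j * vsval w i j.
have fE : f (wedge p q) = (p^T *m A *m q) 0 0.
  have hN i j : A j i = - A i j by have /matrixP/(_ i j) := hA; rewrite !mxE.
  have wE i j : vsval (wedge p q) i j = p i 0 * q j 0 - q i 0 * p j 0.
    by rewrite /= !mxE !big_ord1 !mxE.
  transitivity (\sum_i \sum_j p i 0 * A i j * q j 0); last first.
    rewrite exchange_big mxE; apply: eq_bigr => j _.
    by rewrite !mxE big_distrl; apply: eq_bigr => i _; rewrite mxE.
  have split_ij (G : 'I_m -> 'I_m -> F) : (forall i, G i i = 0) ->
    \sum_i \sum_j G i j = \sum_(i < m) \sum_(j < m | (i < j)%N) (G i j + G j i).
    move=> G0; under [RHS]eq_bigr => i _ do rewrite big_split /=.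
    rewrite big_split /= [X in _ = _ + X](exchange_big_dep predT) //= -big_split /=.
    apply: eq_bigr => i _; rewrite (bigID (fun j : 'I_m => (i < j)%N)) /=.
    congr (_ + _); rewrite (bigD1 i) ?ltnn //= G0 add0r; apply: eq_bigl => j.
    by rewrite -leqNgt ltn_neqAle andbC -(inj_eq val_inj).
  rewrite (split_ij (fun i j => p i 0 * A i j * q j 0)); last first.
    by move=> i; rewrite hA0 mulr0 mul0r.
  apply: eq_bigr => i _; apply: eq_bigr => j _; rewrite wE (hN i j) mulrBr.
  by rewrite mulrN mulNr mulrA (mulrC (A i j)) (mulrC (q i 0)) mulrA (mulrC (A i j)).
rewrite /hyperplane /= ex -fE; split=> [h|h w /vlineP[c ->]].
  by apply: h; exact: memv_line.
transitivity (c * f (wedge p q)); last by rewrite h mulr0.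
rewrite /f mulr_sumr; apply: eq_bigr => i _; rewrite mulr_sumr.
by apply: eq_bigr => j _; rewrite linearZ /= [X in _ * X]mxE mulrCA.
Qed.

End Grassmannian.

Arguments grassmannian F m : clear implicits.

(* Main.v *)
(** Over the affine cone of [X], write [psi v w u = v /\ (A(v,u) w - A(v,w) u)]: this
    parametrizes the isotropic bivectors by all triples of vectors. An automorphism of
    [X] pulled back along [psi] is, by unique factorization in a polynomial ring,
    given by one vector of polynomials without common factor. It is multihomogeneous,
    and constancy along lines in the fibres of [psi] makes it descend to a homogeneous
    map [G] on the cone. On pencils of lines [G] and the lift of the inverse automorphism
    compose to a scalar, which forces degree 1, so [G] is linear on every pencil.

    The bivectors through the kernel [c] of [A] form a linear space of
    dimension [2n >= 4]; linear spaces of decomposable bivectors of that size are made of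
    bivectors with a common factor, and the factor of the image is [c] again because the
    isotropic bivectors through any other vector only form a space of dimension [2n-1].
    This reads off [T] with [G (c /\ x) = c /\ T x], then [T] is
    seen to be a symplectic similitude, and [G] to be induced by [T], a scalar
    and a row vector. In a frame where [A] is [J] plus a zero row and column, scaling by a
    square root makes [OddSp J] surject onto [Aut X] with kernel [+-1]; the extension
    is then read off the diagonal blocks. *)

From HB Require Import structures.
Require Import Defs.
From mathcomp Require Import all_boot all_algebra.
From mathcomp Require Import generic_quotient boolp classical_sets mpoly ring.
From mathcomp Require Import reals complex.

Set Implicit Arguments.
Unset Strict Implicit.
Unset Printing Implicit Defensive.

Import GRing.Theory Num.Theory.
Local Open Scope ring_scope.

(** * Unique factorization in polynomial rings *)

(** The usual reason for linearity is that the hyperplane class generates the Picard group of [X].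
    Here a polynomial ring replaces that group: on an affine space, a field of lines that is locally
    polynomial has, by unique factorization, a global polynomial generator, unique up to constants.
    Pairs [v, w] with [A(v,w) = 0] would be the natural parameters, but they form a quadric
    hypersurface, whose coordinate ring is not a polynomial ring. The third vector [u] buys an
    unconstrained space: [A(v,u) w - A(v,w) u] is orthogonal to [v] whatever [w] and [u] are, and it
    is [w] when [A(v,w) = 0] and [A(v,u) = 1]. The price is a fibre along which to descend. Two
    facts are used throughout: over an algebraically closed field a univariate polynomial without
    zeros is constant, and one with no zero but 0 is a monomial. The bound [2n >= 4] matters because
    the bivectors of a three-dimensional space are all decomposable and have no common factor. *)

Section Factorial.
Variable R : idomainType.
Implicit Types a b c p q u : R.

Definition divides a b := exists c, b = c * a.

Definition prime_elt p := [/\ p != 0, p \isn't a GRing.unit &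
  forall a b, divides p (a * b) -> divides p a \/ divides p b].

(** The factors are prime for divisibility, not merely irreducible, so uniqueness is built in and
    the existence of such a product is all of unique factorization. *)
Definition factored a := exists s u,
  [/\ u \is a GRing.unit, forall p, p \in s -> prime_elt p & a = u * \prod_(p <- s) p].

Definition factorial_ring := forall a, a != 0 -> factored a.

Lemma dividesrr a : divides a a.
Proof. by exists 1; rewrite mul1r. Qed.

Lemma divides_mull a b c : divides a b -> divides a (c * b).
Proof. by move=> [d ->]; exists (c * d); rewrite mulrA. Qed.

Lemma divides_mulr a b c : divides a b -> divides a (b * c).
Proof. by rewrite mulrC; exact: divides_mull. Qed.

Lemma divides_trans b a c : divides a b -> divides b c -> divides a c.
Proof. by move=> ab [d ->]; exact: divides_mull. Qed.

Lemma dividesD a b c : divides a b -> divides a c -> divides a (b + c).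
Proof. by move=> [d ->] [e ->]; exists (d + e); rewrite mulrDl. Qed.

Lemma dividesB a b c : divides a b -> divides a c -> divides a (b - c).
Proof. by move=> [d ->] [e ->]; exists (d - e); rewrite mulrBl. Qed.

Lemma divides_unit a u : u \is a GRing.unit -> divides a u -> a \is a GRing.unit.
Proof. by move=> uu [c e]; move: uu; rewrite e unitrM => /andP[]. Qed.

Lemma factored_unit u : u \is a GRing.unit -> factored u.
Proof. by move=> uu; exists [::], u; rewrite big_nil mulr1. Qed.

Lemma factored_prime p : prime_elt p -> factored p.
Proof.
move=> pp; exists [:: p], 1; split; [exact: unitr1| |by rewrite big_seq1 mul1r].
by move=> q; rewrite inE => /eqP->.
Qed.

Lemma factoredM a b : factored a -> factored b -> factored (a * b).
Proof.
move=> [s [u [uu sp ->]]] [t [v [vu tp ->]]]; exists (s ++ t), (u * v).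
split; first by rewrite unitrM uu.
  by move=> p; rewrite mem_cat => /orP[/sp|/tp].
by rewrite big_cat /= mulrACA.
Qed.

Lemma factorial_ind (P : R -> Prop) : factorial_ring ->
  (forall u, u \is a GRing.unit -> P u) ->
  (forall p a, prime_elt p -> a != 0 -> P a -> P (p * a)) ->
  forall a, a != 0 -> P a.
Proof.
move=> fR Pu Pp a /fR[s [u [uu + ->]]].
elim: s => [|p s IHs] sp; first by rewrite big_nil mulr1; exact: Pu.
rewrite big_cons mulrCA; apply: Pp; first by apply: sp; rewrite mem_head.
  rewrite mulf_neq0 //; first by apply: contraTneq uu => ->; rewrite unitr0.
  rewrite prodf_seq_neq0; apply/allP => q qs /=.
  by have [] := sp q (mem_behead (s := p :: s) qs).
by apply: IHs => q qs; apply: sp; rewrite inE qs orbT.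
Qed.

Lemma prime_divides_prod p (s : seq R) : prime_elt p ->
  divides p (\prod_(q <- s) q) -> exists2 q, q \in s & divides p q.
Proof.
move=> [p0 pu pp]; elim: s => [|q s IHs].
  by rewrite big_nil => /(divides_unit (unitr1 _)); rewrite (negPf pu).
rewrite big_cons => /pp[pq|/IHs[r rs pr]]; first by exists q; rewrite ?mem_head.
by exists r; rewrite // inE rs orbT.
Qed.

Lemma prime_divides_assoc p q : prime_elt p -> prime_elt q -> divides p q ->
  exists2 u, u \is a GRing.unit & q = u * p.
Proof.
move=> [p0 pu _] [q0 qu qp] [c e]; exists c => //.
have [|[d ed]|[d ed]] := qp c p; first by rewrite -e; exact: dividesrr.
- suff /eqP : 1 = d * p.
    move=> /eqP E; case/negP: pu; apply: (@divides_unit p 1); rewrite ?unitr1 //.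
    by exists d.
  apply: (mulIf q0); rewrite mul1r {1}e ed -!mulrA; congr (_ * _).
  by rewrite mulrC.
- have : 1 = d * c.
    by apply: (mulfI p0); rewrite mulr1 {1}ed {1}e mulrA mulrC.
  by move=> E; apply: (@divides_unit c 1); rewrite ?unitr1 //; exists d.
Qed.

Lemma nonunit_prime_factor a : factorial_ring -> a != 0 ->
  a \isn't a GRing.unit -> exists2 p, prime_elt p & divides p a.
Proof.
move=> fR a0; elim/factorial_ind: a / a0 => // [u ->//|p a pp _ _ _].
by exists p => //; exact: divides_mulr (dividesrr p).
Qed.

(** A greatest common divisor for a family of any size: a prime dividing all entries divides [F i0],
    so dividing it out shortens the factorization of that one entry, on whose length the induction
    runs. *)
Lemma content_vector I (F : I -> R) i0 : factorial_ring -> F i0 != 0 ->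
  exists a G, (forall i, F i = a * G i) /\
    forall p, prime_elt p -> exists i, ~ divides p (G i).
Proof.
move=> fR F0; have [s [u []]] := fR _ F0; move: {2}(size s) (erefl (size s)) => n.
elim: n s u F F0 => [|n IHn] s u F F0 ss uu sp ef.
  exists 1, F; split=> [i|p [_ pu _]]; first by rewrite mul1r.
  exists i0; rewrite ef (size0nil ss) big_nil mulr1 => /(divides_unit uu).
  by rewrite (negPf pu).
have [cF|ncF] := pselect (forall p, prime_elt p -> exists i, ~ divides p (F i)).
  by exists 1, F; split=> // i; rewrite mul1r.
have [p pp /choice[G FG]] : exists2 p, prime_elt p & forall i, divides p (F i).
  apply: contrapT => np; apply: ncF => p pp; apply: contrapT => npF; apply: np.
  by exists p => // i; apply: contrapT => nF; apply: npF; exists i.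
have [p0 pu pP] := pp.
have G0 : G i0 != 0 by apply: contraNneq F0 => G0; rewrite FG G0 mul0r.
have lG : u * \prod_(q <- s) q = G i0 * p by rewrite -ef FG.
have [|pu'|] := pP u (\prod_(q <- s) q); first by rewrite lG; exists (G i0).
  by move: pu; rewrite (divides_unit uu pu').
move=> /(prime_divides_prod pp)[q qs pq].
have [v vu eq_] := prime_divides_assoc pp (sp q qs) pq.
have [||||a [H [GH cH]]] := IHn (rem q s) (u * v) G G0 _ _ _ _.
- by rewrite size_rem // ss.
- by rewrite unitrM uu.
- by move=> r /mem_rem; exact: sp.
- apply: (mulIf p0); rewrite -lG (perm_big _ (perm_to_rem qs)) big_cons /= {1}eq_.
  by rewrite -!mulrA; congr (_ * (_ * _)); rewrite mulrC.
- by exists (p * a), H; split=> // i; rewrite FG GH mulrC mulrA.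
Qed.

(* Relative Gauss lemma for a vector of coprime entries. *)
Lemma divides_coprime_vector I (F : I -> R) d e : factorial_ring ->
  (forall p, prime_elt p -> exists i, ~ divides p (F i)) -> d != 0 ->
  (forall i, divides d (e * F i)) -> divides d e.
Proof.
move=> fR cF d0; elim/factorial_ind: d / d0 e => // [u uu|p a pp a0 IH] e dF.
  by exists (e * u^-1); rewrite mulrVK.
have [i npF] := cF _ pp; have [p0 _ pP] := pp.
have [//|[c ec]|//] := pP e (F i).
  by apply: divides_trans (dF i); exact: divides_mulr (dividesrr p).
have /IH[c' ec'] : forall j, divides a (c * F j).
  move=> j; have [g eg] := dF j; exists g; apply: (mulfI p0).
  by rewrite mulrA [p * c]mulrC -ec eg mulrCA.
by exists c'; rewrite ec ec' -mulrA [a * p]mulrC.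
Qed.

End Factorial.

(** * Gauss's lemma and univariate polynomials over a factorial ring *)

Section FactorialPoly.
Variable R : idomainType.
Hypothesis fR : factorial_ring R.
Implicit Types (p a c : R) (f g h : {poly R}).

Lemma divides_polyC p f : divides p%:P f <-> forall i, divides p f`_i.
Proof.
split=> [[g ->] i|pf]; first by rewrite coefMC; exact: divides_mull (dividesrr p).
have [c cE] := choice pf.
exists (\poly_(i < size f) c i); apply/polyP => i.
by rewrite coefMC coef_poly; case: ltnP => [_|si]; [exact: cE | rewrite mul0r nth_default].
Qed.

Lemma prime_polyC p : prime_elt p -> prime_elt p%:P.
Proof.
move=> [p0 pu pp]; split; first by rewrite polyC_eq0.
  by rewrite poly_unitE coefC size_polyC p0 (negPf pu) andbF.
move=> f g; have [n] := ubnP (size f + size g).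
elim: n f g => // n IHn f g /ltnSE le_n pfg.
have [->|f0] := eqVneq f 0; first by left; exists 0; rewrite mul0r.
have [->|g0] := eqVneq g 0; first by right; exists 0; rewrite mul0r.
have peel h : h != 0 -> divides p (lead_coef h) ->
    exists h', (size h' < size h)%N /\ divides p%:P (h - h').
  move=> h0 [c ec]; exists (take_poly (size h).-1 h); split.
    apply: leq_ltn_trans (size_take_poly _ _) _.
    by rewrite prednK // size_poly_gt0.
  apply/divides_polyC => i; rewrite coefB coef_take_poly.
  case: (ltngtP i (size h).-1) => [_|lt|->].
  - by rewrite subrr; exists 0; rewrite mul0r.
  - rewrite nth_default ?subr0; first by exists 0; rewrite mul0r.
    by rewrite -(prednK (n := size h)) ?size_poly_gt0.
  - by rewrite subr0; exists c; rewrite -ec.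
have [||] := pp (lead_coef f) (lead_coef g).
- by rewrite -lead_coefM; move/divides_polyC: pfg; apply.
- move=> /(peel _ f0)[f' [sf' pf']].
  have [|||] := IHn f' g.
  + by apply: leq_trans le_n; rewrite ltn_add2r.
  + have -> : f' * g = f * g - (f - f') * g by rewrite mulrBl opprB addrC subrK.
    by apply: dividesB => //; exact: divides_mulr.
  + by move=> pf; left; rewrite -[f](subrK f'); exact: dividesD.
  + by right.
- move=> /(peel _ g0)[g' [sg' pg']].
  have [|||] := IHn f g'.
  + by apply: leq_trans le_n; rewrite ltn_add2l.
  + have -> : f * g' = f * g - f * (g - g') by rewrite mulrBr opprB addrC subrK.
    by apply: dividesB => //; exact: divides_mull.
  + by left.
  + by move=> pg; right; rewrite -[g](subrK g'); exact: dividesD.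
Qed.

Definition primitive f := forall p, prime_elt p -> ~ divides p%:P f.

Lemma primitive_divides f g : divides g f -> primitive f -> primitive g.
Proof. by move=> gf pf p pp pg; apply: (pf p pp); exact: divides_trans gf. Qed.

Lemma primitive_const c : primitive c%:P -> c != 0 -> c \is a GRing.unit.
Proof.
move=> pc c0; apply/negPn/negP => /(nonunit_prime_factor fR c0)[p pp [d ed]].
by apply: (pc p pp); exists d%:P; rewrite ed polyCM.
Qed.

Lemma content_primitive f : f != 0 ->
  exists a g, [/\ a != 0, primitive g & f = a%:P * g].
Proof.
move=> f0; have l0 : f`_(size f).-1 != 0 by rewrite -lead_coefE lead_coef_eq0.
have [a [F [fF cF]]] := content_vector fR (F := fun i => f`_i) l0.
have a0 : a != 0 by apply: contraNneq l0 => a0; rewrite fF a0 mul0r.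
have Fg i : (\poly_(j < size f) F j)`_i = F i.
  rewrite coef_poly; case: ltnP => // si; apply: (mulfI a0).
  by rewrite -fF nth_default // mulr0.
exists a, (\poly_(j < size f) F j); split => //.
  by move=> p /cF[i npF] /divides_polyC/(_ i); rewrite Fg.
by apply/polyP => i; rewrite coefCM Fg fF.
Qed.

(** The primes of [a] are cancelled one at a time: each divides the product of [g] and its cofactor,
    but not the primitive [g]. *)
Lemma primitive_divides_cancel f g a : primitive g -> a != 0 ->
  divides g (a%:P * f) -> divides g f.
Proof.
move=> pg a0; elim/factorial_ind: a / a0 f => // [u uu|p a pp a0 IHa] f [k ek].
  exists ((u^-1)%:P * k); rewrite -mulrA -ek mulrA -polyCM mulVr // mul1r //.
have [p0 pu _] := pp; have [_ _ pP] := prime_polyC pp.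
have [|[k' ek']|pg'] := pP k g.
- by rewrite -ek polyCM -mulrA; exact: divides_mulr (dividesrr _).
- apply: IHa; exists k'; apply: (@mulfI _ p%:P); first by rewrite polyC_eq0.
  transitivity ((p * a)%:P * f); first by rewrite polyCM -mulrA.
  by rewrite ek ek' mulrAC mulrC.
- by case: (pg p pp).
Qed.

(** The Euclidean argument over the fraction field, kept inside [R] by pseudo-division: an element
    of least size in the ideal of [f] and [g] has a primitive part dividing both, and irreducibility
    makes it either [f] up to a unit or a constant. *)
Lemma primitive_irreducible_prime f : primitive f -> (1 < size f)%N ->
  (forall g h, f = g * h -> size g = 1%N \/ size h = 1%N) -> prime_elt f.
Proof.
move=> pf sf irr.
have f0 : f != 0 by rewrite -size_poly_gt0 (ltn_trans _ sf).
split=> //; first by rewrite poly_unitE gtn_eqF.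
move=> g h fgh; have [fg|nfg] := pselect (divides f g); [by left|right].
pose J m := exists u v, m = u * f + v * g.
pose Q n := `[< exists m, [/\ m != 0, J m & size m = n] >].
have exQ : exists n, Q n.
  exists (size f); apply/asboolP; exists f; split=> //.
  by exists 1, 0; rewrite mul1r mul0r addr0.
case: (ex_minnP exQ) => n /asboolP[m [m0 [u [v em]] sm]] minm.
have mJ x : J x -> exists2 c, c != 0 & divides m (c%:P * x).
  move=> [u' [v' ex]]; exists (lead_coef m ^+ scalp x m).
    by rewrite expf_neq0 ?lead_coef_eq0.
  exists (x %/ m).
  have eqx := Pdiv.Idomain.divp_eq x m.
  have [r0|r0] := eqVneq (x %% m) 0; first by rewrite mul_polyC eqx r0 addr0.
  have : Q (size (x %% m)).
    apply/asboolP; exists (x %% m); split=> //.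
    have -> : x %% m = lead_coef m ^+ scalp x m *: x - x %/ m * m.
      by rewrite eqx addrC addKr.
    rewrite -mul_polyC; set c := _%:P; set q := x %/ m.
    exists (c * u' - q * u), (c * v' - q * v).
    by rewrite em ex; ring.
  by move=> /minm; rewrite -sm leqNgt Pdiv.Idomain.ltn_modp m0.
have [a [m' [a0 pm' em']]] := content_primitive m0.
have m'J x : J x -> divides m' x.
  move=> /mJ[c c0 [d ed]]; apply: primitive_divides_cancel c0 _ => //.
  by exists (d * a%:P); rewrite ed em' mulrA.
have Jf : J f by exists 1, 0; rewrite mul1r mul0r addr0.
have Jg : J g by exists 0, 1; rewrite mul1r mul0r add0r.
have [k ek] := m'J f Jf.
have [/eqP|/eqP] := irr _ _ ek => /size_poly1P[c c0 ec].
  have cu : c \is a GRing.unit.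
    apply: primitive_const => //; apply: primitive_divides pf; rewrite -ec ek.
    exact: divides_mulr (dividesrr _).
  case: nfg; apply: divides_trans (m'J g Jg); exists (c^-1)%:P.
  by rewrite ek ec mulrA -polyCM mulVr // mul1r.
(* Here [m] is a nonzero constant of the ideal, so [f] divides a constant multiple of [h], and
   primitivity removes the constant. *)
apply: (@primitive_divides_cancel h f (a * c)) => //; first by rewrite mulf_neq0.
have -> : (a * c)%:P = m by rewrite polyCM -ec em'.
rewrite em mulrDl; apply: dividesD.
  by rewrite mulrAC; exact: divides_mull (dividesrr _).
by rewrite -mulrA; exact: divides_mull.
Qed.

Lemma factorial_poly : factorial_ring {poly R}.
Proof.
move=> f f0; have [a [g [a0 pg ef]]] := content_primitive f0.
have g0 : g != 0 by apply: contraNneq f0 => g0; rewrite ef g0 mulr0.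
rewrite {}ef {f f0}; apply: factoredM.
  elim/factorial_ind: a / a0 => // [u uu|p a pp a0 IHa].
    by apply: factored_unit; rewrite rmorph_unit.
  by rewrite polyCM; apply: factoredM IHa; apply: factored_prime; exact: prime_polyC.
have [n] := ubnP (size g); elim: n g pg g0 => // n IHn g pg g0 /ltnSE sg.
have [s1|s1] := leqP (size g) 1.
  have ec := size1_polyC s1; apply: factored_unit; rewrite ec rmorph_unit //.
  by apply: primitive_const; rewrite -?ec // -polyC_eq0 -ec.
have [irr|nirr] := pselect (forall h k, g = h * k -> size h = 1%N \/ size k = 1%N).
  by apply: factored_prime; exact: primitive_irreducible_prime.
have [h [k [eg sh sk]]] : exists h k, [/\ g = h * k, size h <> 1%N & size k <> 1%N].
  apply: contrapT => nhk; apply: nirr => h k eg; apply: contrapT => /not_orP[sh sk].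
  by apply: nhk; exists h, k.
have h0 : h != 0 by apply: contraNneq g0 => h0; rewrite eg h0 mul0r.
have k0 : k != 0 by apply: contraNneq g0 => k0; rewrite eg k0 mulr0.
have /prednK sh1 : (0 < size h)%N by rewrite size_poly_gt0.
have /prednK sk1 : (0 < size k)%N by rewrite size_poly_gt0.
have E : size g = ((size h).-1 + (size k).-1).+1%N by rewrite eg size_mul // -sh1 -sk1 addnS.
move/eqP: sh; move/eqP: sk; rewrite -sh1 -sk1 !eqSS -!lt0n => k1 h1.
rewrite eg; apply: factoredM; apply: IHn => //.
- by apply: primitive_divides pg; rewrite eg; exact: divides_mulr (dividesrr _).
- by rewrite -sh1; apply: leq_trans sg; rewrite E ltnS -addn1 leq_add2l.
- by apply: primitive_divides pg; rewrite eg; exact: divides_mull (dividesrr _).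
- by rewrite -sk1; apply: leq_trans sg; rewrite E ltnS -add1n leq_add2r.
Qed.

End FactorialPoly.

(** * Polynomials in several variables, one variable at a time *)

Section FactorialMpoly.

Lemma factorial_iso (R S : idomainType) (f : {rmorphism R -> S}) (g : {rmorphism S -> R}) :
  cancel f g -> cancel g f -> factorial_ring S -> factorial_ring R.
Proof.
move=> fK gK fS a a0.
have [|s [u [uu sp e]]] := fS (f a); first by rewrite -(rmorph0 f) (can_eq fK).
exists (map g s), (g u); split; first exact: rmorph_unit.
- move=> _ /mapP[p /sp[p0 pu pp] ->]; split.
  + by rewrite -(rmorph0 g) (can_eq gK).
  + by apply: contraNN pu => /(rmorph_unit f); rewrite gK.
  + move=> b c [d ed]; have [|[x ex]|[x ex]] := pp (f b) (f c).
    * by exists (f d); rewrite -rmorphM ed rmorphM gK.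
    * by left; exists (g x); rewrite -(fK b) ex rmorphM.
    * by right; exists (g x); rewrite -(fK c) ex rmorphM.
- by rewrite -(fK a) e rmorphM rmorph_prod big_map.
Qed.

Variable K : fieldType.

(** Inverse of [muni], which singles out the last variable; the pair transports factoriality from
    [{poly {mpoly K[n]}}]. *)
Definition mmult n (p : {poly {mpoly K[n]}}) : {mpoly K[n.+1]} :=
  (map_poly (@mwiden n K) p).['X_ord_max].

Lemma mmultD n : {morph @mmult n : p q / p + q}.
Proof. by move=> p q; rewrite /mmult rmorphD hornerD. Qed.

Lemma mmultM n : {morph @mmult n : p q / p * q}.
Proof. by move=> p q; rewrite /mmult rmorphM hornerM. Qed.

Lemma mmult_is_additive n : additive (@mmult n).
Proof. by move=> p q; rewrite /mmult rmorphB hornerD hornerN. Qed.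
HB.instance Definition _ n := GRing.isAdditive.Build _ _ (@mmult n) (@mmult_is_additive n).

Lemma mmult_is_multiplicative n : multiplicative (@mmult n).
Proof. by split=> [p q|]; [exact: mmultM | rewrite /mmult rmorph1 hornerC]. Qed.
HB.instance Definition _ n :=
  GRing.isMultiplicative.Build _ _ (@mmult n) (@mmult_is_multiplicative n).

Lemma muniX_widen n (i : 'I_n) :
  muni ('X_(widen_ord (leqnSn n) i) : {mpoly K[n.+1]}) = ('X_i)%:P.
Proof.
rewrite /muni mmapX mmap1U; case: splitP => [j /= e|j /= e].
  by congr ('X__)%:P; apply: val_inj.
by have := ltn_ord i; rewrite e; rewrite ltnNge leq_addr.
Qed.

Lemma muniX_max n : muni ('X_ord_max : {mpoly K[n.+1]}) = 'X.
Proof.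
rewrite /muni mmapX mmap1U; case: splitP => [j /= e|//].
by have := ltn_ord j; rewrite -e ltnn.
Qed.

Lemma mpoly_gen n (P : {mpoly K[n]} -> Prop) :
  (forall c, P c%:MP) -> (forall i, P 'X_i) -> (forall p q, P p -> P q -> P (p + q)) ->
  (forall p q, P p -> P q -> P (p * q)) -> forall p, P p.
Proof.
move=> PC PX PD PM; elim/mpolyind => [|c m p _ _ Pp]; first by rewrite -mpolyC0.
apply: PD => //; rewrite -mul_mpolyC; apply: (PM) => //.
have P1 : P 1 by rewrite -mpolyC1.
rewrite mpolyXE_id; apply: (big_ind P P1 PM) => i _; elim: (m i) => [|k IHk].
  by rewrite expr0.
by rewrite exprS; apply: (PM).
Qed.

Lemma muniK n : cancel (@muni n K) (@mmult n).
Proof.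
apply: mpoly_gen => [c|i|p q ep eq_|p q ep eq_].
- by rewrite muniC /mmult map_polyC hornerC /= mwidenC.
- have [j ->|->] := unliftP ord_max i; last first.
    by rewrite muniX_max /mmult map_polyX hornerX.
  have -> : lift ord_max j = widen_ord (leqnSn n) j.
    by apply: ord_inj; rewrite lift_max.
  rewrite muniX_widen /mmult map_polyC hornerC /= mwidenX mnmwiden1.
  by congr 'X_[U_(_)]; apply: val_inj.
- by rewrite muniD mmultD; congr (_ + _).
- by rewrite muniM mmultM; congr (_ * _).
Qed.

Lemma mmultK n : cancel (@mmult n) (@muni n K).
Proof.
elim/poly_ind => [|p q IHp]; first by rewrite raddf0 muni0.
rewrite mmultD mmultM muniD muniM.
congr (_ * _ + _) => //; first by rewrite /mmult map_polyX hornerX muniX_max.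
rewrite /mmult map_polyC hornerC /=.
elim/mpoly_gen: q => [d|i|a b ea eb|a b ea eb].
- by rewrite mwidenC muniC.
- rewrite mwidenX mnmwiden1 -muniX_widen.
  by congr (muni 'X_[U_(_)]); apply: val_inj.
- by rewrite mwidenD muniD polyCD; congr (_ + _).
- by rewrite mwidenM muniM polyCM; congr (_ * _).
Qed.

Lemma factorial_mpoly n : factorial_ring {mpoly K[n]}.
Proof.
elim: n => [|n IHn].
  move=> p p0; apply: factored_unit.
  have ep : p = (p@_0%MM)%:MP.
    apply/mpolyP => m; rewrite mcoeffC.
    have -> : m = 0%MM by apply/mnmP => -[].
    by rewrite eqxx mulr1.
  rewrite ep rmorph_unit // unitfE.
  by apply: contraNneq p0 => e; rewrite ep e mpolyC0.
apply: (factorial_iso (@muniK n) (@mmultK n)).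
exact: factorial_poly.
Qed.

Lemma meval_muni n (p : {mpoly K[n.+1]}) (v : 'I_n.+1 -> K) :
  p.@[v] = (map_poly (meval (fun i => v (widen_ord (leqnSn n) i))) (muni p)).[v ord_max].
Proof.
elim/mpoly_gen: p => [c|i|p q ep eq_|p q ep eq_].
- by rewrite mevalC muniC map_polyC hornerC /= mevalC.
- rewrite mevalXU; have [j ->|->] := unliftP ord_max i; last first.
    by rewrite muniX_max map_polyX hornerX.
  have -> : lift ord_max j = widen_ord (leqnSn n) j.
    by apply: ord_inj; rewrite lift_max.
  by rewrite muniX_widen map_polyC hornerC /= mevalXU.
- rewrite mevalD muniD.
  by rewrite (rmorphD (map_poly (meval (fun i => v (widen_ord (leqnSn n) i))))) hornerD ep eq_.
- rewrite mevalM muniM.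
  by rewrite (rmorphM (map_poly (meval (fun i => v (widen_ord (leqnSn n) i))))) hornerM ep eq_.
Qed.

Hypothesis Kinf : forall q : {poly K}, q != 0 -> exists x, q.[x] != 0.

Lemma mpoly_neq0_eval n (p : {mpoly K[n]}) : p != 0 -> exists v, p.@[v] != 0.
Proof.
elim: n p => [|n IHn] p p0.
  exists (fun=> 0); apply: contraNneq p0.
  have -> : p = (p@_0%MM)%:MP.
    apply/mpolyP => m; rewrite mcoeffC.
    have -> : m = 0%MM by apply/mnmP => -[].
    by rewrite eqxx mulr1.
  by rewrite mevalC => ->; rewrite mpolyC0.
have : muni p != 0 by rewrite -(rmorph0 (@muni n K)) (can_eq (@muniK n)).
(* A point where the leading coefficient in the last variable survives leaves a nonzero univariate
   polynomial. *)
rewrite -lead_coef_eq0 => /IHn[v v0].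
set q := map_poly (meval v) (muni p).
have [|x qx] := Kinf (q := q).
  apply: contraNneq v0 => q0; have := coef_map (meval v) (muni p) (size (muni p)).-1.
  by rewrite -/q q0 coef0 => <-.
exists (fun i => oapp v x (unlift ord_max i)).
rewrite meval_muni unlift_none /=; apply: contraNneq qx => <-; apply/eqP.
congr (_.[_]); apply: eq_map_poly => a /=; apply: meval_eq => i.
have -> : widen_ord (leqnSn n) i = lift ord_max i.
  by apply: ord_inj; rewrite lift_max.
by rewrite liftK.
Qed.

End FactorialMpoly.

(** * Lifting projective maps to polynomials *)

Section PolynomialLift.
Variables (K : closedFieldType) (W : vectType K) (N : nat).
Local Notation r := (\dim {:W}).
Implicit Types (z : 'I_N -> K) (F E : 'I_r -> {mpoly K[N]}).

Lemma closed_mpoly_eq0 n (p : {mpoly K[n]}) : (forall v, p.@[v] = 0) -> p = 0.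
Proof.
move=> p0; apply: contrapT => /eqP/mpoly_neq0_eval[q|v]; last by rewrite p0 eqxx.
exact/closed_nonrootP.
Qed.

Definition mvec F z : W := \sum_i (F i).@[z] *: (vbasis {:W})`_i.

Lemma coord_mvec F z i : coord (vbasis {:W}) i (mvec F z) = (F i).@[z].
Proof. by rewrite coord_sum_free // (basis_free (vbasisP _)). Qed.

Lemma mvecZ E F h z : (forall i, E i = h * F i) -> mvec E z = h.@[z] *: mvec F z.
Proof.
by move=> e; rewrite scaler_sumr; apply: eq_bigr => i _; rewrite e mevalM scalerA.
Qed.

Lemma mvec_neq0 F z : mvec F z != 0 -> exists i, (F i).@[z] != 0.
Proof.
move=> F0; apply: contrapT => nF; case/eqP: F0; apply: big1 => i _.
by have [->|Fi] := eqVneq (F i).@[z] 0; [rewrite scale0r | case: nF; exists i].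
Qed.

Variables (D : ('I_N -> K) -> Prop) (l : ('I_N -> K) -> {vspace W}).
Variable delta : {mpoly K[N]}.
Hypothesis delta0 : delta != 0.
Hypothesis deltaD : forall z, delta.@[z] != 0 -> D z.
Hypothesis l_local : forall z, D z -> exists s F, s.@[z] != 0 /\
  forall y, D y -> s.@[y] != 0 -> mvec F y != 0 /\ l y = <[mvec F y]>%VS.

(** One local expression divided by its content works everywhere: any polynomial section is
    proportional to it on a nonempty principal open set, and coprime entries turn proportionality
    into divisibility. The second conclusion is what later yields homogeneity. *)
Theorem polynomial_lift : exists F, (forall z, D z -> mvec F z != 0 /\ l z = <[mvec F z]>%VS) /\
  forall E, (forall z, D z -> mvec E z \in l z) -> exists h, forall i, E i = h * F i.
Proof.
have [z0 dz0] : exists z, delta.@[z] != 0.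
  by apply: mpoly_neq0_eval delta0 => q; exact/closed_nonrootP.
have [s0 [P0 [s0z0 P0l]]] := l_local (deltaD dz0).
have [P0z0 _] := P0l _ (deltaD dz0) s0z0.
have [i0 P0i0] : exists i, P0 i != 0.
  have [i Pi] := mvec_neq0 P0z0; exists i.
  by apply: contraNneq Pi => ->; rewrite meval0.
have fK := @factorial_mpoly K N.
have [g [F [gF cF]]] := content_vector fK P0i0.
have univ E : (forall z, D z -> mvec E z \in l z) -> exists h, forall i, E i = h * F i.
  move=> El; have EF i j : E i * F j = E j * F i.
    (* The factor [delta * s0] kills the points where [P0] is not known to span [l], so the identity
       holds at every point, hence between polynomials. *)
    apply/eqP; rewrite -subr_eq0; have : delta * s0 * (E i * F j - E j * F i) == 0.
      apply/eqP/closed_mpoly_eq0 => y; rewrite !mevalM mevalB !mevalM.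
      have [->|dy] := eqVneq delta.@[y] 0; first by rewrite !mul0r.
      have [->|sy] := eqVneq s0.@[y] 0; first by rewrite mulr0 mul0r.
      have Dy := deltaD dy; have [Py ly] := P0l y Dy sy.
      have := El y Dy; rewrite ly (mvecZ _ gF) => /vlineP[c ec].
      have Ec k : (E k).@[y] = c * g.@[y] * (F k).@[y].
        by rewrite -coord_mvec ec !linearZ /= coord_mvec mulrA.
      by rewrite !Ec; ring.
    rewrite mulf_eq0 => /orP[|//]; rewrite mulf_eq0 (negPf delta0) /= => /eqP s00.
    by move: s0z0; rewrite s00 meval0 eqxx.
  have Fi0 : F i0 != 0 by apply: contraNneq P0i0 => e; rewrite gF e mulr0.
  have [|h eh] := divides_coprime_vector (d := F i0) (e := E i0) fK cF Fi0.
    by move=> i; exists (E i); rewrite EF.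
  exists h => i; apply: (mulIf Fi0); rewrite EF eh; ring.
exists F; split=> // z Dz.
have [s [P [sz Pl]]] := l_local Dz.
(* Multiplied by [s], the local expression at [z] becomes a section on all of [D], hence a multiple
   [h] of [F], and [h] cannot vanish at [z]. *)
have [|h eh] := univ (fun i => s * P i).
  move=> y Dy; rewrite (@mvecZ (fun i => s * P i) P s) //.
  have [->|sy] := eqVneq s.@[y] 0; first by rewrite scale0r mem0v.
  by have [_ ->] := Pl y Dy sy; apply: memvZ; exact: memv_line.
have [Pz lz] := Pl z Dz sz.
have e1 : s.@[z] *: mvec P z = h.@[z] *: mvec F z.
  by rewrite -(mvecZ _ eh) (@mvecZ (fun i => s * P i) P s).
have hz : h.@[z] != 0.
  apply: contraNneq Pz => hz; move/eqP: e1; by rewrite hz scale0r scaler_eq0 (negPf sz).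
have e2 : mvec P z = ((s.@[z])^-1 * h.@[z]) *: mvec F z.
  by rewrite -scalerA -e1 scalerA mulVf // scale1r.
have c0 : (s.@[z])^-1 * h.@[z] != 0 by rewrite mulf_neq0 ?invr_eq0.
split; first by apply: contraNneq Pz => Fz; rewrite e2 Fz scaler0.
rewrite lz e2; apply/eqP; rewrite eqEsubv -!memvE memvZ ?memv_line //=.
by apply/vlineP; exists ((s.@[z])^-1 * h.@[z])^-1; rewrite scalerA mulVf // scale1r.
Qed.

End PolynomialLift.

(** * Bivectors and antisymmetric forms *)

Section Wedge.
Variables (K : fieldType) (m : nat).
Implicit Types (p q v w t : 'cV[K]_m) (b : ext2 K m).

Definition dot v t : K := (v^T *m t) 0 0.

Lemma dotDl v w t : dot (v + w) t = dot v t + dot w t.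
Proof. by rewrite /dot linearD mulmxDl mxE. Qed.

Lemma dotZl c v t : dot (c *: v) t = c * dot v t.
Proof. by rewrite /dot linearZ -scalemxAl mxE. Qed.

Lemma dotDr v w t : dot t (v + w) = dot t v + dot t w.
Proof. by rewrite /dot mulmxDr mxE. Qed.

Lemma dotZr c v t : dot t (c *: v) = c * dot t v.
Proof. by rewrite /dot -scalemxAr mxE. Qed.

Lemma dotC v w : dot v w = dot w v.
Proof. by rewrite /dot -[in RHS](trmxK v) -trmx_mul [RHS]mxE. Qed.

Lemma mulmx_dot p q t : p *m q^T *m t = dot q t *: p.
Proof. by rewrite -mulmxA [q^T *m t]mx11_scalar mul_mx_scalar. Qed.

Lemma dot_delta v i : dot v (delta_mx i 0) = v i 0.
Proof. by rewrite /dot -colE !mxE. Qed.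

Lemma wedgeE p q : vsval (wedge p q) = p *m q^T - q *m p^T.
Proof. by []. Qed.

Lemma wedgeC p q : wedge q p = - wedge p q.
Proof. by apply: val_inj; rewrite /= opprB. Qed.

Lemma wedgevv p : wedge p p = 0.
Proof. by apply: val_inj; rewrite /= subrr. Qed.

Lemma wedgeDl p q v : wedge (p + q) v = wedge p v + wedge q v.
Proof. by apply: val_inj; rewrite /= [(_ + _)^T]linearD /= mulmxDl mulmxDr opprD addrACA. Qed.

Lemma wedgeDr p q v : wedge v (p + q) = wedge v p + wedge v q.
Proof. by rewrite wedgeC wedgeDl opprD -!wedgeC. Qed.

Lemma wedgeZl c p q : wedge (c *: p) q = c *: wedge p q.
Proof.
by apply: val_inj; rewrite /= linearZ /= -scalemxAl -scalemxAr scalerBr.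
Qed.

Lemma wedgeZr c p q : wedge p (c *: q) = c *: wedge p q.
Proof. by rewrite wedgeC wedgeZl -scalerN -wedgeC. Qed.

Lemma wedge0l p : wedge 0 p = 0.
Proof. by rewrite -(scale0r (0 : 'cV_m)) wedgeZl scale0r. Qed.

Lemma wedge0r p : wedge p 0 = 0.
Proof. by rewrite wedgeC wedge0l oppr0. Qed.

Definition wedgeE2 := (wedgeDl, wedgeDr, wedgeZl, wedgeZr, wedgevv).

Lemma wedge_lin2 (a b c d : K) p q :
  wedge (a *: p + b *: q) (c *: p + d *: q) = (a * d - b * c) *: wedge p q.
Proof.
rewrite !wedgeE2 (wedgeC p q) !scaler0 !(addr0, add0r) !scalerN !scalerA -scalerBl.
by congr (_ *: _); ring.
Qed.

(** Interior product with the covector [t]; it reads vectors of a plane back from the bivector. *)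
Definition ctr b t : 'cV[K]_m := vsval b *m t.

Lemma ctr_wedge p q t : ctr (wedge p q) t = dot q t *: p - dot p t *: q.
Proof. by rewrite /ctr wedgeE mulmxBl !mulmx_dot. Qed.

Lemma ctrD b b' t : ctr (b + b') t = ctr b t + ctr b' t.
Proof. by rewrite /ctr linearD mulmxDl. Qed.

Lemma ctrZ c b t : ctr (c *: b) t = c *: ctr b t.
Proof. by rewrite /ctr linearZ -scalemxAl. Qed.

Lemma ctr0 t : ctr 0 t = 0.
Proof. by rewrite -(scale0r (0 : ext2 K m)) ctrZ scale0r. Qed.

Lemma wedge_dual p q x y : wedge p q != 0 -> exists t, dot p t = x /\ dot q t = y.
Proof.
move=> pq; have [i [j d0]] : exists i j, p i 0 * q j 0 - q i 0 * p j 0 != 0.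
  apply: contrapT => n; case/eqP: pq; apply: val_inj; apply/matrixP => i j.
  rewrite /= !mxE !big_ord1 !mxE; apply: contrapT => /eqP e.
  by apply: n; exists i, j.
set d := _ - _ in d0.
(* Cramer's rule on the coordinates [i] and [j], whose minor is [d]. *)
exists (((x * q j 0 - y * p j 0) / d) *: delta_mx i 0
        + ((y * p i 0 - x * q i 0) / d) *: delta_mx j 0).
rewrite !dotDr !dotZr !dot_delta.
by split; rewrite /d; field; exact: d0.
Qed.

Lemma wedge_neq0l p q : wedge p q != 0 -> p != 0.
Proof. by apply: contraNneq => ->; rewrite wedge0l. Qed.

Lemma wedge_neq0r p q : wedge p q != 0 -> q != 0.
Proof. by apply: contraNneq => ->; rewrite wedge0r. Qed.

Lemma vec_dual p : p != 0 -> exists t, dot p t = 1.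
Proof.
move=> p0; have [i pi] : exists i, p i 0 != 0.
  apply: contrapT => n; case/eqP: p0; apply/matrixP => i j; rewrite (ord1 j) mxE.
  by apply: contrapT => /eqP e; apply: n; exists i.
by exists ((p i 0)^-1 *: delta_mx i 0); rewrite dotZr dot_delta mulVf.
Qed.

Lemma wedge_eq0 p q : p != 0 -> wedge p q = 0 -> exists c, q = c *: p.
Proof.
move=> /vec_dual[t pt] e; exists (dot q t); apply/esym/eqP; rewrite -subr_eq0.
by have := ctr_wedge p q t; rewrite e ctr0 pt scale1r => <-.
Qed.

(** Contraction with suitable covectors returns [p'] and [q'] from their bivector, and any
    contraction of [p /\ q] lies in the span of [p] and [q]. *)
Lemma wedge_span p q p' q' : wedge p q = wedge p' q' -> wedge p q != 0 ->
  exists a b c d : K, [/\ p' = a *: p + b *: q, q' = c *: p + d *: q & a * d - b * c = 1].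
Proof.
move=> e pq0; have pq'0 : wedge p' q' != 0 by rewrite -e.
have [t [pt qt]] := wedge_dual 0 1 pq'0.
have [s [ps qs]] := wedge_dual (-1) 0 pq'0.
have ep : p' = dot q t *: p + (- dot p t) *: q.
  by rewrite scaleNr -ctr_wedge e ctr_wedge pt qt scale0r scale1r subr0.
have eq' : q' = dot q s *: p + (- dot p s) *: q.
  by rewrite scaleNr -ctr_wedge e ctr_wedge ps qs scale0r scaleN1r sub0r opprK.
exists (dot q t), (- dot p t), (dot q s), (- dot p s); split=> //.
move: e; rewrite ep eq' wedge_lin2 => /eqP; rewrite -{1}(scale1r (wedge p q)).
by rewrite -subr_eq0 -scalerBl scaler_eq0 (negPf pq0) orbF subr_eq0 => /eqP <-.
Qed.

End Wedge.

Section Form.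
Variables (K : numFieldType) (m : nat) (A : 'M[K]_m).
Hypothesis hA : A^T = - A.
Implicit Types (p q v w t : 'cV[K]_m).

Definition aform v w : K := (v^T *m A *m w) 0 0.

Lemma aformDl u v w : aform (u + v) w = aform u w + aform v w.
Proof. by rewrite /aform linearD !mulmxDl mxE. Qed.

Lemma aformDr u v w : aform w (u + v) = aform w u + aform w v.
Proof. by rewrite /aform mulmxDr mxE. Qed.

Lemma aformZl c v w : aform (c *: v) w = c * aform v w.
Proof. by rewrite /aform linearZ -!scalemxAl mxE. Qed.

Lemma aformZr c v w : aform v (c *: w) = c * aform v w.
Proof. by rewrite /aform -scalemxAr mxE. Qed.

Lemma aformC v w : aform w v = - aform v w.
Proof.
transitivity ((w^T *m A *m v)^T 0 0); first by rewrite [RHS]mxE.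
by rewrite !trmx_mul trmxK hA mulNmx mulmxN mxE mulmxA.
Qed.

Lemma aformvv v : aform v v = 0.
Proof.
have /eqP : aform v v *+ 2 = 0 by rewrite mulr2n {1}aformC addNr.
by rewrite mulrn_eq0 /= => /eqP.
Qed.

Lemma aformNr v w : aform v (- w) = - aform v w.
Proof. by rewrite -scaleN1r aformZr mulN1r. Qed.

Lemma aformNl v w : aform (- v) w = - aform v w.
Proof. by rewrite -scaleN1r aformZl mulN1r. Qed.

Lemma aform0l v : aform 0 v = 0.
Proof. by rewrite -(scale0r v) aformZl mul0r. Qed.

Lemma aform0r v : aform v 0 = 0.
Proof. by rewrite -(scale0r v) aformZr mul0r. Qed.

Definition aformE := (aformDl, aformDr, aformZl, aformZr, aformNl, aformNr).

Lemma diag_antisym i : A i i = 0.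
Proof.
have := aformvv (delta_mx i 0).
by rewrite /aform trmx_delta -mulmxA -colE -rowE !mxE.
Qed.

End Form.

(** * Polynomial curves and functions *)

Section Univariate.
Variable K : closedFieldType.
Implicit Types (g h : K -> K) (W : vectType K).

Definition pfun1 g := exists p : {poly K}, forall s, g s = p.[s].

Lemma pfun1_const c : pfun1 (fun=> c).
Proof. by exists c%:P => s; rewrite hornerC. Qed.

Lemma pfun1_id : pfun1 id.
Proof. by exists 'X => s; rewrite hornerX. Qed.

Lemma pfun1D g h : pfun1 g -> pfun1 h -> pfun1 (fun s => g s + h s).
Proof. by move=> [p ep] [q eq_]; exists (p + q) => s; rewrite hornerD ep eq_. Qed.

Lemma pfun1M g h : pfun1 g -> pfun1 h -> pfun1 (fun s => g s * h s).
Proof. by move=> [p ep] [q eq_]; exists (p * q) => s; rewrite hornerM ep eq_. Qed.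

Lemma pfun1_sum (I : finType) (G : I -> K -> K) :
  (forall i, pfun1 (G i)) -> pfun1 (fun s => \sum_i G i s).
Proof.
move=> /choice[p pG]; exists (\sum_i p i) => s.
by rewrite horner_sum; apply: eq_bigr => i _.
Qed.

Lemma pfun1X g n : pfun1 g -> pfun1 (fun s => g s ^+ n).
Proof. by move=> [p ep]; exists (p ^+ n) => s; rewrite horner_exp ep. Qed.

Lemma pfun1_ext g h : g =1 h -> pfun1 g -> pfun1 h.
Proof. by move=> e [p ep]; exists p => s; rewrite -e. Qed.

Lemma pfun1_mpoly n (p : {mpoly K[n]}) (z : K -> 'I_n -> K) :
  (forall i, pfun1 (fun s => z s i)) -> pfun1 (fun s => p.@[z s]).
Proof.
move=> zP; elim/mpoly_gen: p => [c|i|p q Pp Pq|p q Pp Pq].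
- by apply: pfun1_ext (pfun1_const c) => s; rewrite mevalC.
- by apply: pfun1_ext (zP i) => s; rewrite mevalXU.
- by apply: pfun1_ext (pfun1D Pp Pq) => s; rewrite mevalD.
- by apply: pfun1_ext (pfun1M Pp Pq) => s; rewrite mevalM.
Qed.

Lemma noroot_const (p : {poly K}) : (forall s, p.[s] != 0) -> p = (p.[0])%:P.
Proof.
move=> p0; have sp : size p = 1%N.
  apply/eqP; apply: contrapT => /negP/closed_rootP[x].
  by rewrite rootE (negPf (p0 x)).
by rewrite {1}(size1_polyC (eq_leq sp)) horner_coef0.
Qed.

Lemma pfun1_nz_const g : pfun1 g -> (forall s, g s != 0) -> forall s, g s = g 0.
Proof.
move=> [p ep] g0 s; rewrite !ep (@noroot_const p) ?hornerC // => x.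
by rewrite -ep.
Qed.

Lemma pfun1_monomial g : pfun1 g -> (forall s, s != 0 -> g s != 0) ->
  exists k c, c != 0 /\ forall s, g s = c * s ^+ k.
Proof.
move=> [p ep] g0; have p0 : p != 0.
  by apply: contraNneq (g0 1 (oner_neq0 _)) => p0; rewrite ep p0 horner0.
have [k [q]] := multiplicity_XsubC p 0; rewrite p0 /= subr0 => q0 eq_.
have qc : q = (q.[0])%:P.
  apply: noroot_const => s; have [->//|s0] := eqVneq s 0.
  by apply: contraNneq (g0 s s0) => qs; rewrite ep eq_ hornerM qs mul0r.
exists k, q.[0]; split=> // s.
by rewrite ep eq_ hornerM qc !hornerC horner_exp hornerX.
Qed.

Lemma pfun1_cancel d g h : pfun1 d -> pfun1 g -> pfun1 h -> (exists s, d s != 0) ->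
  (forall s, d s != 0 -> g s = h s) -> g =1 h.
Proof.
move=> [p ep] [q eq_] [r er] [s0 ds0] gh s.
have : p * (q - r) = 0.
  apply/eqP; apply: contrapT => /negP/closed_nonrootP[x]; rewrite rootE hornerM.
  have [px|] := eqVneq (d x) 0; first by rewrite -ep px mul0r eqxx.
  by move=> /gh; rewrite eq_ er hornerD hornerN => ->; rewrite subrr mulr0 eqxx.
move/eqP; rewrite mulf_eq0 => /orP[/eqP p0|].
  by move: ds0; rewrite ep p0 horner0 eqxx.
by rewrite subr_eq0 eq_ er => /eqP ->.
Qed.

(* Bezout in disguise: the denominators [D] have no common zero, so a denominator of
   least degree is constant. *)
Lemma pfun1_local g : (forall s0, exists d, [/\ pfun1 d, d s0 != 0 &
  pfun1 (fun s => d s * g s)]) -> pfun1 g.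
Proof.
move=> gl; pose S n := `[< exists p q : {poly K},
  [/\ p != 0, size p = n & forall s, p.[s] * g s = q.[s]] >].
have exS : exists n, S n.
  have [d [[p ep] d0 [q eq_]]] := gl 0.
  exists (size p); apply/asboolP; exists p, q; split=> // [|s].
    by apply: contraNneq d0 => p0; rewrite ep p0 horner0.
  by rewrite -ep eq_.
case: (ex_minnP exS) => n /asboolP[p [q [p0 sp pq]]] minn.
(* A case split on whether [p] is nonconstant; ['I_1] merely carries the boolean. *)
have [x rx|np] := pickP (fun=> size p != 1%N) (T := 'I_1); last first.
  have /negbFE/size_poly1P[c c0 ec] := np 0.
  exists (c^-1 *: q) => s; rewrite hornerZ -pq ec hornerC mulKf //.
have {x rx} [x] := closed_rootP _ rx.
move=> /factor_theorem[p1 ep1].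
(* A denominator that is nonzero at the root [x] of [p] forces [q] to vanish at [x] as well, so
   [X - x] cancels, against minimality. *)
have [d [[p' ep'] d0 [q' eq']]] := gl x.
have p'q : p' * q = p * q'.
  apply/eqP; rewrite -subr_eq0; apply: contrapT => /negP/closed_nonrootP[y].
  rewrite rootE hornerD hornerN !hornerM -pq -eq' -ep'.
  by rewrite mulrCA subrr eqxx.
have p10 : p1 != 0 by apply: contraNneq p0 => e; rewrite ep1 e mul0r.
have qx : root q x.
  have : root (p' * q) x by rewrite p'q ep1 /root !hornerM hornerXsubC subrr mulr0 mul0r.
  by rewrite rootM rootE -ep' (negPf d0).
have [q1 eq1] := factor_theorem _ _ qx.
have p'q1 : p' * q1 = p1 * q'.
  apply: (@mulIf _ ('X - x%:P)); first by rewrite polyXsubC_eq0.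
  by rewrite -mulrA -eq1 p'q ep1 mulrAC.
suff : S (size p1).
  move=> /minn; rewrite -sp ep1 size_mul ?polyXsubC_eq0 // size_XsubC addnS addn1 /=.
  by rewrite ltnn.
apply/asboolP; exists p1, q1; split=> // s.
have [->|sx] := eqVneq s x.
  have p'x : p'.[x] != 0 by rewrite -ep'.
  apply: (mulfI p'x); rewrite -[RHS]hornerM p'q1 hornerM -eq' ep'.
  by rewrite mulrCA.
apply: (@mulfI _ (s - x)); first by rewrite subr_eq0.
have := pq s; rewrite ep1 eq1 !hornerM !hornerXsubC => e.
by rewrite mulrA [_ * p1.[s]]mulrC e mulrC.
Qed.

Definition pvec1 W (g : K -> W) := forall i, pfun1 (fun s => coord (vbasis {:W}) i (g s)).

Lemma pvec1_const W (w : W) : pvec1 (fun=> w).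
Proof. by move=> i; exact: pfun1_const. Qed.

Lemma pvec1D W (g h : K -> W) : pvec1 g -> pvec1 h -> pvec1 (fun s => g s + h s).
Proof.
move=> gP hP i; apply: pfun1_ext (pfun1D (gP i) (hP i)) => s.
by rewrite linearD.
Qed.

Lemma pvec1Z W (c : K -> K) (g : K -> W) : pfun1 c -> pvec1 g -> pvec1 (fun s => c s *: g s).
Proof.
move=> cP gP i; apply: pfun1_ext (pfun1M cP (gP i)) => s.
by rewrite linearZ.
Qed.

Lemma pvec1_lin W (L : W -> K) (g : K -> W) :
  (forall u v, L (u + v) = L u + L v) -> (forall c u, L (c *: u) = c * L u) ->
  pvec1 g -> pfun1 (fun s => L (g s)).
Proof.
move=> LD LZ gP.
apply: (@pfun1_ext (fun s => \sum_i coord (vbasis {:W}) i (g s) * L (vbasis {:W})`_i)).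
  move=> s; rewrite {2}(coord_vbasis (memvf (g s))) (big_morph L LD (id1 := 0)).
    by apply: eq_bigr => i _; rewrite LZ.
  by rewrite -(scale0r (0 : W)) LZ mul0r.
by apply: pfun1_sum => i; apply: pfun1M (gP i) (pfun1_const _).
Qed.

(** The coefficient of [w] is a polynomial in [s] without zeros. This makes lifts constant along
    lines contained in a fibre. *)
Lemma pvec1_line_const W (w : W) (g : K -> W) : pvec1 g ->
  (forall s, g s != 0) -> (forall s, g s \in <[w]>%VS) -> forall s, g s = g 0.
Proof.
move=> gP g0 gw; have w0 : w != 0.
  by apply: contraNneq (g0 0) => w0; have := gw 0; rewrite w0 => /vlineP[c ->]; rewrite scaler0.
have [c cE] := choice (fun s => vlineP _ _ (gw s)).
have [i wi] : exists i, coord (vbasis {:W}) i w != 0.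
  apply: contrapT => n; case/eqP: w0; rewrite (coord_vbasis (memvf w)).
  apply: big1 => i _; have [->|wi] := eqVneq (coord (vbasis {:W}) i w) 0.
    by rewrite scale0r.
  by case: n; exists i.
have cc : forall s, c s = c 0.
  apply: pfun1_nz_const => [|s]; last by apply: contraNneq (g0 s) => cs; rewrite cE cs scale0r.
  apply: pfun1_ext (pfun1M (gP i) (pfun1_const (coord (vbasis {:W}) i w)^-1)) => s.
  by rewrite cE linearZ /= mulfK.
by move=> s; rewrite !cE cc.
Qed.

End Univariate.

(** * The cone of isotropic bivectors *)

Section PolynomialFunctions.
Variables (K : fieldType) (N : nat).
Implicit Types g h : ('I_N -> K) -> K.

Definition mfun g := exists p : {mpoly K[N]}, forall z, g z = p.@[z].

Lemma mfun_const c : mfun (fun=> c).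
Proof. by exists c%:MP => z; rewrite mevalC. Qed.

Lemma mfun_coord i : mfun (fun z => z i).
Proof. by exists 'X_i => z; rewrite mevalXU. Qed.

Lemma mfun_ext g h : g =1 h -> mfun g -> mfun h.
Proof. by move=> e [p ep]; exists p => z; rewrite -e. Qed.

Lemma mfunD g h : mfun g -> mfun h -> mfun (fun z => g z + h z).
Proof. by move=> [p ep] [q eq_]; exists (p + q) => z; rewrite mevalD ep eq_. Qed.

Lemma mfunN g : mfun g -> mfun (fun z => - g z).
Proof. by move=> [p ep]; exists (- p) => z; rewrite mevalN ep. Qed.

Lemma mfunM g h : mfun g -> mfun h -> mfun (fun z => g z * h z).
Proof. by move=> [p ep] [q eq_]; exists (p * q) => z; rewrite mevalM ep eq_. Qed.

Lemma mfun_sum (I : finType) (G : I -> ('I_N -> K) -> K) :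
  (forall i, mfun (G i)) -> mfun (fun z => \sum_i G i z).
Proof.
move=> /choice[p pG]; exists (\sum_i p i) => z.
by rewrite raddf_sum; apply: eq_bigr => i _; exact: pG.
Qed.

Lemma mfun_lin (U W : vectType K) (L : {linear U -> W}) (g : ('I_N -> K) -> U) :
  (forall i, mfun (fun z => coord (vbasis {:U}) i (g z))) ->
  forall i, mfun (fun z => coord (vbasis {:W}) i (L (g z))).
Proof.
move=> gP i; apply: (@mfun_ext (fun z =>
  \sum_j coord (vbasis {:U}) j (g z) * coord (vbasis {:W}) i (L (vbasis {:U})`_j))).
  move=> z; rewrite {2}(coord_vbasis (memvf (g z))) !linear_sum.
  by apply: eq_bigr => j _; rewrite !linearZ.
by apply: mfun_sum => j; apply: mfunM (gP j) (mfun_const _).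
Qed.

Lemma mfun_mx p q (g : ('I_N -> K) -> 'M[K]_(p, q)) :
  (forall k l, mfun (fun z => g z k l)) ->
  forall i, mfun (fun z => coord (vbasis {: 'M[K]_(p, q)}) i (g z)).
Proof.
move=> gP i; apply: (@mfun_ext (fun z => \sum_k \sum_l
   g z k l * coord (vbasis {: 'M[K]_(p, q)}) i (delta_mx k l))).
  move=> z; rewrite {2}(matrix_sum_delta (g z)) linear_sum; apply: eq_bigr => k _.
  by rewrite linear_sum; apply: eq_bigr => l _; rewrite linearZ.
by apply: mfun_sum => k; apply: mfun_sum => l; apply: mfunM (gP k l) (mfun_const _).
Qed.

End PolynomialFunctions.

Section Parametrization.
Variables (K : numClosedFieldType) (m : nat) (A : 'M[K]_m).
Hypothesis hA : A^T = - A.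
Implicit Types (v w u p q : 'cV[K]_m) (b : ext2 K m).
Local Notation a := (aform A).
Local Notation V := (ext2 K m).
Local Notation N := (m + (m + m))%N.
Implicit Types z : 'I_N -> K.

Definition cone b := exists v w, b = wedge v w /\ a v w = 0.

Lemma coneZ c b : cone b -> cone (c *: b).
Proof.
move=> [v [w [-> vw]]]; exists (c *: v), w.
by rewrite wedgeZl aformZl vw mulr0.
Qed.

Definition vec3 v w u : 'I_N -> K := fun i =>
  match split i with
  | inl i => v i 0
  | inr j => match split j with inl j => w j 0 | inr j => u j 0 end
  end.

Definition vec3_1 z := \col_i z (lshift _ i).
Definition vec3_2 z := \col_i z (rshift _ (lshift _ i)).
Definition vec3_3 z := \col_i z (rshift _ (rshift _ i)).

Lemma vec3K1 v w u : vec3_1 (vec3 v w u) = v.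
Proof.
apply/matrixP => i j; rewrite mxE (ord1 j) /vec3.
by rewrite (unsplitK (inl i : 'I_m + 'I_(m + m))).
Qed.

Lemma vec3K2 v w u : vec3_2 (vec3 v w u) = w.
Proof.
apply/matrixP => i j; rewrite mxE (ord1 j) /vec3.
rewrite (unsplitK (inr (lshift m i) : 'I_m + 'I_(m + m))).
by rewrite (unsplitK (inl i : 'I_m + 'I_m)).
Qed.

Lemma vec3K3 v w u : vec3_3 (vec3 v w u) = u.
Proof.
apply/matrixP => i j; rewrite mxE (ord1 j) /vec3.
rewrite (unsplitK (inr (rshift m i) : 'I_m + 'I_(m + m))).
by rewrite (unsplitK (inr i : 'I_m + 'I_m)).
Qed.

Lemma vec3_ex z : exists v w u, z = vec3 v w u.
Proof.
exists (vec3_1 z), (vec3_2 z), (vec3_3 z); apply/funext => i.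
rewrite /vec3; case: splitP => [j|j] ei; rewrite ?mxE.
  by congr z; apply: val_inj.
by case: splitP => k ek; rewrite mxE; congr z; apply: val_inj; rewrite /= ei ek.
Qed.

Definition psi v w u := wedge v (a v u *: w - a v w *: u).

Lemma psi_cone v w u : cone (psi v w u).
Proof.
exists v, (a v u *: w - a v w *: u); split=> //.
by rewrite aformDr aformNr !aformZr mulrC subrr.
Qed.

(** With [a v u = 1] this shows that [psi] reaches every isotropic bivector having a factor outside
    the kernel. *)
Lemma psi1 v w u : a v w = 0 -> psi v w u = a v u *: wedge v w.
Proof. by move=> vw; rewrite /psi vw scale0r subr0 wedgeZr. Qed.

Definition psiz z := psi (vec3_1 z) (vec3_2 z) (vec3_3 z).

Lemma psiz_vec3 v w u : psiz (vec3 v w u) = psi v w u.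
Proof. by rewrite /psiz vec3K1 vec3K2 vec3K3. Qed.

Lemma mfun_psiz i : mfun (fun z => coord (vbasis {:V}) i (psiz z)).
Proof.
have ent (f g : ('I_N -> K) -> 'cV[K]_m) : (forall i, mfun (fun z => f z i 0)) ->
   (forall i, mfun (fun z => g z i 0)) -> mfun (fun z => a (f z) (g z)).
  move=> fP gP; apply: (@mfun_ext _ _ (fun z => \sum_j (\sum_k f z k 0 * A k j) * g z j 0)).
    move=> z; rewrite /aform mxE; apply: eq_bigr => j _; rewrite mxE; congr (_ * _).
    by apply: eq_bigr => k _; rewrite mxE.
  apply: mfun_sum => j; apply: mfunM (gP j); apply: mfun_sum => k.
  exact: mfunM (fP k) (mfun_const _ _).
have P1 j : mfun (fun z => vec3_1 z j 0).
  by apply: mfun_ext (mfun_coord K (lshift (m + m) j)) => z; rewrite mxE.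
have P2 j : mfun (fun z => vec3_2 z j 0).
  by apply: mfun_ext (mfun_coord K (rshift m (lshift m j))) => z; rewrite mxE.
have P3 j : mfun (fun z => vec3_3 z j 0).
  by apply: mfun_ext (mfun_coord K (rshift m (rshift m j))) => z; rewrite mxE.
pose q z := a (vec3_1 z) (vec3_3 z) *: vec3_2 z - a (vec3_1 z) (vec3_2 z) *: vec3_3 z.
have Pq j : mfun (fun z => q z j 0).
  apply: (@mfun_ext _ _ (fun z => a (vec3_1 z) (vec3_3 z) * vec3_2 z j 0
     + - (a (vec3_1 z) (vec3_2 z) * vec3_3 z j 0))).
    by move=> z; rewrite !mxE.
  by apply: mfunD; last apply: mfunN; apply: mfunM => //; apply: ent.
pose M z := vec3_1 z *m (q z)^T - q z *m (vec3_1 z)^T.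
have PM k l : mfun (fun z => M z k l).
  apply: (@mfun_ext _ _ (fun z => vec3_1 z k 0 * q z l 0 + - (q z k 0 * vec3_1 z l 0))).
    by move=> z; rewrite !mxE !big_ord1 !mxE.
  by apply: mfunD; last apply: mfunN; apply: mfunM.
have := mfun_lin (vsproj (antisym K m)) (mfun_mx PM) i.
apply: mfun_ext => z; congr (coord _ _ _); apply: val_inj; rewrite /= vsprojK //.
exact: (valP (psiz z)).
Qed.

End Parametrization.

(** * Homogeneity of the polynomial lift *)

Section HomogeneousLift.
Variables (K : closedFieldType) (W : vectType K) (N : nat).
Variables (D : ('I_N -> K) -> Prop) (l : ('I_N -> K) -> {vspace W}).
Variable F : 'I_(\dim {:W}) -> {mpoly K[N]}.
Hypothesis F_univ : forall E, (forall z, D z -> mvec E z \in l z) ->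
  exists h, forall i, E i = h * F i.
Hypothesis F_in : forall z, D z -> mvec F z \in l z.
Hypothesis F_nz : exists z, mvec F z != 0.
Variable e : 'I_N -> nat.

Definition rescale (s : K) (z : 'I_N -> K) : 'I_N -> K := fun i => s ^+ e i * z i.

Hypothesis D_rescale : forall s z, s != 0 -> D z -> D (rescale s z) /\ l (rescale s z) = l z.

Lemma rescaleK s z : s != 0 -> rescale s^-1 (rescale s z) = z.
Proof.
by move=> s0; apply/funext => i; rewrite /rescale mulrA -exprMn mulVf // expr1n mul1r.
Qed.

(** Rescaled, [F] is again a section, hence [h s] times [F]; rescaling back shows that [h s] has no
    zeros, so it is constant. Read off one coordinate, this constant is polynomial in [s] with no
    zero but 0, hence a monomial, normalized by its value at 1. *)
Lemma lift_homogeneous : exists k, forall s z, s != 0 ->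
  mvec F (rescale s z) = s ^+ k *: mvec F z.
Proof.
pose sub (s : K) (p : {mpoly K[N]}) := p \mPo [tuple (s ^+ e i) *: 'X_i | i < N].
have subE s p z : (sub s p).@[z] = p.@[rescale s z].
  rewrite /sub comp_mpoly_meval; apply: meval_eq => i.
  by rewrite tnth_mktuple mevalZ mevalXU.
have mvec_sub s z : mvec (fun i => sub s (F i)) z = mvec F (rescale s z).
  by apply: eq_bigr => i _; rewrite subE.
have hex s : exists h : {mpoly K[N]}, s != 0 ->
    forall z, mvec F (rescale s z) = h.@[z] *: mvec F z.
  have [->|s0] := eqVneq s 0; first by exists 0.
  have [|h hE] := @F_univ (fun i => sub s (F i)).
    move=> z Dz; rewrite mvec_sub; have [Dr <-] := D_rescale s0 Dz.
    exact: F_in.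
  exists h => _ z; rewrite -mvec_sub; exact: mvecZ.
have [h hE] := choice hex.
have [z0 Fz0] := F_nz.
have [i0 Fi0] := mvec_neq0 Fz0.
have Fi0' : F i0 != 0 by apply: contraNneq Fi0 => ->; rewrite meval0.
have hh s : s != 0 -> forall z, (h s^-1).@[rescale s z] * (h s).@[z] = 1.
  move=> s0 z; rewrite -subE -mevalM.
  suff -> : sub s (h s^-1) * h s = 1 by rewrite meval1.
  apply: (mulIf Fi0'); rewrite mul1r; apply/eqP; rewrite -subr_eq0.
  apply/eqP/closed_mpoly_eq0 => y; rewrite mevalB !mevalM subE.
  have e1 := hE _ s0 y; have s0' : s^-1 != 0 by rewrite invr_eq0.
  have := hE _ s0' (rescale s y); rewrite rescaleK // e1 scalerA.
  move=> /(congr1 (coord (vbasis {:W}) i0)); rewrite linearZ /= coord_mvec => <-.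
  exact: subrr.
have h0 s z : s != 0 -> (h s).@[z] != 0.
  move=> s0; have := oner_neq0 K; rewrite -(hh s s0 z) mulf_eq0 negb_or.
  by case/andP.
have hc s z : s != 0 -> (h s).@[z] = (h s).@[fun=> 0].
  move=> s0; have := @pfun1_nz_const _ (fun t => (h s).@[fun i => t * z i]) _ _ 1.
  have -> : (fun i => 1 * z i) = z by apply/funext => i; rewrite mul1r.
  have -> : (fun i => 0 * z i) = (fun=> 0) by apply/funext => i; rewrite mul0r.
  apply=> [|t]; last exact: h0.
  by apply: pfun1_mpoly => i; apply: pfun1M (pfun1_id _) (pfun1_const _).
pose g s := (F i0).@[rescale s z0].
have gE s : s != 0 -> g s = (h s).@[fun=> 0] * (F i0).@[z0].
  by move=> s0; rewrite /g -coord_mvec hE // linearZ /= coord_mvec hc.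
have [||k [c [c0 gk]]] := @pfun1_monomial _ g.
- by apply: pfun1_mpoly => i; apply: pfun1M (pfun1X _ (pfun1_id _)) (pfun1_const _).
- by move=> s s0; rewrite gE // mulf_neq0 // h0.
have c1 : c = (F i0).@[z0].
  have -> : c = g 1 by rewrite gk expr1n mulr1.
  by congr (F i0).@[_]; apply/funext => i; rewrite /rescale expr1n mul1r.
exists k => s z s0; rewrite hE // hc //; congr (_ *: _).
by apply: (mulIf Fi0); rewrite -gE // gk c1 mulrC.
Qed.

End HomogeneousLift.

Section ConeLift.
Variables (K : numClosedFieldType) (m : nat) (A : 'M[K]_m).
Hypothesis hA : A^T = - A.
Implicit Types (v w u p q : 'cV[K]_m) (b : ext2 K m).
Local Notation a := (aform A).
Local Notation V := (ext2 K m).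
Local Notation N := (m + (m + m))%N.

Variable c0 : 'cV[K]_m.
Hypothesis kerA : forall v, (forall w, a v w = 0) -> exists x, v = x *: c0.
Variables e0 e1 f0 f1 : 'cV[K]_m.
Hypotheses (e0f0 : a e0 f0 = 1) (e0f1 : a e0 f1 = 0) (e1f0 : a e1 f0 = 0)
  (e1f1 : a e1 f1 = 1) (e0e1 : a e0 e1 = 0).

(** An abstract field of lines on the cone, so that the results apply both to an automorphism and to
    its inverse. The hyperbolic pairs above supply a nonzero isotropic bivector. *)
Variable fl : V -> {vspace V}.
Hypothesis fl_scale : forall x b, x != 0 -> cone A b -> b != 0 -> fl (x *: b) = fl b.
Hypothesis fl_local : forall b, cone A b -> b != 0 ->
  exists (s : {mpoly K[\dim {:V}]}) (P : 'I_(\dim {:V}) -> {mpoly K[\dim {:V}]}),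
  peval s b != 0 /\ forall b', cone A b' -> b' != 0 -> peval s b' != 0 ->
    poly_map P b' != 0 /\ fl b' = <[poly_map P b']>%VS.

Lemma e0e1_neq0 : wedge e0 e1 != 0.
Proof.
apply/eqP => /wedge_eq0[|x ex].
  by apply: contraPneq e0f0 => ->; rewrite aform0l => /eqP; rewrite eq_sym oner_eq0.
by move: e1f1; rewrite ex aformZl e0f1 mulr0 => /eqP; rewrite eq_sym oner_eq0.
Qed.

Lemma psi_lift : exists F : 'I_(\dim {:V}) -> {mpoly K[N]},
  (forall z, psiz A z != 0 -> mvec F z != 0 /\ fl (psiz A z) = <[mvec F z]>%VS) /\
  forall E, (forall z, psiz A z != 0 -> mvec E z \in fl (psiz A z)) ->
    exists h, forall i, E i = h * F i.
Proof.
have [Psi PsiE] := choice (@mfun_psiz _ _ A).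
pose z0 := vec3 e0 e1 f0.
have [i di] : exists i, coord (vbasis {:V}) i (psiz A z0) != 0.
  apply: contrapT => n; have /eqP := e0e1_neq0; apply.
  have -> : wedge e0 e1 = psiz A z0 by rewrite psiz_vec3 psi1 // e0f0 scale1r.
  rewrite (coord_vbasis (memvf (psiz A z0))); apply: big1 => i _.
  have [->|di] := eqVneq (coord (vbasis {:V}) i (psiz A z0)) 0; first exact: scale0r.
  by case: n; exists i.
pose pull (r : {mpoly K[\dim {:V}]}) := r \mPo [tuple Psi i | i < \dim {:V}].
have pullE (r : {mpoly K[\dim {:V}]}) z : (pull r).@[z] = peval r (psiz A z).
  rewrite /pull comp_mpoly_meval /peval; apply: meval_eq => j.
  by rewrite tnth_mktuple PsiE.
(* The role of [delta] is played by a coordinate of [psiz] that is nonzero at [z0]. *)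
apply: (@polynomial_lift _ _ _ _ _ (Psi i)).
- by apply: contraNneq di => e; rewrite PsiE e meval0.
- by move=> z; apply: contraNneq => e; rewrite -PsiE e linear0.
- move=> z z_nz; have [s [P [sz sP]]] := fl_local (psi_cone A _ _ _) z_nz.
  exists (pull s), (fun i => pull (P i)); rewrite pullE; split=> // y y_nz; rewrite pullE => sy.
  have -> : mvec (fun i => pull (P i)) y = poly_map P (psiz A y).
    by apply: eq_bigr => j _; rewrite pullE.
  by apply: sP => //; exact: psi_cone.
Qed.

Section WithLift.
Variable F : 'I_(\dim {:V}) -> {mpoly K[N]}.
Hypothesis F_lift : forall z, psiz A z != 0 ->
  mvec F z != 0 /\ fl (psiz A z) = <[mvec F z]>%VS.
Hypothesis F_univ : forall E, (forall z, psiz A z != 0 -> mvec E z \in fl (psiz A z)) ->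
    exists h, forall i, E i = h * F i.

Definition Phi v w u := mvec F (vec3 v w u).

Lemma PhiP v w u : psi A v w u != 0 ->
  Phi v w u != 0 /\ fl (psi A v w u) = <[Phi v w u]>%VS.
Proof. by rewrite -psiz_vec3 => /F_lift. Qed.

Lemma Phi_curve (v w u : K -> 'cV[K]_m) : (forall i, pfun1 (fun s => v s i 0)) ->
  (forall i, pfun1 (fun s => w s i 0)) -> (forall i, pfun1 (fun s => u s i 0)) ->
  pvec1 (fun s => Phi (v s) (w s) (u s)).
Proof.
move=> vP wP uP i; apply: (@pfun1_ext _ (fun s => (F i).@[vec3 (v s) (w s) (u s)])).
  by move=> s; rewrite coord_mvec.
apply: pfun1_mpoly => j; rewrite /vec3; case: split => // j'; by case: split.
Qed.

(** Along the segment [Phi] is a polynomial curve, never zero, inside the single line [fl b]. *)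
Lemma Phi_segment v v' w w' u u' b : b != 0 ->
  (forall s, psi A (v + s *: v') (w + s *: w') (u + s *: u') = b) ->
  Phi (v + v') (w + w') (u + u') = Phi v w u.
Proof.
move=> b0 psib; pose g s := Phi (v + s *: v') (w + s *: w') (u + s *: u').
have gP s : g s != 0 /\ fl b = <[g s]>%VS.
  by rewrite -(psib s); apply: PhiP; rewrite psib.
have aff (x y : 'cV[K]_m) i : pfun1 (fun s => (x + s *: y) i 0).
  apply: (@pfun1_ext _ (fun s => x i 0 + s * y i 0)); first by move=> s; rewrite !mxE.
  exact: pfun1D (pfun1_const _) (pfun1M (pfun1_id _) (pfun1_const _)).
have := @pvec1_line_const _ _ (g 0) g _ _ _ 1; rewrite /g !scale1r !scale0r !addr0.
apply=> [|s|s].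
- by apply: Phi_curve => i; apply: aff.
- by have [] := gP s.
- have [_ e] := gP s; have [_ e'] := gP 0; move: e'; rewrite /g !scale0r !addr0 => <-.
  by rewrite e; exact: memv_line.
Qed.

Lemma Phi_scale : exists k : nat * nat * nat, forall s v w u, s != 0 ->
  [/\ Phi (s *: v) w u = s ^+ k.1.1 *: Phi v w u,
      Phi v (s *: w) u = s ^+ k.1.2 *: Phi v w u &
      Phi v w (s *: u) = s ^+ k.2 *: Phi v w u].
Proof.
pose D z := psiz A z != 0.
have F_in z : D z -> mvec F z \in fl (psiz A z).
  by move=> /F_lift[_ ->]; exact: memv_line.
have F_nz : exists z, mvec F z != 0.
  exists (vec3 e0 e1 f0); have [] // := PhiP (v := e0) (w := e1) (u := f0).
  by rewrite psi1 // e0f0 scale1r e0e1_neq0.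
(* Weights on the three blocks of coordinates; weight 1 on one block and 0 on the others gives the
   degree in that block. *)
pose ee (i j k : nat) (x : 'I_N) := match split x with
  | inl _ => i | inr y => match split y with inl _ => j | inr _ => k end end.
have reE i j k s v w u :
    rescale (ee i j k) s (vec3 v w u) = vec3 (s ^+ i *: v) (s ^+ j *: w) (s ^+ k *: u).
  apply/funext => x; rewrite /rescale /ee /vec3; case: split => [y|y]; first by rewrite mxE.
  by case: split => y'; rewrite mxE.
have psi_re i j k s v w u : psi A (s ^+ i *: v) (s ^+ j *: w) (s ^+ k *: u) =
    s ^+ (i + i + j + k) *: psi A v w u.
  rewrite /psi wedgeZl !aformZl !aformZr !scalerA.
  have -> : s ^+ i * (s ^+ k * a v u) * s ^+ j = s ^+ (i + j + k) * a v u.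
    by rewrite !exprD; ring.
  have -> : s ^+ i * (s ^+ j * a v w) * s ^+ k = s ^+ (i + j + k) * a v w.
    by rewrite !exprD; ring.
  rewrite -!scalerA -scalerBr wedgeZr scalerA; congr (_ *: _).
  by rewrite -exprD -!addnA.
have hom i j k : exists n, forall s v w u, s != 0 ->
    Phi (s ^+ i *: v) (s ^+ j *: w) (s ^+ k *: u) = s ^+ n *: Phi v w u.
  have [|n nE] := @lift_homogeneous _ _ _ D (fun z => fl (psiz A z)) F F_univ F_in F_nz (ee i j k).
    move=> s z s0; have [v [w [u ->]]] := vec3_ex z; rewrite /D reE !psiz_vec3 psi_re => z0.
    have sn : s ^+ (i + i + j + k) != 0 by rewrite expf_neq0.
    by rewrite scaler_eq0 negb_or sn z0 fl_scale //; exact: psi_cone.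
  by exists n => s v w u s0; rewrite /Phi -reE nE.
have [i iP] := hom 1%N 0%N 0%N; have [j jP] := hom 0%N 1%N 0%N; have [k kP] := hom 0%N 0%N 1%N.
exists (i, j, k) => s v w u s0; split=> /=.
- by rewrite -iP // !expr0 expr1 !scale1r.
- by rewrite -jP // !expr0 expr1 !scale1r.
- by rewrite -kP // !expr0 expr1 !scale1r.
Qed.

End WithLift.
End ConeLift.

(** * Descent of the lift from triples of vectors to bivectors *)

Section Descent.
Variables (K : numClosedFieldType) (m : nat) (A : 'M[K]_m).
Hypothesis hA : A^T = - A.
Implicit Types (v w u p q : 'cV[K]_m) (b : ext2 K m).
Local Notation a := (aform A).
Local Notation V := (ext2 K m).

Variable c0 : 'cV[K]_m.
Hypothesis ker_line : forall v, (forall w, a v w = 0) -> exists x, v = x *: c0.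
Variables e0 e1 f0 f1 : 'cV[K]_m.
Hypotheses (e0f0 : a e0 f0 = 1) (e0f1 : a e0 f1 = 0) (e1f0 : a e1 f0 = 0)
  (e1f1 : a e1 f1 = 1) (e0e1 : a e0 e1 = 0).

Variables (W : vectType K) (Phi : 'cV[K]_m -> 'cV[K]_m -> 'cV[K]_m -> W) (kv kw ku : nat).
Hypothesis Phi_segment : forall v v' w w' u u' b, b != 0 ->
  (forall s, psi A (v + s *: v') (w + s *: w') (u + s *: u') = b) ->
  Phi (v + v') (w + w') (u + u') = Phi v w u.
Hypothesis Phi_nz : forall v w u, psi A v w u != 0 -> Phi v w u != 0.
Hypothesis Phi_scalev : forall (s : K) v w u, s != 0 -> Phi (s *: v) w u = s ^+ kv *: Phi v w u.
Hypothesis Phi_scalew : forall (s : K) v w u, s != 0 -> Phi v (s *: w) u = s ^+ kw *: Phi v w u.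
Hypothesis Phi_scaleu : forall (s : K) v w u, s != 0 -> Phi v w (s *: u) = s ^+ ku *: Phi v w u.

Lemma Phi_segmentv v v' w u b : b != 0 -> (forall s, psi A (v + s *: v') w u = b) ->
  Phi (v + v') w u = Phi v w u.
Proof.
move=> b0 E; rewrite -[X in Phi _ X _ = _]addr0 -[X in Phi _ _ X = _]addr0.
by apply: (Phi_segment b0) => s; rewrite !scaler0 !addr0.
Qed.

Lemma Phi_segmentw v w w' u b : b != 0 -> (forall s, psi A v (w + s *: w') u = b) ->
  Phi v (w + w') u = Phi v w u.
Proof.
move=> b0 E; rewrite -[X in Phi X _ _ = _]addr0 -[X in Phi _ _ X = _]addr0.
by apply: (Phi_segment b0) => s; rewrite !scaler0 !addr0.
Qed.

Lemma Phi_segmentu v w u u' b : b != 0 -> (forall s, psi A v w (u + s *: u') = b) ->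
  Phi v w (u + u') = Phi v w u.
Proof.
move=> b0 E; rewrite -[X in Phi X _ _ = _]addr0 -[X in Phi _ X _ = _]addr0.
by apply: (Phi_segment b0) => s; rewrite !scaler0 !addr0.
Qed.

Definition nonker v := exists u, a v u = 1.

Definition dual v : 'cV[K]_m := xget 0 [set u | a v u = 1].

Lemma dualP v : nonker v -> a v (dual v) = 1.
Proof. by move=> [u vu]; rewrite /dual; case: xgetP => // /(_ u). Qed.

Lemma nonkerP v : nonker v \/ forall w, a v w = 0.
Proof.
have [nv|nn] := pselect (nonker v); [by left|right => w].
have [->//|vw] := eqVneq (a v w) 0; case: nn; exists ((a v w)^-1 *: w).
by rewrite aformZr mulVf.
Qed.

Definition Psi v q := Phi v q (dual v).

(** The admissible [u] form an affine space on which [psi v q u] is constantly [v /\ q], so each is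
    joined to the chosen one by a line in the fibre. *)
Lemma Psi_dual v q u : a v u = 1 -> a v q = 0 -> wedge v q != 0 -> Phi v q u = Psi v q.
Proof.
move=> vu vq0 vq; have nv : nonker v by exists u.
rewrite /Psi -[dual v](subrK u) addrC; apply/esym; apply: (Phi_segmentu vq) => s.
rewrite psi1 // aformDr aformZr aformDr aformNr (dualP nv) vu.
by rewrite subrr mulr0 addr0 scale1r.
Qed.

Lemma Psi_addr v q x : nonker v -> a v q = 0 -> wedge v q != 0 ->
  Psi v (q + x *: v) = Psi v q.
Proof.
move=> nv vq0 vq; apply: (Phi_segmentw vq) => s; rewrite psi1.
  by rewrite dualP // scale1r !wedgeE2 !scaler0 addr0.
by rewrite aformDr !aformZr (aformvv hA) vq0 !mulr0 addr0.
Qed.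

(** Being orthogonal to [q], one and the same [u] stays dual to [v + s q] for all [s]. *)
Lemma Psi_addl v q x u : a v u = 1 -> a q u = 0 -> a v q = 0 -> wedge v q != 0 ->
  Psi (v + x *: q) q = Psi v q.
Proof.
move=> vu qu vq0 vq.
have vx s : a (v + s *: q) u = 1 by rewrite aformDl aformZl qu mulr0 addr0.
have vxq s : a (v + s *: q) q = 0 by rewrite aformDl aformZl (aformvv hA) mulr0 addr0.
have wvx s : wedge (v + s *: q) q = wedge v q by rewrite !wedgeE2 scaler0 addr0.
rewrite -(Psi_dual (vx x)) ?wvx // -(Psi_dual vu) //.
apply: (Phi_segmentv vq) => s; rewrite scalerA psi1 ?vxq //.
by rewrite vx scale1r wvx.
Qed.

Lemma Psi_scaler v q (s : K) : s != 0 -> Psi v (s *: q) = s ^+ kw *: Psi v q.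
Proof. exact: Phi_scalew. Qed.

Lemma Psi_scalel v q (s : K) : s != 0 -> nonker v -> a v q = 0 -> wedge v q != 0 ->
  s ^+ ku *: Psi (s *: v) q = s ^+ kv *: Psi v q.
Proof.
move=> s0 nv vq0 vq; have vu := dualP nv.
have su : a (s *: v) (s^-1 *: dual v) = 1 by rewrite aformZl aformZr mulVKf ?vu.
have svq : wedge (s *: v) q != 0 by rewrite wedgeZl scaler_eq0 negb_or s0.
rewrite -(Psi_dual su) //; last by rewrite aformZl vq0 mulr0.
by rewrite -Phi_scaleu // scalerA mulfV // scale1r Phi_scalev.
Qed.

(** Independence modulo the kernel of [A], given by a dual pair because the shears in [v] need
    one. *)
Definition indep v q := exists u u', [/\ a v u = 1, a q u = 0, a v u' = 0 & a q u' = 1].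

Lemma indep_wedge v q : indep v q -> wedge v q != 0.
Proof.
move=> [u [u' [vu qu vu' qu']]]; apply/eqP => /wedge_eq0[|x ex].
  by apply: contraPneq vu => ->; rewrite aform0l => /eqP; rewrite eq_sym oner_eq0.
by move: qu'; rewrite ex aformZl vu' mulr0 => /eqP; rewrite eq_sym oner_eq0.
Qed.

Lemma indep_lin v q (x y z t : K) : x * t - y * z = 1 -> indep v q ->
  indep (x *: v + y *: q) (z *: v + t *: q).
Proof.
move=> d [u [u' [vu qu vu' qu']]].
exists (t *: u + (- z) *: u'), ((- y) *: u + x *: u').
rewrite !aformE vu qu vu' qu'.
by split; [rewrite -[RHS]d; ring | ring | ring | rewrite -[RHS]d; ring].
Qed.

Lemma aform_lin2 v q (x y z t : K) : a v q = 0 -> a (x *: v + y *: q) (z *: v + t *: q) = 0.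
Proof. by move=> vq; rewrite !aformE !(aformvv hA) (aformC hA v q) vq; ring. Qed.

(** A matrix of SL2 with [y] nonzero is a product of three shears, with parameters [(x - 1) / y],
    [y] and [(t - 1) / y]. If [y = 0] then [t] is nonzero, and one more shear replaces [y] by
    [t]. *)
Lemma Psi_SL2 v q (x y z t : K) : a v q = 0 -> indep v q -> x * t - y * z = 1 ->
  Psi (x *: v + y *: q) (z *: v + t *: q) = Psi v q.
Proof.
have main v' q' (x' y' z' t' : K) : a v' q' = 0 -> indep v' q' -> x' * t' - y' * z' = 1 ->
    y' != 0 -> Psi (x' *: v' + y' *: q') (z' *: v' + t' *: q') = Psi v' q'.
  clear v q x y z t; move: v' q' x' y' z' t' => v q x y z t vq0 vq d y0.
  have w0 := indep_wedge vq; have [u [u' [vu qu vu' qu']]] := vq.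
  have nv : nonker v by exists u.
  pose r := (x - 1) / y; pose h := (t - 1) / y.
  have -> : Psi v q = Psi v (q + r *: v) by rewrite Psi_addr.
  have e1' : x *: v + y *: q = v + y *: (q + r *: v).
    by apply/matrixP => i j; rewrite !mxE /r; field.
  have vq0' : a v (q + r *: v) = 0 by rewrite aformDr aformZr (aformvv hA) mulr0 addr0.
  have w0' : wedge v (q + r *: v) = wedge v q by rewrite !wedgeE2 scaler0 addr0.
  have -> : Psi v (q + r *: v) = Psi (x *: v + y *: q) (q + r *: v).
    rewrite e1' (@Psi_addl _ _ _ (u - r *: u')) ?w0' //.
      by rewrite !aformE vu vu' mulr0 oppr0 addr0.
    by rewrite !aformE qu qu' vu vu'; ring.
  have -> : z *: v + t *: q = (q + r *: v) + h *: (x *: v + y *: q).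
    have hx : z * y = (x - 1) + (t - 1) * x.
      by have := d; move=> /eqP; rewrite subr_eq => /eqP; rewrite mulrBl mul1r => d'; ring: d'.
    apply/matrixP => i j; rewrite !mxE /r /h.
    have -> : z = (x - 1) / y + (t - 1) / y * x.
      by apply: (mulIf y0); rewrite hx; field.
    by field.
  rewrite Psi_addr //.
  - exists (t *: u + (- z) *: u'); by rewrite !aformE vu qu vu' qu' -[RHS]d; ring.
  - have := @aform_lin2 v q x y r 1 vq0; rewrite scale1r addrC.
    by rewrite [r *: v + q]addrC [y *: q + _]addrC.
  - have := @wedge_lin2 _ _ x y r 1 v q; rewrite scale1r [r *: v + q]addrC => ->.
    have -> : x * 1 - y * r = 1 by rewrite /r mulrC [y * _]mulrC divfK //; ring.
    by rewrite scale1r.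
move=> vq0 vq d; have [y0|] := eqVneq y 0; last exact: main.
have [u [u' [h1 h2 h3 h4]]] := indep_lin d vq.
rewrite -(@Psi_addl _ _ 1 u) ?aform_lin2 ?indep_wedge //; last first.
  exact: indep_lin.
have t0 : t != 0.
  by apply: contra_eq_neq d => ->; rewrite y0 mul0r mulr0 subrr eq_sym oner_eq0.
have -> : x *: v + y *: q + 1 *: (z *: v + t *: q) = (x + z) *: v + (y + t) *: q.
  by rewrite scale1r !scalerDl addrACA.
rewrite main //; last by rewrite y0 add0r.
by rewrite -d; ring.
Qed.

Lemma indep_e : indep e0 e1.
Proof. by exists f0, f1. Qed.

(** Invariance of [Psi] under diag(2, 1/2) compares two powers of 2, and in characteristic zero the
    2-adic valuation reads off the exponents. *)
Lemma exponents : kv = (ku + kw)%N.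
Proof.
have two : (2 : K) != 0 by rewrite pnatr_eq0.
have n0 : nonker e0 by exists f0.
have w0 := indep_wedge indep_e.
have P0 : Psi e0 e1 != 0 by apply: Phi_nz; rewrite psi1 // dualP // scale1r.
have := @Psi_SL2 e0 e1 2 0 0 2^-1 e0e1 indep_e _.
rewrite !scale0r addr0 add0r mul0r subr0 mulfV // => /(_ erefl) E.
have w2 : wedge e0 (2^-1 *: e1) != 0 by rewrite wedgeZr scaler_eq0 negb_or invr_eq0 two.
have := @Psi_scalel e0 (2^-1 *: e1) 2 two n0 _ w2; rewrite E aformZr e0e1 mulr0 => /(_ erefl).
rewrite Psi_scaler ?invr_eq0 // scalerA => /eqP.
rewrite -subr_eq0 -scalerBl scaler_eq0 (negPf P0) orbF subr_eq0 exprVn => /eqP E2.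
have : (2 : K) ^+ kv = 2 ^+ (ku + kw).
  by rewrite exprD E2 mulfVK // expf_neq0.
rewrite -!natrX => /eqP; rewrite eqr_nat => /eqP.
by move=> /(congr1 (logn 2)); rewrite !pfactorK.
Qed.

Lemma indepP v q : nonker v -> indep v q \/ exists x, forall w, a (q - x *: v) w = 0.
Proof.
move=> [u vu]; have [[u' ru']|rk] := nonkerP (q - a q u *: v); last by right; exists (a q u).
left; pose u2 := u' - a v u' *: u; have vu2 : a v u2 = 0 by rewrite !aformE vu; ring.
have qu2 : a q u2 = 1 by move: ru'; rewrite /u2 !aformE => <-; ring.
exists (u - a q u *: u2), u2; move: u2 vu2 qu2 => u2 vu2 qu2.
by rewrite !aformE vu vu2 qu2; split=> //; ring.
Qed.

(** The well-definedness of [G]: two factorizations of a bivector differ by a matrix of SL2, which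
    [Psi_SL2] handles unless the plane meets the kernel. *)
Lemma Psi_wedge v q v' q' : a v q = 0 -> nonker v -> nonker v' ->
  wedge v q = wedge v' q' -> wedge v q != 0 -> Psi v q = Psi v' q'.
Proof.
move=> vq0 nv nv' e vq.
have [x [y [z [t [ev eq' d]]]]] := wedge_span e vq.
have vq0' : a v' q' = 0 by rewrite ev eq' aform_lin2.
have [ind|[r rk]] := indepP q nv; first by rewrite ev eq' Psi_SL2.
have vq' : wedge v' q' != 0 by rewrite -e.
(* When the plane contains a kernel vector [c], shears reduce both pairs to multiples of [v] and
   [c], with factors [x'] and [t'] such that [x' * t' = 1]. Their contributions cancel precisely
   because [kv = ku + kw]. *)
have [c [eq0 ck]] : exists c, q = c + r *: v /\ forall w, a c w = 0.
  by exists (q - r *: v); rewrite subrK.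
have cv w : a w c = 0 by rewrite (aformC hA c) ck oppr0.
have vc : wedge v c = wedge v q by rewrite eq0 !wedgeE2 scaler0 addr0.
have -> : Psi v q = Psi v c by rewrite {1}eq0 Psi_addr ?vc.
have [u vu] := nv.
have ev2 : v' = (x + y * r) *: v + y *: c.
  by rewrite ev {1}eq0 scalerDr scalerA scalerDl addrAC addrA.
have eq2 : q' = (z + t * r) *: v + t *: c.
  by rewrite eq' {1}eq0 scalerDr scalerA scalerDl addrAC addrA.
set x' := x + y * r in ev2; set z' := z + t * r in eq2.
have d' : x' * t - y * z' = 1 by rewrite -d /x' /z'; ring.
have nx : x' != 0.
  apply/eqP => x0; have [u' ] := nv'; rewrite ev2 x0 scale0r add0r aformZl ck mulr0.
  by move=> /eqP; rewrite eq_sym oner_eq0.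
pose t' := t - z' / x' * y.
have t'E : x' * t' = 1 by rewrite /t' mulrBr mulrA mulrCA mulfV // mulr1 mulrC -[RHS]d'; ring.
have -> : Psi v' q' = Psi v' (t' *: c).
  have -> : t' *: c = q' + (- (z' / x')) *: v'.
    by rewrite ev2 eq2 /t'; apply/matrixP => i j; rewrite !mxE; field.
  by rewrite Psi_addr.
have t0 : t' != 0 by apply: contra_eq_neq t'E => ->; rewrite mulr0 eq_sym oner_eq0.
rewrite Psi_scaler // ev2.
have nxv : wedge (x' *: v) c != 0 by rewrite wedgeZl scaler_eq0 negb_or nx vc.
have xu : a (x' *: v) (x'^-1 *: u) = 1 by rewrite aformZl aformZr mulVKf ?vu.
rewrite (Psi_addl _ xu) ?ck ?cv //.
have cv0 : a v c = 0 := cv v.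
have := Psi_scalel nx nv cv0; rewrite vc => /(_ vq); rewrite exponents exprD -scalerA.
move=> /(scalerI (expf_neq0 _ nx)) ->.
by rewrite scalerA -exprMn mulrC t'E expr1n scale1r.
Qed.

End Descent.

(** * The map induced on the cone *)

Section ConeMap.
Variables (K : numClosedFieldType) (m : nat) (A : 'M[K]_m).
Hypothesis hA : A^T = - A.
Implicit Types (v w u p q : 'cV[K]_m) (b : ext2 K m).
Local Notation a := (aform A).
Local Notation V := (ext2 K m).

Variable c0 : 'cV[K]_m.
Hypothesis ker_line : forall v, (forall w, a v w = 0) -> exists x, v = x *: c0.
Variables e0 e1 f0 f1 : 'cV[K]_m.
Hypotheses (e0f0 : a e0 f0 = 1) (e0f1 : a e0 f1 = 0) (e1f0 : a e1 f0 = 0)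
  (e1f1 : a e1 f1 = 1) (e0e1 : a e0 e1 = 0).

Variable fl : V -> {vspace V}.
Hypothesis fl_scale : forall x b, x != 0 -> cone A b -> b != 0 -> fl (x *: b) = fl b.
Hypothesis fl_local : forall b, cone A b -> b != 0 ->
  exists (s : {mpoly K[\dim {:V}]}) (P : 'I_(\dim {:V}) -> {mpoly K[\dim {:V}]}),
  peval s b != 0 /\ forall b', cone A b' -> b' != 0 -> peval s b' != 0 ->
    poly_map P b' != 0 /\ fl b' = <[poly_map P b']>%VS.

Lemma cone_nonker b : cone A b -> b != 0 ->
  exists v q, [/\ nonker A v, a v q = 0 & b = wedge v q].
Proof.
move=> [v [w [-> vw]]] b0; have [nv|kv] := nonkerP A v; first by exists v, w.
have [nw|kw] := nonkerP A w.
  by exists w, (- v); rewrite aformNr (aformC hA) vw !oppr0 -scaleN1r wedgeZr scaleN1r -wedgeC.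
have [x ex] := ker_line kv; have [y ey] := ker_line kw.
by move: b0; rewrite ex ey wedgeZl wedgeZr wedgevv !scaler0 eqxx.
Qed.

(** Since [G] is built from a choice of factors for each bivector, its polynomial nature is stated
    along curves in the cone; it is proved locally by contraction and glued by [pfun1_local]. *)
Theorem cone_map : exists (k : nat) (G : V -> V), [/\
  forall b, cone A b -> b != 0 -> G b != 0 /\ fl b = <[G b]>%VS,
  forall x b, x != 0 -> cone A b -> b != 0 -> G (x *: b) = x ^+ k *: G b &
  forall g, pvec1 g -> (forall s, cone A (g s) /\ g s != 0) -> pvec1 (fun s => G (g s))].
Proof.
have [F [F_lift F_univ]] := psi_lift e0f0 e0f1 e1f1 e0e1 fl_local.
have [[[kv kw] ku] /= scale] := Phi_scale e0f0 e0f1 e1f1 e0e1 fl_scale F_lift F_univ.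
have PhiP := PhiP F_lift.
have seg := Phi_segment F_lift.
have Phi_nz v w u : psi A v w u != 0 -> Phi F v w u != 0 by move=> /PhiP[].
have scalev (s : K) v w u : s != 0 -> Phi F (s *: v) w u = s ^+ kv *: Phi F v w u.
  by move=> s0; have [] := scale s v w u s0.
have scalew (s : K) v w u : s != 0 -> Phi F v (s *: w) u = s ^+ kw *: Phi F v w u.
  by move=> s0; have [] := scale s v w u s0.
have scaleu (s : K) v w u : s != 0 -> Phi F v w (s *: u) = s ^+ ku *: Phi F v w u.
  by move=> s0; have [] := scale s v w u s0.
have wd := Psi_wedge hA e0f0 e0f1 e1f0 e1f1 e0e1 seg Phi_nz scalev scalew scaleu.
pose T := ('cV[K]_m * 'cV[K]_m)%type.
pose rep b : T := xget (0, 0) [set x : T | [/\ nonker A x.1, a x.1 x.2 = 0 & b = wedge x.1 x.2]].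
pose G b := Psi A (Phi F) (rep b).1 (rep b).2.
have GE v q : nonker A v -> a v q = 0 -> wedge v q != 0 ->
    G (wedge v q) = Psi A (Phi F) v q.
  move=> nv vq vq0; rewrite /G /rep; case: xgetP => [[x y] _ /= [nx xy e]|/(_ (v, q))[]//].
  by apply: wd => //; rewrite -e.
have GP b : cone A b -> b != 0 -> G b != 0 /\ fl b = <[G b]>%VS.
  move=> cb b0; have [v [q [nv vq eb]]] := cone_nonker cb b0.
  have psib : psi A v q (dual A v) = b by rewrite psi1 // dualP // scale1r eb.
  have -> : G b = Phi F v q (dual A v) by rewrite eb GE // -eb.
  by rewrite -psib; apply: PhiP; rewrite psib.
have GZ x b : x != 0 -> cone A b -> b != 0 -> G (x *: b) = x ^+ kw *: G b.
  move=> x0 cb b0; have [v [q [nv vq eb]]] := cone_nonker cb b0.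
  rewrite eb -wedgeZr !GE -?eb // ?wedgeZr ?aformZr ?vq ?mulr0 -?eb ?scaler_eq0 ?negb_or ?x0 //.
  exact: scalew.
exists kw, G; split=> // g gP gC i.
apply: pfun1_local => s0.
have [cb0 b0] := gC s0; have [v0 [q0 [nv0 vq0 eb0]]] := cone_nonker cb0 b0.
have wb0 : wedge v0 q0 != 0 by rewrite -eb0.
(* Contraction with [t1] and [t2] takes [g s0] back to [v0] and [q0], and [g s] to polynomial curves
   [v, w] with [v /\ w = de g], where [de] is 1 at [s0]. *)
have [t1 [vt1 qt1]] := wedge_dual 0 1 wb0.
have [t2 [vt2 qt2]] := wedge_dual (-1) 0 wb0.
have [u vu] := nv0.
pose v s := ctr (g s) t1; pose w s := ctr (g s) t2.
have vs0 : v s0 = v0 by rewrite /v eb0 ctr_wedge vt1 qt1 scale0r scale1r subr0.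
have ws0 : w s0 = q0 by rewrite /w eb0 ctr_wedge vt2 qt2 scale0r scaleN1r opprK add0r.
have ctrP t j : pfun1 (fun s => ctr (g s) t j 0).
  apply: (pvec1_lin (L := fun b => ctr b t j 0)) gP => [x y|c x].
    by rewrite ctrD mxE.
  by rewrite ctrZ mxE.
pose al s := a (v s) u; pose de s := dot t1 (w s).
have alP : pfun1 al.
  apply: (pvec1_lin (L := fun b => a (ctr b t1) u)) gP => [x y|c x].
    by rewrite ctrD aformDl.
  by rewrite ctrZ aformZl.
have deP : pfun1 de.
  apply: (pvec1_lin (L := fun b => dot t1 (ctr b t2))) gP => [x y|c x].
    by rewrite ctrD dotDr.
  by rewrite ctrZ dotZr.
have als0 : al s0 = 1 by rewrite /al vs0.
have des0 : de s0 = 1 by rewrite /de ws0 dotC.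
have vw s : wedge (v s) (w s) = de s *: g s /\ a (v s) (w s) = 0.
  have [[x [y [e xy]]] _] := gC s.
  rewrite /v /w /de /w e !ctr_wedge -!scaleNr; split; last exact: aform_lin2.
  by rewrite wedge_lin2 dotDr !dotZr; congr (_ *: _); rewrite !(dotC t1); ring.
(* Clearing denominators needs only the exponents [ku] and [kw]; one more makes both sides vanish
   where [al] or [de] does, even if [ku] or [kw] is 0. *)
exists (fun s => al s ^+ ku.+1 * de s ^+ kw.+1); split.
- exact: pfun1M (pfun1X _ alP) (pfun1X _ deP).
- by rewrite als0 des0 !expr1n mulr1 oner_neq0.
- have PhiP1 := @Phi_curve _ _ F v w (fun=> u) (ctrP t1) (ctrP t2) _ i.
  apply: (@pfun1_ext _ (fun s => al s * de s *
      coord (vbasis {:V}) i (Phi F (v s) (w s) u))); last first.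
    apply: pfun1M; first exact: pfun1M.
    by apply: PhiP1 => j; exact: pfun1_const.
  move=> s; have [e1' e2'] := vw s.
  have [al0|al0] := eqVneq (al s) 0; first by rewrite al0 expr0n !mul0r.
  have [de0|de0] := eqVneq (de s) 0; first by rewrite de0 expr0n !(mulr0, mul0r).
  have [cg g0] := gC s.
  have E : Phi F (v s) (w s) u = al s ^+ ku * de s ^+ kw *: G (g s).
    have wn : wedge (v s) (w s) != 0 by rewrite e1' scaler_eq0 negb_or de0.
    have nv : a (v s) ((al s)^-1 *: u) = 1 by rewrite aformZr mulVf.
    rewrite -scalerA -GZ // -e1' GE //; last by exists ((al s)^-1 *: u).
    rewrite -(Psi_dual seg nv) // -scaleu // scalerA mulfV // scale1r //.
  by rewrite E linearZ /= !exprS; ring.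
Qed.

End ConeMap.

(** * Automorphisms of the cone are linear on pencils *)

(** [g] and [h] are one section of O(1) on the projective line in its two affine charts, so both
    have degree at most 1. *)
Lemma pfun1_reciprocal (K : numClosedFieldType) (g h : K -> K) : pfun1 g -> pfun1 h ->
  (forall s, s != 0 -> h s = s * g s^-1) -> forall s, g s = g 0 + s * h 0.
Proof.
move=> [p ep] [q eq_] hg s.
have psum x : x != 0 -> q.[x] = \sum_(i < size p) p`_i * (x * x ^- i).
  move=> x0; rewrite -eq_ hg // ep horner_coef mulr_sumr.
  by apply: eq_bigr => i _; rewrite exprVn mulrCA.
have sp : (size p <= 2)%N.
  rewrite leqNgt; apply/negP => sp.
  set d := (size p).-2; have ed : size p = d.+2 by rewrite /d -subn2 -addn2 subnK // ltnW.
  have d0 : (0 < d)%N by rewrite -ltnS -ltnS -ed.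
  (* If [p] had degree [d + 1 >= 2], this identity at 0 would equate 0 with the leading coefficient
     of [p]. *)
  have E : (fun x => x ^+ d * q.[x]) =1 (fun x => \sum_(i < size p) p`_i * x ^+ (d.+1 - i)).
    apply: (@pfun1_cancel _ id); rewrite ?ed.
    - exact: pfun1_id.
    - exact: pfun1M (pfun1X _ (pfun1_id _)) (ex_intro _ q (fun=> erefl)).
    - apply: pfun1_sum => i; exact: pfun1M (pfun1_const _) (pfun1X _ (pfun1_id _)).
    - by exists 1; rewrite oner_neq0.
    - move=> x x0; rewrite psum // mulr_sumr ed; apply: eq_bigr => i _.
      rewrite mulrCA; congr (_ * _); rewrite mulrA -exprSr.
      by apply: (mulIf (expf_neq0 i x0)); rewrite mulfVK ?expf_neq0 // -exprD subnK // -ltnS.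
  have := E 0; rewrite expr0n (gtn_eqF d0) mul0r ed big_ord_recr /= subnn expr0 mulr1.
  rewrite big1 => [|i _]; last by rewrite expr0n subn_eq0 leqNgt ltn_ord mulr0.
  rewrite add0r => /esym/eqP; have := lead_coef_eq0 p; rewrite lead_coefE ed /= => ->.
  by move=> /eqP p0; move: sp; rewrite p0 size_poly0.
have pE x : p.[x] = p`_0 + p`_1 * x.
  by rewrite (horner_coef_wide _ sp) !big_ord_recl big_ord0 addr0 expr0 expr1 mulr1.
have qE : (fun x => q.[x]) =1 (fun x => p`_0 * x + p`_1).
  apply: (@pfun1_cancel _ id).
  - exact: pfun1_id.
  - by exists q.
  - apply: pfun1D (pfun1_const _); exact: pfun1M (pfun1_const _) (pfun1_id _).
  - by exists 1; rewrite oner_neq0.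
  - by move=> x x0; rewrite -eq_ hg // ep pE; field.
by rewrite !ep !eq_ qE !pE; ring.
Qed.

Section ConeAutomorphism.
Variables (K : numClosedFieldType) (m : nat) (A : 'M[K]_m).
Hypothesis hA : A^T = - A.
Implicit Types (v w u p q : 'cV[K]_m) (b : ext2 K m).
Local Notation a := (aform A).
Local Notation V := (ext2 K m).
Local Notation cone := (cone A).

Variables (G H : V -> V) (k l : nat).
Hypothesis G_nz : forall b, cone b -> b != 0 -> G b != 0.
Hypothesis H_nz : forall b, cone b -> b != 0 -> H b != 0.
Hypothesis H_cone : forall b, cone b -> b != 0 -> cone (H b).
Hypothesis G_homog : forall x b, x != 0 -> cone b -> b != 0 -> G (x *: b) = x ^+ k *: G b.
Hypothesis H_homog : forall x b, x != 0 -> cone b -> b != 0 -> H (x *: b) = x ^+ l *: H b.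
Hypothesis G_curve : forall g, pvec1 g -> (forall s, cone (g s) /\ g s != 0) ->
  pvec1 (fun s => G (g s)).
Hypothesis H_curve : forall g, pvec1 g -> (forall s, cone (g s) /\ g s != 0) ->
  pvec1 (fun s => H (g s)).
Hypothesis GH : forall b, cone b -> b != 0 -> exists x, G (H b) = x *: b.

Definition pencil b b' := (forall s t, cone (s *: b + t *: b')) /\
  (forall s t, s *: b + t *: b' = 0 -> s = 0 /\ t = 0).

Lemma pencilC b b' : pencil b b' -> pencil b' b.
Proof.
move=> [h1 h2]; split=> s t; rewrite addrC //.
by move=> /h2[].
Qed.

Lemma pencil_curve b b' : pencil b b' -> pvec1 (fun s => b + s *: b') /\
  forall s, cone (b + s *: b') /\ b + s *: b' != 0.
Proof.
move=> [h1 h2]; split.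
  by apply: pvec1D (pvec1_const _) _; apply: pvec1Z (pfun1_id _) (pvec1_const _).
move=> s; rewrite -[b]scale1r; split=> //; apply/eqP => /h2[/eqP].
by rewrite oner_eq0.
Qed.

(** The scalar by which [G] after [H] acts is a coordinate of a polynomial curve, so polynomial in
    [s]; it has no zeros, hence is constant. *)
Lemma GH_pencil b b' : pencil b b' ->
  exists2 x, x != 0 & forall s, G (H (b + s *: b')) = x *: (b + s *: b').
Proof.
move=> bb'; have [gP gC] := pencil_curve bb'.
have [x xE] := choice (fun s => GH (gC s).1 (gC s).2).
have HP := H_curve gP gC.
have HC s : cone (H (b + s *: b')) /\ H (b + s *: b') != 0.
  by have [c1 c2] := gC s; split; [exact: H_cone | exact: H_nz].
have GP := G_curve HP HC.
have x0 s : x s != 0.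
  have [c1 c2] := HC s; apply: contraNneq (G_nz c1 c2) => xs.
  by rewrite xE xs scale0r.
exists (x 0) => // s; rewrite xE; congr (_ *: _).
have fr : free [:: b; b'].
  apply/freeP => y; rewrite !big_ord_recl big_ord0 addr0 /= => e i.
  have [y0 y1] := bb'.2 _ _ e.
  case: i => [[|[|]]] // pf; [move: y0 | move: y1]; congr (y _ = _); exact: val_inj.
pose L (z : V) : K := coord (in_tuple [:: b; b']) 0 z.
apply: pfun1_nz_const x0 s.
apply: (@pfun1_ext _ (fun s => L (G (H (b + s *: b'))))) => [s|].
  rewrite xE /L linearZ linearD linearZ /=.
  have -> : coord (in_tuple [:: b; b']) 0 b = 1.
    exact: (coord_free (X := in_tuple [:: b; b']) 0 0 fr).
  have -> : coord (in_tuple [:: b; b']) 0 b' = 0.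
    exact: (coord_free (X := in_tuple [:: b; b']) (lift ord0 0) 0 fr).
  by rewrite mulr0 addr0 mulr1.
by apply: pvec1_lin GP => [y z|c y]; rewrite /L ?linearD ?linearZ.
Qed.

(** Comparing the scalars [x] and [y] of the two charts gives [s^(lk) x = s y]; then [s = 1] yields
    [x = y], and [s = 2] yields [l k = 1]. *)
Lemma degree_one b b' : pencil b b' -> k = 1%N.
Proof.
move=> bb'; have [x x0 xE] := GH_pencil bb'; have [y y0 yE] := GH_pencil (pencilC bb').
have two : (2 : K) != 0 by rewrite pnatr_eq0.
have [_ gC] := pencil_curve bb'.
have E s : s != 0 -> s ^+ (l * k) * x = s * y.
  move=> s0; have [c1 c2] := gC s^-1.
  have e : b' + s *: b = s *: (b + s^-1 *: b').
    by rewrite scalerDr scalerA mulfV // scale1r addrC.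
  have := yE s; rewrite e H_homog // G_homog ?expf_neq0 //; last first.
  - exact: H_nz.
  - exact: H_cone.
  rewrite xE !scalerA -exprM => /eqP; rewrite -subr_eq0 -scalerBl scaler_eq0 (negPf c2) orbF.
  by rewrite subr_eq0 => /eqP ->; rewrite mulrC.
have xy : x = y by have := E 1 (oner_neq0 _); rewrite expr1n !mul1r.
have := E 2 two; rewrite xy => /(mulIf y0)/eqP; rewrite -[X in _ == X]expr1.
rewrite -!natrX eqr_nat => /eqP/(congr1 (logn 2)); rewrite !pfactorK // => /eqP.
by rewrite muln_eq1 => /andP[_ /eqP].
Qed.

(** In degree 1, each coordinate of [G] in the two charts of the pencil satisfies
    [pfun1_reciprocal]. *)
Lemma pencil_linear b b' : pencil b b' -> forall s, G (b + s *: b') = G b + s *: G b'.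
Proof.
move=> bb' s; have k1 := degree_one bb'.
have [gP gC] := pencil_curve bb'; have [gP' gC'] := pencil_curve (pencilC bb').
have GP := G_curve gP gC; have GP' := G_curve gP' gC'.
rewrite (coord_vbasis (memvf (G (b + s *: b')))) (coord_vbasis (memvf (G b + s *: G b'))).
apply: eq_bigr => i _; congr (_ *: _).
have := @pfun1_reciprocal _ _ _ (GP i) (GP' i) _ s; rewrite !scale0r !addr0 linearD linearZ.
apply=> t t0; have [c1 c2] := gC t^-1.
have -> : b' + t *: b = t *: (b + t^-1 *: b').
  by rewrite scalerDr scalerA mulfV // scale1r addrC.
by rewrite G_homog // k1 expr1 linearZ.
Qed.

End ConeAutomorphism.

(** * Linear spaces of decomposable bivectors *)

Section ExteriorMap.
Variables (K : fieldType).

Lemma ext2_map_subproof m d (R : 'M[K]_(d, m)) (b : ext2 K m) :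
  R *m vsval b *m R^T \in antisym K d.
Proof.
apply/antisymP; rewrite !trmx_mul trmxK mulmxA.
have /antisymP -> := valP b.
by rewrite mulmxN mulNmx.
Qed.

(** The exterior square of [R]. *)
Definition ext2_map m d (R : 'M[K]_(d, m)) (b : ext2 K m) : ext2 K d :=
  Subvs (ext2_map_subproof R b).

Lemma ext2_map_wedge m d (R : 'M[K]_(d, m)) p q :
  ext2_map R (wedge p q) = wedge (R *m p) (R *m q).
Proof. by apply: val_inj; rewrite /= mulmxBr mulmxBl !trmx_mul !mulmxA. Qed.

Lemma ext2_mapD m d (R : 'M[K]_(d, m)) b b' :
  ext2_map R (b + b') = ext2_map R b + ext2_map R b'.
Proof. by apply: val_inj; rewrite /= mulmxDr mulmxDl. Qed.

Lemma ext2_mapZ m d (R : 'M[K]_(d, m)) x b : ext2_map R (x *: b) = x *: ext2_map R b.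
Proof. by apply: val_inj; rewrite /= -scalemxAr -scalemxAl. Qed.

Lemma ext2_map0 m d (R : 'M[K]_(d, m)) : ext2_map R 0 = 0.
Proof. by rewrite -(scale0r (0 : ext2 K m)) ext2_mapZ scale0r. Qed.

Lemma ext2_map1 m (b : ext2 K m) : ext2_map 1%:M b = b.
Proof. by apply: val_inj; rewrite /= mul1mx trmx1 mulmx1. Qed.

Lemma ext2_map_comp m d e (R : 'M[K]_(d, m)) (S : 'M[K]_(e, d)) b :
  ext2_map S (ext2_map R b) = ext2_map (S *m R) b.
Proof. by apply: val_inj; rewrite /= trmx_mul !mulmxA. Qed.

Lemma ext2_map_scalar m d (R : 'M[K]_(d, m)) x b :
  ext2_map (x *: R) b = x ^+ 2 *: ext2_map R b.
Proof.
apply: val_inj; rewrite /= [(x *: R)^T]linearZ /= -!scalemxAl -scalemxAr scalerA.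
by rewrite expr2.
Qed.

End ExteriorMap.

Section Stars.
Variables (K : fieldType) (m : nat).
Implicit Types (p q r s v w : 'cV[K]_m) (b : ext2 K m).

Definition decomposable b := exists v w, b = wedge v w.

(** For nonzero bivectors, the lines through the point [p]. *)
Definition in_star p b := exists y, b = wedge p y.

Lemma in_starZ p x b : in_star p b -> in_star p (x *: b).
Proof. by move=> [y ->]; exists (x *: y); rewrite wedgeZr. Qed.

Lemma in_star_scale p x b : x != 0 -> in_star (x *: p) b -> in_star p b.
Proof. by move=> x0 [y ->]; exists (x *: y); rewrite wedgeZl wedgeZr. Qed.

Lemma in_star_lin2 p q (x y : K) : (x, y) != (0, 0) -> in_star (x *: p + y *: q) (wedge p q).
Proof.
rewrite xpair_eqE negb_and; have [->|x0 _] := eqVneq x 0; last first.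
  by exists (x^-1 *: q); rewrite wedgeDl !wedgeZr !wedgeZl wedgevv !scaler0 addr0 scalerA
    mulVf // scale1r.
move=> /= y0; exists (- y^-1 *: p); rewrite scale0r add0r wedgeZl wedgeZr scalerA mulrN.
by rewrite mulfV // scaleN1r -wedgeC.
Qed.

(* The matrix of a sum of two disjoint planes has rank 4, that of a bivector rank 2. *)
Lemma decomposable_sum_meet p q r s : wedge p q != 0 -> wedge r s != 0 ->
  decomposable (wedge p q + wedge r s) ->
  exists x y : K, [/\ x *: p + y *: q != 0, in_star (x *: p + y *: q) (wedge p q) &
     in_star (x *: p + y *: q) (wedge r s)].
Proof.
move=> pq rs [t [u e]].
pose M : 'M[K]_(1 + 1 + (1 + 1), m) := col_mx (col_mx p^T q^T) (col_mx r^T s^T).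
have [fM|nfM] := boolP (row_free M).
  pose O2 : 'M[K]_(1 + 1) := block_mx 0 1 (- 1) 0.
  pose O : 'M[K]_(1 + 1 + (1 + 1)) := block_mx O2 0 0 O2.
  have eO : vsval (wedge p q + wedge r s) = M^T *m O *m M.
    rewrite /= /M /O !tr_col_mx !trmxK mul_row_block !mulmx0 addr0 add0r.
    rewrite mul_row_col /O2 !mul_row_block !mulmx0 add0r addr0 !mulmx1 !mulmxN !mulmx1.
    rewrite !mul_row_col !mulNmx.
    by rewrite sub0r addr0 mulNmx; congr (_ + _); rewrite addrC.
  have uO2 : O2 *m (- O2) = 1%:M.
    rewrite /O2 mulmxN mulmx_block !(mul0mx, mulmx0, addr0, add0r, mul1mx, mulNmx, mulmx1).
    by rewrite opp_block_mx !oppr0 !opprK -scalar_mx_block.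
  have uO : O *m (- O) = 1%:M.
    rewrite mulmxN /O mulmx_block !(mul0mx, mulmx0, addr0, add0r).
    by rewrite opp_block_mx !oppr0 -mulmxN uO2 -scalar_mx_block.
  have rk4 : \rank (M^T *m O *m M) = 4%N.
    rewrite mxrankMfree // -mxrank_tr trmx_mul trmxK mxrankMfree // mxrank_tr.
    by apply: mxrank_unit; have [] := mulmx1_unit uO.
  have : (\rank (vsval (wedge t u)) <= 2)%N.
    rewrite /= (leq_trans (mxrank_add _ _)) // mxrank_opp.
    have le1 (y z : 'cV[K]_m) : (\rank (y *m z^T) <= 1)%N.
      exact: leq_trans (mxrankM_maxl _ _) (rank_leq_col _).
    by rewrite -[2%N]/(1 + 1)%N leq_add.
  by rewrite -e eO rk4.
(* In a linear relation between the four vectors, the part on [p, q] is opposite to the part on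
   [r, s]; this is the common vector, nonzero because each pair is independent. *)
have [z z0 zM] : exists2 z : 'rV_(1 + 1 + (1 + 1)), z != 0 & z *m M = 0.
  move: nfM; rewrite -kermx_eq0 => /rowV0Pn[z /sub_kermxP zM z0]; by exists z.
pose z1 := lsubmx z; pose z2 := rsubmx z.
pose x := lsubmx z1 0 0; pose y := rsubmx z1 0 0.
pose x' := lsubmx z2 0 0; pose y' := rsubmx z2 0 0.
have ez1 : z1 = row_mx x%:M y%:M by rewrite -[LHS]hsubmxK -!mx11_scalar.
have ez2 : z2 = row_mx x'%:M y'%:M by rewrite -[LHS]hsubmxK -!mx11_scalar.
have ez : z = row_mx z1 z2 by rewrite hsubmxK.
have E : x *: p + y *: q = - x' *: r + - y' *: s.
  have := congr1 trmx zM; rewrite ez ez1 ez2 /M !mul_row_col !mul_scalar_mx.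
  rewrite !linearD /= !linearZ /= !trmxK trmx0 => /eqP; rewrite addr_eq0 => /eqP ->.
  by rewrite opprD !scaleNr.
have n0 : x *: p + y *: q != 0.
  apply: contraNneq z0 => e0.
  have := congr1 (wedge p) e0; have := congr1 (fun z => wedge z q) e0.
  rewrite wedgeDl wedgeDr !wedgeZl !wedgeZr !wedgevv !scaler0 addr0 add0r wedge0l wedge0r.
  move=> /eqP; rewrite scaler_eq0 (negPf pq) orbF => /eqP x0.
  move=> /eqP; rewrite scaler_eq0 (negPf pq) orbF => /eqP y0.
  move: e0; rewrite E => e0.
  have := congr1 (wedge r) e0; have := congr1 (fun z => wedge z s) e0.
  rewrite wedgeDl wedgeDr !wedgeZl !wedgeZr !wedgevv !scaler0 addr0 add0r wedge0l wedge0r.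
  move=> /eqP; rewrite scaler_eq0 (negPf rs) orbF oppr_eq0 => /eqP x'0.
  move=> /eqP; rewrite scaler_eq0 (negPf rs) orbF oppr_eq0 => /eqP y'0.
  by rewrite ez ez1 ez2 x0 y0 x'0 y'0 !raddf0 !row_mx0.
exists x, y; split=> //.
  apply: in_star_lin2; apply: contraNneq n0 => -[-> ->].
  by rewrite !scale0r addr0.
rewrite E; apply: in_star_lin2; apply: contraNneq n0 => -[x0 y0].
by rewrite E x0 y0 !scale0r addr0.
Qed.

Lemma in_star2 p q b : b != 0 -> wedge p q != 0 -> in_star p b -> in_star q b ->
  exists2 x, x != 0 & b = x *: wedge p q.
Proof.
move=> b0 pq [y ey] [y' ey'].
have [x1 [x2 [x3 [x4 [eq_ _ _]]]]] : exists x1 x2 x3 x4 : K,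
  [/\ q = x1 *: p + x2 *: y, y' = x3 *: p + x4 *: y & x1 * x4 - x2 * x3 = 1].
  by apply: wedge_span; rewrite -ey.
have e : wedge p q = x2 *: b by rewrite eq_ wedgeDr !wedgeZr wedgevv scaler0 add0r ey.
have x20 : x2 != 0 by apply: contraNneq pq => x0; rewrite e x0 scale0r.
by exists x2^-1; rewrite ?invr_eq0 // e scalerA mulVf // scale1r.
Qed.

Lemma in_star_span p q r : wedge p q != 0 -> in_star r (wedge p q) ->
  exists x y : K, r = x *: p + y *: q.
Proof.
move=> pq [y ey]; have [x1 [x2 [_ [_ [e _ _]]]]] := wedge_span ey pq.
by exists x1, x2.
Qed.

Lemma meet_outside p q b : wedge p q != 0 -> b != 0 -> decomposable b ->
  decomposable (wedge p q + b) -> in_star p b \/ exists x : K, in_star (q + x *: p) b.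
Proof.
move=> pq b0 [r [s eb]] dec; rewrite eb in b0 dec *.
have [x [y [n0 s1 s2]]] := decomposable_sum_meet pq b0 dec.
have [y0|y0] := eqVneq y 0; [left|right].
  apply: (@in_star_scale _ x); last by move: s2; rewrite y0 scale0r addr0.
  by apply: contraNneq n0 => ->; rewrite y0 !scale0r addr0.
exists (y^-1 * x); apply: (@in_star_scale _ y) => //.
by rewrite scalerDr scalerA mulrA mulfV // mul1r addrC.
Qed.

End Stars.

Section CommonVector.
Variables (K : fieldType) (m d : nat) (L : 'cV[K]_d -> ext2 K m).
Implicit Types (p q r s t v w : 'cV[K]_m) (b : ext2 K m) (x y : 'cV[K]_d).
Hypothesis LD : forall x y, L (x + y) = L x + L y.
Hypothesis LZ : forall (c : K) x, L (c *: x) = c *: L x.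
Hypothesis L_inj : forall x, L x = 0 -> x = 0.

Lemma L0 : L 0 = 0.
Proof. by rewrite -(scale0r (0 : 'cV_d)) LZ scale0r. Qed.

Lemma Lsum (I : finType) (y : I -> K) (x : I -> 'cV[K]_d) :
  L (\sum_i y i *: x i) = \sum_i y i *: L (x i).
Proof. by rewrite (big_morph L LD L0); apply: eq_bigr => i _; rewrite LZ. Qed.

Lemma cV_sum_delta x : x = \sum_i x i 0 *: delta_mx i 0.
Proof.
rewrite {1}(matrix_sum_delta x); apply: eq_bigr => i _.
by rewrite big_ord1.
Qed.

Hypothesis L_dec : forall x, decomposable (L x).
Hypothesis d4 : (4 <= d)%N.

(** Two images meet in some [p], as [p /\ q] and [p /\ r]. An image not through [p] meets both
    planes away from [p], so it is a bivector of the span of [p, q, r]. A fourth independent image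
    escapes that span and excludes this case. *)
Lemma common_vector : exists2 p, p != 0 & forall x, in_star p (L x).
Proof.
pose e (k : 'I_4) : 'cV[K]_d := delta_mx (widen_ord d4 k) 0.
have e_free (y : 'I_4 -> K) : \sum_k y k *: e k = 0 -> forall k, y k = 0.
  move=> /matrixP E k; have := E (widen_ord d4 k) 0.
  rewrite summxE (bigD1 k) //= !mxE !eqxx mulr1 big1 ?addr0 // => j jk.
  rewrite !mxE -(inj_eq val_inj) /= (inj_eq val_inj) eq_sym (negPf jk) mulr0 //.
have Le_free : free [tuple L (e k) | k < 4].
  apply/freeP => y; under eq_bigr do rewrite -tnth_nth tnth_mktuple.
  by rewrite -Lsum => /L_inj; exact: e_free.
have e_neq0 k : L (e k) != 0.
  apply/eqP => /L_inj/matrixP/(_ (widen_ord d4 k) 0); rewrite !mxE !eqxx => /eqP.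
  by rewrite oner_eq0.
pose k0 : 'I_4 := ord0; pose k1 : 'I_4 := lift ord0 ord0.
have [p [p0 [q eq_] [r er]]] : exists p, [/\ p != 0, in_star p (L (e k0)) & in_star p (L (e k1))].
  have [v [w e0]] := L_dec (e k0); have [v' [w' e1]] := L_dec (e k1).
  have [|||x [y [n0 s0 s1]]] := @decomposable_sum_meet _ _ v w v' w'.
  - by rewrite -e0.
  - by rewrite -e1.
  - by rewrite -e0 -e1 -LD.
  by exists (x *: v + y *: w); rewrite e0 e1.
have pq : wedge p q != 0 by rewrite -eq_.
have pr : wedge p r != 0 by rewrite -er.
have indep_qr (s x y : K) : s *: (q + x *: p) = r + y *: p -> False.
  move=> E; have := congr1 (wedge p) E.
  rewrite wedgeZr !wedgeDr !wedgeZr wedgevv !scaler0 !addr0 -eq_ -er -LZ => E2.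
  have := e_free (fun k => if k == k0 then s else if k == k1 then - 1 else 0).
  rewrite !big_ord_recl big_ord0 /= !scale0r !addr0 scaleN1r.
  have -> : s *: e ord0 - e (lift ord0 ord0) = 0.
    apply: L_inj; rewrite LD -scaleN1r !LZ scaleN1r -LZ E2; apply/eqP.
    by rewrite subr_eq0.
  by move=> /(_ erefl k1) /= /eqP; rewrite oppr_eq0 oner_eq0.
have zz (x y : K) : wedge (q + x *: p) (r + y *: p) != 0.
  apply/eqP => /wedge_eq0[|s E]; last by apply: (@indep_qr s x y).
  by apply: contraNneq pq => E;
      rewrite -(addrK (x *: p) q) E sub0r -scaleNr wedgeZr wedgevv scaler0.
(* The bivectors of the span of [p, q, r]: at most three dimensions, too few for four independent
   images. *)
pose E := <<[:: wedge p q; wedge p r; wedge q r]>>%VS.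
have Epq : wedge p q \in E by apply: memv_span; rewrite inE eqxx.
have Epr : wedge p r \in E by apply: memv_span; rewrite !inE eqxx orbT.
have Eqr : wedge q r \in E by apply: memv_span; rewrite !inE eqxx !orbT.
have Ez (x y : K) : wedge (q + x *: p) (r + y *: p) \in E.
  rewrite wedgeDl !wedgeDr !wedgeZl !wedgeZr wedgevv !scaler0 addr0 (wedgeC p q).
  by rewrite !rpredD ?memvZ ?rpredN.
have [k kE] : exists k, L (e k) \notin E.
  apply: contrapT => n; have sE : (<<[tuple L (e k) | k < 4]>> <= E)%VS.
    apply/span_subvP => b /tnthP[k ->]; rewrite tnth_mktuple.
    by apply: contrapT => /negP bE; apply: n; exists k.
  have := dimvS sE; move: Le_free; rewrite /free size_tuple => /eqP ->.
  by rewrite leqNgt ltnS (dim_span [:: wedge p q; wedge p r; wedge q r]).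
have out b : b != 0 -> decomposable b -> (exists x, b = L x) -> ~ in_star p b ->
    exists x y s : K, [/\ s != 0, b = s *: wedge (q + x *: p) (r + y *: p),
      in_star (q + x *: p) b & in_star (r + y *: p) b].
  move=> b0 db [x ex] ns.
  have [|/ns//|[a1 s1]] := meet_outside pq b0 db; first by rewrite ex -eq_ -LD.
  have [|np|[a2 s2]] := meet_outside pr b0 db; first by rewrite ex -er -LD.
    by case: ns.
  have [s s0 eb] := in_star2 b0 (zz a1 a2) s1 s2.
  by exists a1, a2, s.
have [t et] : in_star p (L (e k)).
  apply: contrapT => ns.
  have [|x [y [s [_ eb _ _]]]] := out (L (e k)) (e_neq0 k) (L_dec _) _ ns; first by exists (e k).
  by move: kE; rewrite eb memvZ.
exists p => // x; have [->|b0] := eqVneq (L x) 0; first by exists 0; rewrite wedge0r.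
apply: contrapT => ns.
have [|a1 [a2 [s [s0 eb _ _]]]] := out (L x) b0 (L_dec _) _ ns; first by exists x.
(* A bad [L x] also meets the plane of [p] and [t] away from [p], which puts [t] in the span of
   [p, q, r], against the choice of [k]. *)
have [||||/ns//|[a3 s3]] := @meet_outside _ _ p t (L x).
- by rewrite -et.
- exact: b0.
- exact: L_dec.
- by rewrite -et -LD.
have [|u1 [u2 eu]] := @in_star_span _ _ (q + a1 *: p) (r + a2 *: p) (t + a3 *: p) (zz _ _).
  have -> : wedge (q + a1 *: p) (r + a2 *: p) = s^-1 *: L x.
    by rewrite eb scalerA mulVf // scale1r.
  exact: in_starZ.
case/negP: kE; rewrite et.
have -> : wedge p t = u1 *: wedge p q + u2 *: wedge p r.
  have := congr1 (wedge p) eu.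
  by rewrite !wedgeDr !wedgeZr !wedgeDr !wedgeZr !wedgevv !scaler0 !addr0.
by rewrite rpredD ?memvZ.
Qed.

End CommonVector.

(** * Recovering the matrix *)

Lemma injective_unitmx (K : fieldType) n (T : 'M[K]_n) :
  (forall x : 'cV_n, T *m x = 0 -> x = 0) -> T \in unitmx.
Proof.
move=> Ti; rewrite -unitmx_tr -row_free_unit -kermx_eq0; apply/rowV0P => v.
move=> /sub_kermxP e; apply: trmx_inj; rewrite trmx0; apply: Ti.
by rewrite -[T]trmxK -trmx_mul e trmx0.
Qed.

Section SymplecticSpace.
Variables (K : numClosedFieldType) (d : nat) (J : 'M[K]_d).
Hypotheses (hJ : J^T = - J) (uJ : J \in unitmx).
Implicit Types x y z : 'cV[K]_d.
Local Notation j := (aform J).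

Lemma nondegenerate x : (forall y, j x y = 0) -> x = 0.
Proof.
move=> xj; have : x^T *m J = 0.
  apply/matrixP => i k; have := xj (delta_mx k 0).
  by rewrite /aform -colE mxE (ord1 i) => ->; rewrite mxE.
move=> /(congr1 (mulmx^~ (invmx J))); rewrite mulmxK // mul0mx => /(congr1 trmx).
by rewrite trmxK trmx0.
Qed.

Lemma exists_dual x : x != 0 -> exists y, j x y = 1.
Proof.
by move=> x0; have [//|/nondegenerate e] := nonkerP J x; rewrite e eqxx in x0.
Qed.

Lemma common_perp x y : (2 < d)%N -> exists z, [/\ z != 0, j x z = 0 & j y z = 0].
Proof.
move=> d2; pose B := row_mx (J^T *m x) (J^T *m y).
have nz : kermx B != 0.
  rewrite kermx_eq0; apply/negP => /eqP rB.
  have := rank_leq_col B; rewrite rB leqNgt => /negP; apply; exact: d2.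
have /rowV0Pn[v /sub_kermxP vB v0] := nz.
have jE w : w^T *m J *m v^T = (v *m (J^T *m w))^T by rewrite !trmx_mul !trmxK.
have [vx vy] : v *m (J^T *m x) = 0 /\ v *m (J^T *m y) = 0.
  by move: vB; rewrite mul_mx_row -[0]row_mx0 => /eq_row_mx[].
exists v^T; split.
- by rewrite -trmx0 (inj_eq trmx_inj).
- by rewrite /aform jE vx !mxE.
- by rewrite /aform jE vy !mxE.
Qed.

Hypothesis d4 : (4 <= d)%N.

(** Any two nonzero vectors are linked by isotropic planes through a third one; this connectedness
    is what makes the local coefficients of [G] global constants. *)
Lemma common_perp_indep x y : x != 0 -> y != 0 ->
  exists z, [/\ j x z = 0, j y z = 0, wedge x z != 0 & wedge y z != 0].
Proof.
move=> x0 y0; have d2 : (2 < d)%N by apply: leq_trans d4.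
have ind u w z : z != 0 -> j u z = 0 -> j w z = 0 -> j u w != 0 -> wedge u z != 0 /\ wedge w z != 0.
  move=> z0 uz wz uw.
  have w0 : w != 0 by apply: contraNneq uw => ->; rewrite aform0r.
  have u0 : u != 0 by apply: contraNneq uw => ->; rewrite aform0l.
  split; apply/eqP.
    move=> /(wedge_eq0 u0)[s es]; move: wz z0; rewrite es aformZr (aformC hJ) mulrN.
    move/eqP; rewrite oppr_eq0 mulf_eq0 (negPf uw) orbF => /eqP ->.
    by rewrite scale0r eqxx.
  move=> /(wedge_eq0 w0)[s es]; move: uz z0; rewrite es aformZr.
  move/eqP; rewrite mulf_eq0 (negPf uw) orbF => /eqP ->.
  by rewrite scale0r eqxx.
have [xy|xy] := eqVneq (j x y) 0; last first.
  by have [z [z0 xz yz]] := common_perp x y d2; exists z; have [] := ind x y z.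
have [xy0|xy0] := eqVneq (wedge x y) 0; last first.
  exists (x + y); rewrite !aformDr !(aformvv hJ) (aformC hJ x) xy oppr0 !addr0; split=> //.
    by rewrite wedgeDr wedgevv add0r.
  by rewrite wedgeDr wedgevv addr0 wedgeC oppr_eq0.
have [s es] := wedge_eq0 x0 xy0.
have s0 : s != 0 by apply: contraNneq y0 => e; rewrite es e scale0r.
have [x' xx'] := exists_dual x0.
have [z [z0 xz x'z]] := common_perp x x' d2.
have [xz0 _] := ind x x' z z0 xz x'z (eq_ind_r (fun t => t != 0) (oner_neq0 _) xx').
exists z; split=> //; rewrite es ?aformZl ?xz ?mulr0 // wedgeZl scaler_eq0 negb_or.
by rewrite s0.
Qed.

Lemma common_perp_indep3 x y : wedge x y != 0 -> exists z,
  [/\ j z x = 0, j z y = 0, wedge z x != 0, wedge z y != 0 & wedge z (x + y) != 0].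
Proof.
move=> xy0; have d2 : (2 < d)%N by apply: leq_trans d4.
have [xy|xy] := eqVneq (j x y) 0.
  (* Any [x + k y] with [k] different from 0 and 1 would do. *)
  exists (x + 2 *: y); have yx : wedge y x = - wedge x y by rewrite wedgeC.
  have two : (2 : K) != 0 by rewrite pnatr_eq0.
  have three : (1 - 2 : K) != 0 by rewrite -oppr_eq0 opprB [2]mulr2n addrK oner_neq0.
  split; rewrite ?aformDl ?aformZl ?(aformvv hJ) ?(aformC hJ x) ?xy ?oppr0 ?mulr0 ?addr0 //.
  - by rewrite wedgeDl wedgeZl wedgevv add0r yx scaler_eq0 negb_or two oppr_eq0.
  - by rewrite wedgeDl wedgeZl wedgevv scaler0 addr0.
  - rewrite wedgeDr !wedgeDl !wedgeZl !wedgevv scaler0 add0r addr0 yx scalerN addrC.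
    by rewrite -{1}(scale1r (wedge x y)) -scalerBl scaler_eq0 negb_or three.
have [z [z0 xz yz]] := common_perp x y d2.
exists z; split; rewrite ?(aformC hJ x) ?(aformC hJ y) ?xz ?yz ?oppr0 //; apply/eqP.
- move=> /(wedge_eq0 z0)[s es]; move: xy; rewrite es aformZl (aformC hJ y) yz.
  by rewrite oppr0 mulr0 eqxx.
- by move=> /(wedge_eq0 z0)[s es]; move: xy; rewrite es aformZr xz mulr0 eqxx.
- move=> /(wedge_eq0 z0)[s es]; move: xy.
  have -> : y = s *: z - x by rewrite -es addrC addKr.
  by rewrite aformDr aformNr aformZr xz (aformvv hJ) subr0 mulr0 eqxx.
Qed.

(** For fixed nonzero [x] the two linear forms are proportional since one vanishes on the kernel of
    the other. The ratios at [x] and [y] agree when [j x y] is nonzero, and any two nonzero vectors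
    have a third one orthogonal to neither. *)
Lemma proportional_forms (j' : 'cV[K]_d -> 'cV[K]_d -> K) :
  (forall x y y', j' x (y + y') = j' x y + j' x y') ->
  (forall (s : K) x y, j' x (s *: y) = s * j' x y) ->
  (forall x y, j' y x = - j' x y) ->
  (forall x y, j x y = 0 -> j' x y = 0) -> exists s, forall x y, j' x y = s * j x y.
Proof.
move=> jD jZ jC jj.
have one x u y : j x u = 1 -> j' x y = j' x u * j x y.
  move=> xu; have -> : y = (y - j x y *: u) + j x y *: u by rewrite subrK.
  rewrite jD jZ jj; last by rewrite !aformE xu mulr1 subrr.
  by rewrite add0r mulrC aformDr aformZr xu mulr1 !aformE xu mulr1 subrr add0r.
have nz : (delta_mx (Ordinal (leq_trans (isT : 0 < 4)%N d4)) 0 : 'cV[K]_d) != 0.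
  apply/eqP => /matrixP/(_ (Ordinal (leq_trans (isT : 0 < 4)%N d4)) 0).
  by rewrite !mxE !eqxx => /eqP; rewrite oner_eq0.
set x0 := delta_mx _ _ in nz.
have [u0 xu0] := exists_dual nz.
have link x u y w : j x u = 1 -> j y w = 1 -> j x y != 0 -> j' x u = j' y w.
  move=> xu yw xy; apply: (mulIf xy); rewrite -one //.
  by rewrite -(opprK (j x y)) -(aformC hJ) mulrN -one // jC.
have all x u : j x u = 1 -> j' x u = j' x0 u0.
  move=> xu; have [z xz x0z] : exists2 z, j x z != 0 & j x0 z != 0.
    have [e|] := eqVneq (j x0 u) 0; last by exists u; rewrite // xu oner_neq0.
    have [e'|] := eqVneq (j x u0) 0; last by exists u0; rewrite // xu0 oner_neq0.
    by exists (u + u0); rewrite !aformDr ?xu ?e' ?addr0 ?e ?add0r ?xu0 oner_neq0.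
  have zx : j z ((- (j x z)^-1) *: x) = 1.
    by rewrite aformZr (aformC hJ x) mulrNN mulVf.
  rewrite (link _ _ _ _ xu zx) //; apply/esym; exact: link xu0 zx x0z.
exists (j' x0 u0) => x y; have [[u xu]|kx] := nonkerP J x.
  by rewrite (one x u) // (all _ _ xu).
by rewrite kx mulr0 jj // kx.
Qed.

(* [h] behaves like [y |-> s x /\ y] on each line of the hyperplane orthogonal to [x]. *)
Lemma perp_eigen (V : vectType K) (w : 'cV[K]_d -> V) (h : 'cV[K]_d -> V) (be : 'cV[K]_d -> K) x :
  (forall y z, w (y + z) = w y + w z) -> (forall (s : K) y, w (s *: y) = s *: w y) ->
  (forall y z, j x y = 0 -> j x z = 0 -> h (y + z) = h y + h z) ->
  (forall (s : K) y, j x y = 0 -> h (s *: y) = s *: h y) ->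
  h x = 0 -> (forall y, w y = 0 -> exists s, y = s *: x) ->
  (forall y, j x y = 0 -> h y = be y *: w y) ->
  forall y z, j x y = 0 -> j x z = 0 -> w y != 0 -> w z != 0 -> be y = be z.
Proof.
move=> wD wZ hD hZ hx wK hw y z xy xz wy wz.
(* If [w z] is a multiple of [w y], then [z] is [s y] up to a multiple of [x], which [h] kills;
   otherwise the coefficients are compared on [y + z]. *)
have [[s es]|ind] := pselect (exists s, w z = s *: w y).
  have [r er] : exists r, z - s *: y = r *: x.
    apply: wK; rewrite -scaleN1r wD !wZ es scaleN1r subrr //.
  have ez : z = s *: y + r *: x by rewrite -er addrC subrK.
  have xx : j x x = 0 by exact: aformvv.
  have xsy : j x (s *: y) = 0 by rewrite aformZr xy mulr0.
  have xrx : j x (r *: x) = 0 by rewrite aformZr xx mulr0.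
  have := hw z xz; rewrite {1}ez hD // !hZ // hx scaler0 addr0 hw // scalerA mulrC -scalerA -es.
  move/eqP; rewrite -subr_eq0 -scalerBl scaler_eq0 (negPf wz) orbF subr_eq0.
  by move=> /eqP.
have xyz : j x (y + z) = 0 by rewrite aformDr xy xz addr0.
have := hD y z xy xz; rewrite !hw // wD scalerDr => E.
have E2 : (be (y + z) - be y) *: w y = (be z - be (y + z)) *: w z.
  rewrite !scalerBl; apply/eqP; rewrite subr_eq addrAC eq_sym subr_eq eq_sym.
  by rewrite [X in X == _]E [_ *: w z + _]addrC.
have e1 : be z = be (y + z).
  apply/eqP; rewrite -subr_eq0; apply: contrapT => /negP n; apply: ind.
  exists ((be z - be (y + z))^-1 * (be (y + z) - be y)).
  by rewrite -scalerA E2 scalerA mulVf // scale1r.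
move: E2; rewrite e1 subrr scale0r => /eqP; rewrite scaler_eq0 (negPf wy) orbF subr_eq0.
by move=> /eqP.
Qed.

End SymplecticSpace.

(** * Maps of the cone that are linear on pencils *)

Section ConeLinear.
Variables (K : numClosedFieldType) (m d : nat) (A : 'M[K]_m) (J : 'M[K]_d).
Hypotheses (hA : A^T = - A) (hJ : J^T = - J) (uJ : J \in unitmx) (d4 : (4 <= d)%N).
Hypothesis md : (m <= d + 1)%N.
Local Notation V := (ext2 K m).
Local Notation a := (aform A).
Local Notation j := (aform J).
Local Notation cone := (cone A).
Implicit Types (p q v w : 'cV[K]_m) (b : V) (x y z : 'cV[K]_d).

(** A frame: [iota] embeds the symplectic space, [c] spans the kernel, and [R] and [t] are the dual
    coordinates. *)
Variables (iota : 'M[K]_(m, d)) (c t : 'cV[K]_m) (R : 'M[K]_(d, m)).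
Hypotheses (Ri : R *m iota = 1%:M) (Rc : R *m c = 0) (ct : dot c t = 1)
  (it : forall x, dot (iota *m x) t = 0)
  (dec : forall v, v = iota *m (R *m v) + dot v t *: c)
  (Ai : forall x y, a (iota *m x) (iota *m y) = j x y) (Ac : forall v, a c v = 0).

Variable G : V -> V.
Hypotheses (Gn : forall b, cone b -> b != 0 -> G b != 0)
  (Gc : forall b, cone b -> cone (G b))
  (GZ : forall (s : K) b, cone b -> G (s *: b) = s *: G b)
  (Gadd : forall p q q', a p q = 0 -> a p q' = 0 ->
    G (wedge p (q + q')) = G (wedge p q) + G (wedge p q'))
  (Ginj : forall b b' (s : K), cone b -> cone b' -> b != 0 -> G b = s *: G b' ->
     exists y : K, b = y *: b').

Lemma RiK x : R *m (iota *m x) = x.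
Proof. by rewrite mulmxA Ri mul1mx. Qed.

Lemma G0 : G 0 = 0.
Proof. by rewrite -(scale0r (wedge c c)) GZ ?scale0r //; exists c, c. Qed.

Lemma GN b : cone b -> G (- b) = - G b.
Proof. by move=> cb; rewrite -scaleN1r GZ // scaleN1r. Qed.

Lemma aAc v : a v c = 0.
Proof. by rewrite (aformC hA c) Ac oppr0. Qed.

Lemma cone_decomposable b : cone b -> decomposable b.
Proof. by move=> [v [w [-> _]]]; exists v, w. Qed.

Lemma cone_wedge p q : cone (wedge p q) -> wedge p q != 0 -> a p q = 0.
Proof.
move=> [v [w [e vw]]] pq; have vw0 : wedge v w != 0 by rewrite -e.
have [x1 [x2 [x3 [x4 [-> -> _]]]]] := wedge_span (esym e) vw0.
exact: aform_lin2.
Qed.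

Lemma cone_c q : cone (wedge c q).
Proof. by exists c, q. Qed.

Lemma ext2_map_iota x y : ext2_map R (wedge (iota *m x) (iota *m y)) = wedge x y.
Proof. by rewrite ext2_map_wedge !RiK. Qed.

Lemma ext2_map_c q : ext2_map R (wedge c q) = 0.
Proof. by rewrite ext2_map_wedge Rc wedge0l. Qed.

Lemma wedge_c_iota q : wedge c q = wedge c (iota *m (R *m q)).
Proof. by rewrite {1}(dec q) wedgeDr wedgeZr wedgevv scaler0 addr0. Qed.

Lemma ctr_c_iota x : ctr (wedge c (iota *m x)) t = - (iota *m x).
Proof. by rewrite ctr_wedge it ct scale0r scale1r sub0r. Qed.

Lemma ker_c v : (forall w, a v w = 0) -> v = dot v t *: c.
Proof.
move=> kv; rewrite {1}(dec v) (nondegenerate uJ (x := R *m v)) ?mulmx0 ?add0r // => y.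
rewrite -Ai -[iota *m (R *m v)](addrK (dot v t *: c)) -dec.
by rewrite aformDl aformNl aformZl Ac mulr0 oppr0 addr0 kv.
Qed.

Definition starmap x := G (wedge c (iota *m x)).

Lemma starmapD x y : starmap (x + y) = starmap x + starmap y.
Proof. by rewrite /starmap mulmxDr Gadd. Qed.

Lemma starmapZ (s : K) x : starmap (s *: x) = s *: starmap x.
Proof. by rewrite /starmap -scalemxAr wedgeZr GZ //; exact: cone_c. Qed.

Lemma starmap_inj x : starmap x = 0 -> x = 0.
Proof.
move=> e; have [//|x0] := eqVneq x 0; have : wedge c (iota *m x) != 0.
  apply: contraNneq x0 => e0; have := ctr_c_iota x; rewrite e0 ctr0 => /eqP.
  rewrite eq_sym oppr_eq0 => /eqP/(congr1 (mulmx R)).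
  by rewrite RiK mulmx0 => ->.
by move=> /(Gn (cone_c _)); rewrite -/(starmap x) e eqxx.
Qed.

Lemma starmap_center : exists2 T : 'M[K]_d, T \in unitmx &
  forall x, G (wedge c (iota *m x)) = wedge c (iota *m (T *m x)).
Proof.
have Lc x : cone (starmap x) by apply: Gc; exact: cone_c.
have [p p0 ps] := common_vector starmapD starmapZ starmap_inj
  (fun x => cone_decomposable (Lc x)) d4.
have [s es] : exists s : K, p = s *: c.
  have [[u pu]|kp] := nonkerP A p; last by exists (dot p t); exact: ker_c.
  (* If [p] were outside the kernel, write the images as [p] wedge a vector normalized by [th]. This
     vector is also orthogonal to [p] for [a], and so [Y] would inject a space of dimension [d] into
     one of dimension [m - 2 < d]. *)
  exfalso; have [th pth] := vec_dual p0.
  pose Y x := ctr (starmap x) th.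
  have YP x : [/\ starmap x = wedge p (- Y x), dot (Y x) th = 0 & a p (Y x) = 0].
    have [y ey] := ps x; rewrite /Y ey ctr_wedge pth scale1r; split.
    - by rewrite opprB wedgeDr -scaleNr wedgeZr wedgevv scaler0 addr0.
    - by rewrite -scaleN1r dotDl !dotZl pth; ring.
    - have [e|n] := eqVneq (wedge p y) 0.
        have [r ->] := wedge_eq0 p0 e.
        by rewrite !aformE (aformvv hA); ring.
      rewrite aformDr aformNr aformZr (aformvv hA) mulr0 add0r cone_wedge ?oppr0 //.
      by rewrite -ey.
  have YD x y : Y (x + y) = Y x + Y y by rewrite /Y starmapD ctrD.
  have YZ (r : K) x : Y (r *: x) = r *: Y x by rewrite /Y starmapZ ctrZ.
  have Y0 : Y 0 = 0 by rewrite -(scale0r (0 : 'cV_d)) YZ scale0r.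
  clearbody Y.
  pose Ym := \matrix_(i < d, k < m) Y (delta_mx i 0) k 0.
  have YE (z : 'rV_d) : z *m Ym = (Y z^T)^T.
    apply/matrixP => i k; rewrite (ord1 i) !mxE (cV_sum_delta z^T) (big_morph Y YD Y0).
    rewrite summxE; apply: eq_bigr => l _; by rewrite YZ !mxE.
  have Yfree : row_free Ym.
    rewrite -kermx_eq0; apply/rowV0P => z /sub_kermxP; rewrite YE => e.
    have YzT : Y z^T = 0 by apply: trmx_inj; rewrite e trmx0.
    apply: trmx_inj; rewrite trmx0; apply: starmap_inj.
    by have [-> _ _] := YP z^T; rewrite YzT oppr0 wedge0r.
  pose B : 'M[K]_(m, 1 + 1) := row_mx th (A^T *m p).
  have YB : Ym *m B = 0.
    apply/row_matrixP => i; rewrite row0 row_mul.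
    have -> : row i Ym = (Y (delta_mx i 0))^T by apply/matrixP => k l; rewrite !mxE (ord1 k).
    have [_ y1 y2] := YP (delta_mx i 0).
    rewrite mul_mx_row -[RHS]row_mx0; congr row_mx; apply/matrixP => k l.
      by rewrite (ord1 k) (ord1 l) [RHS]mxE -[RHS]y1.
    have -> : (Y (delta_mx i 0))^T *m (A^T *m p) = (p^T *m A *m Y (delta_mx i 0))^T.
      by rewrite !trmx_mul trmxK.
    by rewrite (ord1 k) (ord1 l) mxE [RHS]mxE -[RHS]y2.
  have rB : \rank B = 2%N.
    rewrite -mxrank_tr; apply/eqP; rewrite -[_ == _]/(row_free B^T) -kermx_eq0.
    apply/rowV0P => z /sub_kermxP; rewrite /B tr_row_mx -[z]hsubmxK mul_row_col.
    rewrite [lsubmx z]mx11_scalar [rsubmx z]mx11_scalar !mul_scalar_mx trmx_mul trmxK => e.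
    have e1 : lsubmx z 0 0 = 0.
      have := congr1 (fun M => (M *m p) 0 0) e.
      rewrite mulmxDl -!scalemxAl mxE [X in X + _]mxE [X in _ + X]mxE mul0mx [RHS]mxE.
      have -> : (th^T *m p) 0 0 = 1 by rewrite -pth dotC.
      by rewrite -/(a p p) (aformvv hA) mulr0 addr0 mulr1.
    have e2 : rsubmx z 0 0 = 0.
      have := congr1 (fun M => (M *m u) 0 0) e.
      rewrite e1 scale0r add0r -scalemxAl mxE mul0mx [RHS]mxE -/(a p u) pu mulr1 //.
    by rewrite e1 e2 raddf0 row_mx0.
  have := mulmx0_rank_max YB; rewrite rB; move: Yfree; rewrite /row_free => /eqP ->.
  by rewrite leqNgt => /negP; apply; apply: leq_ltn_trans md _; rewrite ltn_add2l.
have s0 : s != 0 by apply: contraNneq p0 => e; rewrite es e scale0r.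
have /choice[tau tauE] x : exists y, starmap x = wedge c (iota *m y).
  have [y ->] := ps x; exists (R *m (s *: y)); rewrite -wedge_c_iota es.
  by rewrite wedgeZl wedgeZr.
pose T : 'M[K]_d := \matrix_(i, k) tau (delta_mx k 0) i 0.
have TE x : starmap x = wedge c (iota *m (T *m x)).
  have -> : T *m x = \sum_k x k 0 *: tau (delta_mx k 0).
    apply/matrixP => i l; rewrite (ord1 l) summxE mxE; apply: eq_bigr => k _.
    by rewrite !mxE mulrC.
  rewrite {1}(cV_sum_delta x) (Lsum starmapD starmapZ) mulmx_sumr.
  have w0 : wedge c 0 = 0 by exact: wedge0r.
  rewrite (big_morph (wedge c) (fun q q' => wedgeDr q q' c) w0); apply: eq_bigr => k _.
  by rewrite -scalemxAr wedgeZr tauE.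
exists T => //; apply: injective_unitmx => x Tx; apply: starmap_inj.
by rewrite TE Tx mulmx0 wedge0r.
Qed.

Section WithT.
Variable T : 'M[K]_d.
Hypothesis uT : T \in unitmx.
Hypothesis GcT : forall x, G (wedge c (iota *m x)) = wedge c (iota *m (T *m x)).

Lemma wedge_T x y : wedge x y != 0 -> wedge (T *m x) (T *m y) != 0.
Proof.
apply: contraNneq => e; rewrite -[wedge x y]ext2_map1 -(mulVmx uT) -ext2_map_comp.
by rewrite ext2_map_wedge e ext2_map0.
Qed.

Lemma T_neq0 x : x != 0 -> T *m x != 0.
Proof. by apply: contraNneq => e; rewrite -[x](mulKmx uT) e mulmx0. Qed.

Lemma wedge_c_iota_neq0 x : x != 0 -> wedge c (iota *m x) != 0.
Proof.
apply: contraNneq => e; have := ctr_c_iota x; rewrite e ctr0 => /eqP.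
by rewrite eq_sym oppr_eq0 => /eqP/(congr1 (mulmx R)); rewrite RiK mulmx0 => ->.
Qed.

Lemma wedge_c_T (mu nu : K) x y : wedge c (iota *m (T *m (mu *: y - nu *: x))) =
  mu *: wedge c (iota *m (T *m y)) - nu *: wedge c (iota *m (T *m x)).
Proof.
by rewrite !(mulmxBr, mulmxN, =^~ scalemxAr) wedgeDr -scaleNr !wedgeZr scaleNr.
Qed.

(** Replacing [Y] by [Y - c] or [X] by [X + c] keeps the plane isotropic, so [b] plus [c /\ T x] or
    [c /\ T y] is decomposable. Hence [b] contains a vector [T x + al1 c] and a vector
    [T y + al2 c], and is a multiple of their wedge. *)
Lemma G_isotropic x y : j x y = 0 -> wedge x y != 0 -> exists be mu nu : K,
  [/\ be != 0, j (T *m x) (T *m y) = 0 &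
   G (wedge (iota *m x) (iota *m y)) =
     be *: wedge (iota *m (T *m x)) (iota *m (T *m y))
     + wedge c (iota *m (T *m (mu *: y - nu *: x)))].
Proof.
move=> xy xy0; set X := iota *m x; set Y := iota *m y.
have aXY : a X Y = 0 by rewrite Ai.
have XY0 : wedge X Y != 0.
  by apply: contraNneq xy0 => e; rewrite -ext2_map_iota -/X -/Y e ext2_map0.
have cXY : cone (wedge X Y) by exists X, Y.
have cYX : cone (wedge Y X) by exists Y, X; rewrite (aformC hA X) aXY oppr0.
set b := G (wedge X Y); have cb : cone b by exact: Gc.
have b0 : b != 0 := Gn cXY XY0.
(* As [T] is invertible, every bivector through [c] is already the image of one through [c]. *)
have nc : ~ in_star c b.
  move=> [q eb]; have : b = 1 *: G (wedge c (iota *m (invmx T *m (R *m q)))).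
    by rewrite scale1r GcT mulKVmx // -wedge_c_iota.
  move=> /Ginj[||//|s es]; [exact: cXY|exact: cone_c|].
  case/eqP: xy0; rewrite -ext2_map_iota -/X -/Y es ext2_mapZ ext2_map_c.
  by rewrite scaler0.
have meet z : z != 0 -> (exists u : V, cone u /\ b + wedge c (iota *m (T *m z)) = u) ->
    exists al : K, in_star (iota *m (T *m z) + al *: c) b.
  move=> z0 [u [cu eu]].
  have [|/nc//|//] := meet_outside (wedge_c_iota_neq0 (T_neq0 z0)) b0 (cone_decomposable cb).
  by rewrite addrC eu; exact: cone_decomposable.
have [al1 s1] : exists al : K, in_star (iota *m (T *m x) + al *: c) b.
  apply: meet; first exact: wedge_neq0l xy0.
  exists (G (wedge X (Y - c))); split.
    by apply: Gc; exists X, (Y - c); rewrite aformDr aformNr aAc aXY subrr.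
  rewrite Gadd // ?aformNr ?aAc ?oppr0 // -scaleN1r wedgeZr scaleN1r -wedgeC.
  by rewrite GcT.
have [al2 s2] : exists al : K, in_star (iota *m (T *m y) + al *: c) b.
  apply: meet; first exact: wedge_neq0r xy0.
  have aYX : a Y X = 0 by rewrite (aformC hA X) aXY oppr0.
  exists (G (- wedge Y (X + c))); split.
    apply: Gc; rewrite -scaleN1r; apply: coneZ; exists Y, (X + c).
    by rewrite aformDr aYX aAc addr0.
  rewrite GN; last by exists Y, (X + c); rewrite aformDr aYX aAc addr0.
  rewrite Gadd ?aAc // opprD -!GN -?wedgeC ?GcT //.
  by exists Y, c; rewrite aAc.
set z1 := _ + _ in s1; set z2 := _ + _ in s2.
have z12 : wedge z1 z2 != 0.
  apply: contraNneq (wedge_T xy0) => e; have := congr1 (ext2_map R) e.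
  rewrite ext2_map_wedge /z1 /z2 !mulmxDr -!scalemxAr Rc !scaler0 !addr0 !RiK => ->.
  by rewrite ext2_map0.
have [be be0 eb] := in_star2 b0 z12 s1 s2.
exists be, (be * al1), (be * al2); split=> //.
  have : a z1 z2 = 0.
    apply: cone_wedge => //; have -> : wedge z1 z2 = be^-1 *: b.
      by rewrite eb scalerA mulVf // scale1r.
    exact: coneZ.
  by rewrite /z1 /z2 !aformDl !aformDr !aformZl !aformZr Ai Ac aAc Ac !mulr0 !addr0.
rewrite wedge_c_T eb /z1 /z2 wedgeDl !wedgeDr !wedgeZl !wedgeZr wedgevv !scaler0 addr0.
rewrite [wedge (iota *m (T *m x)) c]wedgeC scalerN !scalerDr scalerN !scalerA.
by rewrite -addrA [- _ + _]addrC.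
Qed.

(** With [part1], the two components of a bivector, on the image of [iota] and on [c] wedge that
    image, moved back by the inverse of [T]. The sign in [part1] undoes that of [ctr_c_iota]. *)
Definition part2 b : ext2 K d := ext2_map (invmx T *m R) b.
Definition part1 b : 'cV[K]_d := - (invmx T *m R *m ctr b t).

Lemma part_form (be mu nu : K) x y b :
  b = be *: wedge (iota *m (T *m x)) (iota *m (T *m y))
     + wedge c (iota *m (T *m (mu *: y - nu *: x))) ->
  part2 b = be *: wedge x y /\ part1 b = mu *: y - nu *: x.
Proof.
move=> ->; rewrite /part2 /part1; split.
  rewrite ext2_mapD ext2_mapZ !ext2_map_wedge -!mulmxA !RiK !mulKmx // Rc mulmx0.
  by rewrite wedge0l addr0.
rewrite ctrD ctrZ ctr_c_iota ctr_wedge !it !scale0r subrr scaler0 add0r.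
by rewrite mulmxN opprK -mulmxA RiK mulKmx.
Qed.

Lemma part2D b b' : part2 (b + b') = part2 b + part2 b'.
Proof. exact: ext2_mapD. Qed.

Lemma part2Z (s : K) b : part2 (s *: b) = s *: part2 b.
Proof. exact: ext2_mapZ. Qed.

Lemma part1D b b' : part1 (b + b') = part1 b + part1 b'.
Proof. by rewrite /part1 ctrD mulmxDr opprD. Qed.

Lemma part1Z (s : K) b : part1 (s *: b) = s *: part1 b.
Proof. by rewrite /part1 ctrZ -scalemxAr scalerN. Qed.

Definition Giso x y := G (wedge (iota *m x) (iota *m y)).

Lemma GisoD x y z : j x y = 0 -> j x z = 0 -> Giso x (y + z) = Giso x y + Giso x z.
Proof. by move=> xy xz; rewrite /Giso mulmxDr Gadd ?Ai. Qed.

Lemma GisoZ (s : K) x y : j x y = 0 -> Giso x (s *: y) = s *: Giso x y.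
Proof.
by move=> xy; rewrite /Giso -scalemxAr wedgeZr GZ //; exists (iota *m x), (iota *m y); rewrite Ai.
Qed.

Lemma GisoC x y : j x y = 0 -> Giso y x = - Giso x y.
Proof.
by move=> xy; rewrite /Giso wedgeC GN //; exists (iota *m x), (iota *m y); rewrite Ai.
Qed.

Lemma Gisovv x : Giso x x = 0.
Proof. by rewrite /Giso wedgevv G0. Qed.

Lemma Giso_dep x y : wedge x y = 0 -> Giso x y = 0.
Proof.
have [->|x0] := eqVneq x 0; first by rewrite /Giso mulmx0 !wedge0l G0.
move=> /(wedge_eq0 x0)[s ->].
by rewrite /Giso -scalemxAr wedgeZr wedgevv scaler0 G0.
Qed.

Lemma Giso_form : exists be mu nu : 'cV[K]_d -> 'cV[K]_d -> K, forall x y, j x y = 0 ->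
  [/\ wedge x y != 0 -> be x y != 0,
      Giso x y = be x y *: wedge (iota *m (T *m x)) (iota *m (T *m y))
       + wedge c (iota *m (T *m (mu x y *: y - nu x y *: x))),
      part2 (Giso x y) = be x y *: wedge x y &
      part1 (Giso x y) = mu x y *: y - nu x y *: x].
Proof.
have ex (xy : 'cV[K]_d * 'cV[K]_d) : exists s : K * K * K, j xy.1 xy.2 = 0 ->
  (wedge xy.1 xy.2 != 0 -> s.1.1 != 0) /\
  Giso xy.1 xy.2 = s.1.1 *: wedge (iota *m (T *m xy.1)) (iota *m (T *m xy.2))
       + wedge c (iota *m (T *m (s.1.2 *: xy.2 - s.2 *: xy.1))).
  case: xy => x y /=; have [xy|xy] := eqVneq (j x y) 0; last first.
    by exists (0, 0, 0) => e; rewrite e eqxx in xy.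
  have [e|n] := eqVneq (wedge x y) 0.
    exists (0, 0, 0) => _; split=> //=.
    by rewrite !scale0r subrr !mulmx0 wedge0r addr0 Giso_dep.
  have [be [mu [nu [be0 _ e]]]] := G_isotropic xy n.
  by exists (be, mu, nu).
have [s sP] := choice ex.
exists (fun x y => (s (x, y)).1.1), (fun x y => (s (x, y)).1.2), (fun x y => (s (x, y)).2).
move=> x y xy; have [/= h1 h2] := sP (x, y) xy; have [h3 h4] := part_form h2.
by split.
Qed.

Lemma T_similitude : exists2 s : K, s != 0 & forall x y, j (T *m x) (T *m y) = s * j x y.
Proof.
have [||||s sP] := @proportional_forms _ _ _ hJ uJ d4 (fun x y => j (T *m x) (T *m y)).
- by move=> x y z; rewrite mulmxDr aformDr.
- by move=> s x y; rewrite -scalemxAr aformZr.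
- by move=> x y; rewrite (aformC hJ).
- move=> x y xy; have [e|n] := eqVneq (wedge x y) 0; last first.
    by have [? [? [? []]]] := G_isotropic xy n.
  have [->|x0] := eqVneq x 0; first by rewrite mulmx0 aform0l.
  have [r ->] := wedge_eq0 x0 e.
  by rewrite -scalemxAr aformZr (aformvv hJ) mulr0.
exists s => //; have d0 : (0 < d)%N by apply: leq_trans d4.
have nz : (delta_mx (Ordinal d0) 0 : 'cV[K]_d) != 0.
  by apply/eqP => /matrixP/(_ (Ordinal d0) 0); rewrite !mxE !eqxx => /eqP; rewrite oner_eq0.
have [y xy] := exists_dual uJ (T_neq0 nz).
apply/eqP => s0; move: xy; rewrite -[y](mulKVmx uT) sP s0 mul0r => /eqP.
by rewrite eq_sym oner_eq0.
Qed.

(** The coefficients of [Giso_form] depend on the pair: [perp_eigen] frees them from [y], symmetry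
    and connectedness make [be] constant, and [mu x y] becomes a linear form in [x]. *)
Theorem Giso_linear : exists (be : K) (al : 'cV[K]_d), be != 0 /\ forall x y, j x y = 0 ->
  Giso x y = be *: wedge (iota *m (T *m x)) (iota *m (T *m y))
     + wedge c (iota *m (T *m (dot al x *: y - dot al y *: x))).
Proof.
have [be [mu [nu form]]] := Giso_form.
have be_loc x y z : j x y = 0 -> j x z = 0 -> wedge x y != 0 -> wedge x z != 0 -> be x y = be x z.
  move=> xy xz xy0 xz0; have x0 := wedge_neq0l xy0.
  apply: (@perp_eigen _ _ _ hJ _ (wedge x) (fun y => part2 (Giso x y)) (be x) x) => //.
  - by move=> u v; rewrite wedgeDr.
  - by move=> s u; rewrite wedgeZr.
  - by move=> u v xu xv; rewrite GisoD // part2D.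
  - by move=> s u xu; rewrite GisoZ // part2Z.
  - by rewrite Gisovv -(scale0r (0 : V)) part2Z scale0r.
  - by move=> u /(wedge_eq0 x0).
  - by move=> u xu; have [_ _ ->] := form x u xu.
have jC x y : j x y = 0 -> j y x = 0 by move=> xy; rewrite (aformC hJ x) xy oppr0.
have wC x y : wedge x y != 0 -> wedge y x != 0 by move=> xy; rewrite wedgeC oppr_eq0.
have be_sym x y : j x y = 0 -> wedge x y != 0 -> be y x = be x y.
  move=> xy xy0; have [_ _ e1 _] := form x y xy; have [_ _ + _] := form y x (jC _ _ xy).
  rewrite GisoC // -scaleN1r part2Z e1 scaleN1r -scalerN -wedgeC => /eqP.
  rewrite -subr_eq0 -scalerBl scaler_eq0 (negPf (wC _ _ xy0)) orbF subr_eq0.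
  by move=> /eqP.
(* The pairs are joined through [z], orthogonal to [x] and [x'] and independent of each. *)
have be_const x y x' y' : j x y = 0 -> wedge x y != 0 -> j x' y' = 0 -> wedge x' y' != 0 ->
    be x y = be x' y'.
  move=> xy xy0 xy' xy0'.
  have [z [xz xz' wz wz']] := common_perp_indep hJ uJ d4 (wedge_neq0l xy0) (wedge_neq0l xy0').
  rewrite (be_loc x y z xy xz xy0 wz) -(be_sym x z xz wz).
  rewrite (be_loc z x x' (jC _ _ xz) (jC _ _ xz') (wC _ _ wz) (wC _ _ wz')).
  by rewrite (be_sym x' z xz' wz'); exact: be_loc.
(* Wedging with [x] removes the [nu] term and leaves an eigenvalue situation for [mu]. *)
have mu_loc x y z : j x y = 0 -> j x z = 0 -> wedge x y != 0 -> wedge x z != 0 -> mu x y = mu x z.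
  move=> xy xz xy0 xz0; have x0 := wedge_neq0l xy0.
  apply: (@perp_eigen _ _ _ hJ _ (wedge x) (fun y => wedge x (part1 (Giso x y))) (mu x) x) => //.
  - by move=> u v; rewrite wedgeDr.
  - by move=> s u; rewrite wedgeZr.
  - by move=> u v xu xv; rewrite GisoD // part1D wedgeDr.
  - by move=> s u xu; rewrite GisoZ // part1Z wedgeZr.
  - by rewrite Gisovv -(scale0r (0 : V)) part1Z scale0r wedge0r.
  - by move=> u /(wedge_eq0 x0).
  - move=> u xu; have [_ _ _ ->] := form x u xu.
    by rewrite wedgeDr -scaleNr !wedgeZr wedgevv scaler0 addr0.
have nu_mu x y : j x y = 0 -> wedge x y != 0 -> nu x y = mu y x.
  move=> xy xy0; have [_ _ _ e1] := form x y xy; have [_ _ _] := form y x (jC _ _ xy).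
  rewrite GisoC // -scaleN1r part1Z e1 => /(congr1 (fun z => wedge z y)).
  rewrite scaleN1r opprB !wedgeDl -!scaleNr !wedgeZl wedgevv !scaler0 !addr0 => /eqP.
  rewrite -subr_eq0 -scalerBl scaler_eq0 (negPf xy0) orbF subr_eq0.
  by move=> /eqP.
have perp x : x != 0 -> exists z, j x z = 0 /\ wedge x z != 0.
  by move=> x0; have [z [h1 _ h2 _]] := common_perp_indep hJ uJ d4 x0 x0; exists z.
have /choice[zf zfP] x : exists z, x != 0 -> j x z = 0 /\ wedge x z != 0.
  have [->|x0] := eqVneq x 0; first by exists 0.
  by have [z zP] := perp x x0; exists z.
pose f x := if x == 0 then 0 else mu x (zf x).
have fE x y : j x y = 0 -> wedge x y != 0 -> mu x y = f x.
  move=> xy xy0; have x0 := wedge_neq0l xy0; rewrite /f (negPf x0).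
  by have [h1 h2] := zfP x x0; apply: mu_loc.
have p1 x y : j x y = 0 -> wedge x y != 0 -> part1 (Giso x y) = f x *: y - f y *: x.
  move=> xy xy0; have [_ _ _ ->] := form x y xy.
  by rewrite nu_mu // (fE x y xy xy0) (fE y x (jC _ _ xy) (wC _ _ xy0)).
have coef x y (s r : K) : wedge x y != 0 -> s *: y - r *: x = 0 -> r = 0.
  move=> xy0 /(congr1 (fun z => wedge z y)); rewrite wedgeDl -scaleNr !wedgeZl wedgevv.
  rewrite scaler0 add0r wedge0l => /eqP; rewrite scaler_eq0 (negPf xy0) orbF oppr_eq0.
  by move/eqP.
have f0 : f 0 = 0 by rewrite /f eqxx.
clearbody f.
have fZ (s : K) x : f (s *: x) = s * f x.
  have [->|s0] := eqVneq s 0; first by rewrite scale0r mul0r f0.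
  have [->|x0] := eqVneq x 0; first by rewrite scaler0 f0 mulr0.
  have [z [xz xz0]] := perp x x0; have zx := jC _ _ xz; have zx0 := wC _ _ xz0.
  have zsx : j z (s *: x) = 0 by rewrite aformZr zx mulr0.
  have zsx0 : wedge z (s *: x) != 0 by rewrite wedgeZr scaler_eq0 negb_or s0.
  have := p1 _ _ zsx zsx0; rewrite GisoZ // part1Z p1 // => e.
  apply/eqP; rewrite -subr_eq0; apply/eqP; apply: (coef z x 0 _ zx0).
  apply/matrixP => i k; have := congr1 (fun M : 'cV_d => M i k) e; rewrite !mxE => e'.
  by move/esym/eqP: e'; rewrite -subr_eq0 => /eqP e2; rewrite -[RHS]e2; ring.
have fD x y : f (x + y) = f x + f y.
  have [e|n] := eqVneq (wedge x y) 0.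
    have [->|x0] := eqVneq x 0; first by rewrite f0 !add0r.
    have [s ->] := wedge_eq0 x0 e.
    by rewrite -{1}[x]scale1r -scalerDl !fZ; ring.
  (* Additivity is tested against one [z] that forms isotropic planes with [x], [y] and [x + y] at
     once. *)
  have [z [zx zy zx0 zy0 zxy0]] := common_perp_indep3 hJ d4 n.
  have zxy : j z (x + y) = 0 by rewrite aformDr zx zy addr0.
  have := p1 _ _ zxy zxy0; rewrite GisoD // part1D !p1 // => e.
  apply/eqP; rewrite -subr_eq0; apply/eqP; apply: (coef z x 0 _ zx0).
  apply/matrixP => i k; have := congr1 (fun M : 'cV_d => M i k) e; rewrite !mxE => e'.
  by move/esym/eqP: e'; rewrite -subr_eq0 => /eqP e2; rewrite -[RHS]e2; ring.
pose al : 'cV[K]_d := \col_i f (delta_mx i 0).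
have alE x : dot al x = f x.
  rewrite {2}(cV_sum_delta x) (big_morph f fD f0) /dot mxE; apply: eq_bigr => i _.
  by rewrite fZ !mxE mulrC.
have d0 : (0 < d)%N by apply: leq_trans d4.
have nz : (delta_mx (Ordinal d0) 0 : 'cV[K]_d) != 0.
  by apply/eqP => /matrixP/(_ (Ordinal d0) 0); rewrite !mxE !eqxx => /eqP; rewrite oner_eq0.
have [z0 [xz0 wz0]] := perp _ nz.
exists (be (delta_mx (Ordinal d0) 0) z0), al; split; first by have [-> //] := form _ _ xz0.
move=> x y xy; rewrite !alE; have [e|n] := eqVneq (wedge x y) 0.
  rewrite Giso_dep //; have [->|x0] := eqVneq x 0.
    by rewrite f0 scaler0 scale0r subrr !mulmx0 wedge0l wedge0r scaler0 addr0.
  have [s ->] := wedge_eq0 x0 e.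
  rewrite fZ -!scalemxAr wedgeZr wedgevv !scaler0 add0r scalerA mulrC subrr.
  by rewrite !mulmx0 wedge0r.
have [_ -> _ _] := form x y xy.
by rewrite (be_const _ _ _ _ xz0 wz0 xy n) nu_mu // (fE x y xy n) (fE y x (jC _ _ xy) (wC _ _ n)).
Qed.

End WithT.

Definition frame_map (T : 'M[K]_d) (be : K) (al : 'cV[K]_d) v : 'cV[K]_m :=
  iota *m (T *m (R *m v)) + (be * (dot al (R *m v) + dot v t)) *: c.

(** [G] carries the factor [be] on bivectors of [iota] but no factor on those through [c]; scaling
    the [c] component by the inverse of [be] reconciles the two. *)
Theorem cone_linear : exists (T : 'M[K]_d) (be s : K) (al : 'cV[K]_d),
  [/\ T \in unitmx, be != 0, s != 0, forall x y, j (T *m x) (T *m y) = s * j x y &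
   forall v w, a v w = 0 ->
     G (wedge v w) = be *: wedge (frame_map T be^-1 al v) (frame_map T be^-1 al w)].
Proof.
have [T uT GcT] := starmap_center; have [s s0 sP] := T_similitude uT GcT.
have [be [al [be0 beP]]] := Giso_linear uT GcT.
exists T, be, s, al; split=> // v w vw.
set x := R *m v; set y := R *m w; set k := dot v t; set l := dot w t.
have xy : j x y = 0.
  rewrite -vw -Ai [in RHS](dec v) [in RHS](dec w).
  by rewrite !aformDl !aformDr !aformZl !aformZr !Ac !aAc !mulr0 !addr0.
have aXY : a (iota *m x) (iota *m y) = 0 by rewrite Ai.
have aYX : a (iota *m y) (iota *m x) = 0 by rewrite (aformC hA (iota *m x)) aXY oppr0.
have coc (z : 'cV[K]_m) : cone (wedge z c) by exists z, c; rewrite aAc.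
have Gv (z : 'cV[K]_m) : G (wedge z c) = - wedge c (iota *m (T *m (R *m z))).
  by rewrite (wedgeC c z) GN; [rewrite wedge_c_iota GcT | exact: cone_c].
have ev : v = iota *m x + k *: c := dec v.
have ew : w = iota *m y + l *: c := dec w.
have avy : a v (iota *m y) = 0 by rewrite ev aformDl aformZl Ac aXY mulr0 addr0.
have -> : wedge v w = wedge v (iota *m y + l *: c) by rewrite -ew.
rewrite Gadd ?aformZr ?aAc ?mulr0 // wedgeZr GZ // Gv -/x.
rewrite (wedgeC (iota *m y) v) GN; last first.
  by exists (iota *m y), v; rewrite (aformC hA v) avy oppr0.
have -> : wedge (iota *m y) v = wedge (iota *m y) (iota *m x + k *: c) by rewrite -ev.
rewrite Gadd ?aformZr ?aAc ?mulr0 // wedgeZr GZ // Gv RiK.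
rewrite (wedgeC (iota *m x)) GN; last by exists (iota *m x), (iota *m y).
have := beP x y xy; rewrite /Giso => ->; rewrite wedge_c_T.
rewrite /frame_map -/x -/y -/k -/l.
rewrite wedgeDl !wedgeDr !wedgeZl !wedgeZr wedgevv !scaler0 addr0.
rewrite (wedgeC c (iota *m (T *m x))).
set P := wedge _ _; set Q := wedge c _; set S := wedge c _.
rewrite !scalerDr !scalerN !scalerA !mulVKf //.
move: P Q S => P Q S; apply: val_inj; apply/matrixP => i i'; rewrite /= !mxE.
ring.
Qed.
End ConeLinear.

(** * Adapted frames *)

Section Darboux.
Variable K : numClosedFieldType.

Lemma darboux_vectors m (A : 'M[K]_m) n : A^T = - A -> (n + n <= \rank A)%N ->
  exists e f : nat -> 'cV[K]_m, forall i j, (i < n)%N -> (j < n)%N ->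
    [/\ aform A (e i) (f j) = (i == j)%:R, aform A (e i) (e j) = 0
      & aform A (f i) (f j) = 0].
Proof.
move=> hA; elim: n => [|n IHn] rA; first by exists (fun=> 0), (fun=> 0).
have [|e [f ef]] := IHn.
  by apply: leq_trans rA; rewrite leq_add.
pose E : 'M[K]_(m, n + n) :=
    row_mx (\matrix_(i < m, j < n) e j i 0) (\matrix_(i < m, j < n) f j i 0).
have colE1 (j : 'I_n) : col (lshift n j) E = e j.
  by apply/matrixP => i k; rewrite mxE row_mxEl mxE (ord1 k).
have colE2 (j : 'I_n) : col (rshift n j) E = f j.
  by apply/matrixP => i k; rewrite mxE row_mxEr mxE (ord1 k).
(* Symplectic Gram-Schmidt: [A E] has rank at most [2n], less than that of [A], so some vector is
   orthogonal to the pairs already built without being in the kernel. *)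
have [z zE zA] : exists2 z : 'rV[K]_m, z *m (A *m E) = 0 & z *m A != 0.
  apply: contrapT => nz; have : (kermx (A *m E) <= kermx A)%MS.
    apply/row_subP => i; apply/sub_kermxP/eqP; apply: contrapT => /negP zA.
    apply: nz; exists (row i (kermx (A *m E))) => //.
    by apply/sub_kermxP; exact: row_sub.
  move=> /mxrankS; rewrite !mxrank_ker leq_sub2lE ?rank_leq_row // => rAE.
  have := leq_trans rA (leq_trans rAE (leq_trans (mxrankM_maxr _ _) (rank_leq_col _))).
  by rewrite leqNgt addSn addnS ltnS leqnSn.
pose x := z^T.
have xa w : aform A x w = (z *m A *m w) 0 0 by rewrite /aform trmxK.
have xcol k : aform A x (col k E) = 0.
  by rewrite xa -mulmxA colE mulmxA mulmxA -(mulmxA z) zE mul0mx mxE.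
have xe (j : nat) : (j < n)%N -> aform A x (e j) = 0.
  by move=> jn; rewrite -(colE1 (Ordinal jn)).
have xf (j : nat) : (j < n)%N -> aform A x (f j) = 0.
  by move=> jn; rewrite -(colE2 (Ordinal jn)).
have [[y0 xy0]|kx] := nonkerP A x; last first.
  case/eqP: zA; apply/matrixP => i k; rewrite (ord1 i) [RHS]mxE.
  by rewrite -(kx (delta_mx k 0)) xa -colE [RHS]mxE.
(* The partner is made orthogonal to the earlier pairs; since [x] is orthogonal to them, its pairing
   with [x] remains 1. *)
pose y := y0 + (- \sum_(i < n) aform A (e i) y0 *: f i + \sum_(i < n) aform A (f i) y0 *: e i).
have asum (I : finType) (g : I -> K) (h : I -> 'cV[K]_m) w :
    aform A w (\sum_i g i *: h i) = \sum_i g i * aform A w (h i).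
  rewrite (big_morph (aform A w) (fun u v => aformDr A u v w) (aform0r A w)).
  by apply: eq_bigr => i _; rewrite aformZr.
have efC i j : (i < n)%N -> (j < n)%N -> aform A (f i) (e j) = - (i == j)%:R.
  by move=> iN jN; rewrite (aformC hA (e j)); have [-> _ _] := ef j i jN iN; rewrite eq_sym.
have xy : aform A x y = 1.
  rewrite !aformDr aformNr !asum xy0 !big1 ?oppr0 ?addr0 // => i _.
    by rewrite xe ?mulr0.
  by rewrite xf ?mulr0.
have ey j : (j < n)%N -> aform A (e j) y = 0.
  move=> jN; rewrite !aformDr aformNr !asum [X in _ + (_ + X)]big1 => [|i _]; last first.
    by have [_ -> _] := ef j i jN (ltn_ord i); rewrite mulr0.
  rewrite (bigD1 (Ordinal jN)) //= big1 => [|i ij]; last first.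
    have [-> _ _] := ef j i jN (ltn_ord i).
    by rewrite eq_sym -[j]/(val (Ordinal jN)) (inj_eq val_inj) (negPf ij) mulr0.
  by have [-> _ _] := ef j j jN jN; rewrite eqxx mulr1 !addr0 subrr.
have fy j : (j < n)%N -> aform A (f j) y = 0.
  move=> jN; rewrite !aformDr aformNr !asum [X in _ + (- X + _)]big1 => [|i _]; last first.
    by have [_ _ ->] := ef j i jN (ltn_ord i); rewrite mulr0.
  rewrite (bigD1 (Ordinal jN)) //= big1 => [|i ij]; last first.
    by rewrite efC // eq_sym -[j]/(val (Ordinal jN)) (inj_eq val_inj) (negPf ij) oppr0 mulr0.
  by rewrite efC // eqxx mulrN1 addr0 oppr0 add0r subrr.
exists (fun i => if i == n then x else e i), (fun i => if i == n then y else f i) => i j.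
have ltn_ i' : (i' < n.+1)%N -> i' != n -> (i' < n)%N.
  by rewrite ltnS leq_eqVlt => /orP[->|].
move=> iN jN; have [ein|ni] := eqVneq i n; have [ejn|nj] := eqVneq j n.
- by rewrite ein ejn eqxx xy !(aformvv hA).
- have jn := ltn_ j jN nj.
  by rewrite ein eq_sym (negPf nj) xe // xf // (aformC hA (f j)) fy // oppr0.
- have i_n := ltn_ i iN ni.
  by rewrite ejn (negPf ni) ey // (aformC hA x) xe // oppr0 fy.
- exact: ef (ltn_ i iN ni) (ltn_ j jN nj).
Qed.

Definition standard_form n : 'M[K]_(n + n) := block_mx 0 1%:M (- 1%:M) 0.

Lemma darboux_matrix m (A : 'M[K]_m) n : A^T = - A -> (n + n <= \rank A)%N ->
  exists E : 'M[K]_(m, n + n), E^T *m A *m E = standard_form n.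
Proof.
move=> hA rA; have [e [f ef]] := darboux_vectors hA rA.
pose E1 : 'M[K]_(m, n) := \matrix_(i < m, j < n) e j i 0.
pose E2 : 'M[K]_(m, n) := \matrix_(i < m, j < n) f j i 0.
have ent (g h : nat -> 'cV[K]_m) (i j : 'I_n) :
    ((\matrix_(k < m, l < n) g l k 0)^T *m A *m (\matrix_(k < m, l < n) h l k 0)) i j
    = aform A (g i) (h j).
  rewrite /aform !mxE; apply: eq_bigr => k _; rewrite !mxE; congr (_ * _).
  by apply: eq_bigr => l _; rewrite !mxE.
exists (row_mx E1 E2); rewrite tr_row_mx mul_col_mx mul_col_mx !mul_mx_row /standard_form.
rewrite -/(block_mx _ _ _ _); congr block_mx; apply/matrixP => i j; rewrite ent !mxE.
- by have [_ -> _] := ef i j (ltn_ord i) (ltn_ord j).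
- by have [-> _ _] := ef i j (ltn_ord i) (ltn_ord j); rewrite (inj_eq val_inj).
- rewrite (aformC hA (e j)); have [-> _ _] := ef j i (ltn_ord j) (ltn_ord i).
  by rewrite eq_sym (inj_eq val_inj).
- by have [_ _ ->] := ef i j (ltn_ord i) (ltn_ord j).
Qed.

Lemma symplectic_standard k (J : 'M[K]_k) n : k = (n + n)%N -> J^T = - J -> J \in unitmx ->
  exists W : 'M[K]_(n + n, k), W^T *m standard_form n *m W = J.
Proof.
move=> ek; case: _ / (esym ek) J => J hJ uJ.
have [|E eE] := @darboux_matrix _ J n hJ; first by rewrite mxrank_unit.
have uE : E \in unitmx.
  have : standard_form n *m (- standard_form n) = 1%:M.
    rewrite /standard_form opp_block_mx mulmx_block !oppr0 opprK.
    by rewrite !(mul0mx, mulmx0, addr0, add0r, mul1mx, mulmx1, mulmxN, mulNmx, opprK)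
      -scalar_mx_block.
  move=> /mulmx1_unit[]; rewrite -eE => u _.
  by move: u; rewrite unitmx_mul => /andP[].
exists (invmx E); rewrite -eE !mulmxA -trmx_mul mulmxV // trmx1 mul1mx.
by rewrite -mulmxA mulmxV // mulmx1.
Qed.

Lemma odd_frame n (A : 'M[K]_(2 * n + 1)) (J : 'M[K]_(2 * n)) :
  A^T = - A -> \rank A = (2 * n)%N -> J^T = - J -> J \in unitmx ->
  exists2 P : 'M[K]_(2 * n + 1), P \in unitmx & P^T *m A *m P = block_mx J 0 0 0.
Proof.
move=> hA rA hJ uJ; have e2 : (2 * n = n + n)%N by rewrite mul2n addnn.
have [|E eE] := @darboux_matrix _ A n hA; first by rewrite rA e2.
have [W eW] := symplectic_standard e2 hJ uJ.
pose iota := E *m W.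
have iotaE : iota^T *m A *m iota = J.
  by rewrite /iota trmx_mul -!mulmxA (mulmxA E^T) (mulmxA _ E) eE mulmxA.
have [c c0 Ac] : exists2 c : 'cV[K]_(2 * n + 1), c != 0 & A *m c = 0.
  have : kermx A^T != 0.
    rewrite kermx_eq0 -row_leq_rank mxrank_tr rA -ltnNge.
    by rewrite addn1 ltnS.
  move=> /rowV0Pn[z /sub_kermxP zA z0]; exists z^T.
    by rewrite -trmx0 (inj_eq trmx_inj).
  by rewrite -[A]trmxK -trmx_mul zA trmx0.
have cA : c^T *m A = 0.
  by apply: trmx_inj; rewrite trmx_mul trmxK hA mulNmx Ac oppr0 trmx0.
exists (row_mx iota c).
  apply: injective_unitmx => z; rewrite -[z]vsubmxK mul_row_col => e.
  have x0 : usubmx z = 0.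
    have := congr1 (mulmx (iota^T *m A)) e.
    rewrite mulmxDr mulmx0 [X in X + _]mulmxA iotaE [X in _ + X]mulmxA.
    rewrite -(mulmxA _ A) Ac mulmx0 mul0mx addr0 => /(congr1 (mulmx (invmx J))).
    by rewrite mulKmx // mulmx0.
  move: e; rewrite x0 mulmx0 add0r [dsubmx z]mx11_scalar mul_mx_scalar => /eqP.
  by rewrite scaler_eq0 (negPf c0) orbF => /eqP ->; rewrite raddf0 col_mx0.
rewrite tr_row_mx mul_col_mx mul_col_mx !mul_mx_row -/(block_mx _ _ _ _) iotaE cA !mul0mx.
by rewrite -mulmxA Ac mulmx0.
Qed.

End Darboux.

(** * Group morphisms and quotients *)

Section GroupMorphisms.
Local Open Scope group_scope.
Local Open Scope quotient_scope.

Lemma isomorphic_of (G H : groupType) (f : G -> H) :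
  {morph f : x y / x * y} -> injective f -> (forall y, exists x, f x = y) -> isomorphic G H.
Proof.
move=> fM fI /choice[g gK].
pose f' : {multiplicative G -> H} := HB.pack f (isMultiplicative.Build G H f fM).
by exists f'; exists g => x; [apply: fI; rewrite gK | exact: gK].
Qed.

Lemma isomorphic_sym (G H : groupType) : isomorphic G H -> isomorphic H G.
Proof.
move=> [f [g fK gK]]; apply: (@isomorphic_of _ _ g) => [x y||x].
- by apply: (can_inj fK); rewrite gmulfM !gK.
- exact: can_inj gK.
- by exists (f x).
Qed.

Lemma morph_one (G H : groupType) (f : G -> H) : {morph f : x y / x * y} -> f 1 = 1.
Proof. by move=> fM; apply: (mulgI (f 1)); rewrite -fM !mulg1. Qed.

Lemma morph_inv (G H : groupType) (f : G -> H) : {morph f : x y / x * y} ->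
  {morph f : x / x^-1}.
Proof. by move=> fM x; apply: (mulgI (f x)); rewrite -fM !mulgV (morph_one fM). Qed.

Lemma pi_mul (G : groupType) (N : normalClosed G) :
  {morph (fun x => \pi_(quotient_group N) x) : x y / x * y}.
Proof. by move=> x y; exact: esym (pi_quo_mul N x y). Qed.

Lemma pi_eq1 (G : groupType) (N : normalClosed G) x :
  (\pi_(quotient_group N) x = 1) <-> x \in N.
Proof.
split=> [/eqmodP|xN].
  by rewrite /= same_coset_sym /same_coset invg1 mul1g.
by apply/eqmodP; rewrite /= same_coset_sym /same_coset invg1 mul1g.
Qed.

Lemma first_isomorphism (G H : groupType) (N : normalClosed G) (f : G -> H) :
  {morph f : x y / x * y} -> (forall y, exists x, f x = y) ->
  (forall x, x \in N <-> f x = 1) -> isomorphic (quotient_group N) H.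
Proof.
move=> fM fS fN; pose g (q : quotient_group N) := f (repr q).
have gpi x : g (\pi x) = f x.
  have /fN := repr_same_coset N x; rewrite fM (morph_inv fM) => e.
  by apply: (mulgI (g (\pi x))^-1); rewrite mulVg e.
apply: (@isomorphic_of _ _ g) => [p q|p q e|y].
- by rewrite -[p]reprK -[q]reprK -[_ * _]pi_mul !gpi fM.
- rewrite -[p]reprK -[q]reprK; apply/eqmodP; rewrite /= /same_coset.
  by apply/fN; rewrite fM (morph_inv fM) -/(g p) e mulVg.
- by have [x <-] := fS y; exists (\pi x); rewrite gpi.
Qed.

Lemma factor_morphism (G H L : groupType) (f : G -> H) (h : G -> L) :
  {morph f : x y / x * y} -> {morph h : x y / x * y} -> (forall y, exists x, f x = y) ->
  (forall x, f x = 1 -> h x = 1) ->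
  exists2 k : H -> L, {morph k : x y / x * y} & forall x, k (f x) = h x.
Proof.
move=> fM hM /choice[g gK] fh.
have kf x : h (g (f x)) = h x.
  apply: (mulgI (h x)^-1); rewrite mulVg -(morph_inv hM) -hM; apply: fh.
  by rewrite fM (morph_inv fM) gK mulVg.
exists (h \o g) => // x y /=.
by rewrite -hM -[RHS]kf fM !gK.
Qed.

Section Kernel.
Variables (G H : groupType) (f : {multiplicative G -> H}).

Definition kernel : {pred G} := [pred x | f x == 1].

Fact kernel1 : 1 \in kernel.
Proof. by rewrite inE (morph_one (@gmulfM _ _ f)). Qed.
Fact kernelM : mulg_closed kernel.
Proof. by move=> x y; rewrite !inE gmulfM => /eqP-> /eqP->; rewrite mulg1. Qed.
Fact kernelV : invg_closed kernel.
Proof. by move=> x; rewrite !inE (morph_inv (@gmulfM _ _ f)) => /eqP->; rewrite invg1. Qed.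
Fact kernelJ x y : x \in kernel -> x ^ y \in kernel.
Proof.
rewrite !inE conjgE !gmulfM => /eqP->; rewrite mul1g -gmulfM mulVg.
by rewrite (morph_one (@gmulfM _ _ f)).
Qed.
HB.instance Definition _ := isMulClosed.Build G kernel kernelM.
HB.instance Definition _ := isMul1Closed.Build G kernel kernel1.
HB.instance Definition _ := isInvClosed.Build G kernel kernelV.
HB.instance Definition _ := isConjClosed.Build G kernel kernelJ.

End Kernel.

Lemma kernel_normal (G H : groupType) (f : G -> H) : {morph f : x y / x * y} ->
  exists N : normalClosed G, forall x, x \in N <-> f x = 1.
Proof.
move=> fM; pose f' : {multiplicative G -> H} := HB.pack f (isMultiplicative.Build G H f fM).
exists (kernel f' : normalClosed G) => x; rewrite inE.
by split=> [/eqP|/eqP].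
Qed.

End GroupMorphisms.

Local Open Scope classical_set_scope.

(** * The hyperplane section and its automorphisms *)

Section Points.
Variables (K : numClosedFieldType) (m : nat) (A : 'M[K]_m).
Hypothesis hA : A^T = - A.
Implicit Types (v w u p q : 'cV[K]_m) (b : ext2 K m).
Local Notation a := (aform A).
Local Notation V := (ext2 K m).
Local Notation cone := (cone A).
Definition section_set : set (proj V) := grassmannian K m `&` hyperplane A.
Local Notation X := section_set.

Lemma proj_line_neq0 (x : proj V) b : val x = <[b]>%VS -> b != 0.
Proof. by move=> e; have /eqP := valP x; rewrite e dim_vline; case: (b != 0). Qed.

Lemma line_eq b b' : <[b]>%VS = <[b']>%VS -> b' != 0 -> exists2 x, x != 0 & b = x *: b'.
Proof.
move=> e b0; have : b \in <[b']>%VS by rewrite -e memv_line.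
move=> /vlineP[x ex]; exists x => //; apply: contraNneq b0 => x0.
have := congr1 (fun L : {vspace V} => \dim L) e.
by rewrite ex x0 scale0r !dim_vline eqxx; case: (b' == 0).
Qed.

Lemma point_cone (x : X) b : val (val x) = <[b]>%VS -> cone b.
Proof.
have [[L [_ [p [q [_ ex]]]]] Hx] := set_mem (valP x).
have w0 := proj_line_neq0 ex.
have := (hyperplane_wedge hA (diag_antisym hA) ex).1 Hx => pq e.
have : b \in <[wedge p q]>%VS by rewrite -ex e memv_line.
by move=> /vlineP[y ->]; apply: coneZ; exists p, q.
Qed.

Lemma point_rep (x : X) : exists b, [/\ cone b, b != 0 & val (val x) = <[b]>%VS].
Proof.
have [[L [_ [p [q [_ ex]]]]] Hx] := set_mem (valP x).
exists (wedge p q); split=> //; first exact: point_cone ex.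
exact: proj_line_neq0 ex.
Qed.

Lemma point_ex b : cone b -> b != 0 -> exists x : X, val (val x) = <[b]>%VS.
Proof.
move=> [v [w [eb vw]]] b0; have db : \dim <[b]>%VS == 1%N by rewrite dim_vline b0.
pose y : proj V := exist (fun L : {vspace V} => is_true (\dim L == 1%N)) _ db.
have w0 : wedge v w != 0 by rewrite -eb.
have fr : free [:: v; w].
  rewrite free_cons seq1_free (wedge_neq0r w0) andbT span_seq1.
  by apply: contraNN w0 => /vlineP[x ->]; rewrite wedgeZl wedgevv scaler0.
have yX : y \in X.
  apply: mem_set; split.
    exists <<[:: v; w]>>%VS; split; first by move: fr; rewrite /free => /eqP.
    by exists v, w; rewrite -eb.
  by apply/(hyperplane_wedge (p := v) (q := w) hA (diag_antisym hA)) => //; rewrite /= eb.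
by exists (exist _ y yX).
Qed.

Lemma point_inj (x y : X) : val (val x) = val (val y) -> x = y.
Proof. by move=> e; apply: val_inj; apply: val_inj. Qed.

(** The field of lines on the cone given by [f]; the default is taken only if [b] spans no point of
    [X]. *)
Definition image_line (f : X -> X) (b : V) : {vspace V} :=
  xget 0%VS [set L | exists2 x : X, val (val x) = <[b]>%VS & L = val (val (f x))].

Lemma image_lineE f (x : X) b : val (val x) = <[b]>%VS -> image_line f b = val (val (f x)).
Proof.
move=> ex; rewrite /image_line; case: xgetP => [L _ [y ey ->]|/(_ (val (val (f x))))[]].
  by congr (val (val (f _))); apply: point_inj; rewrite ex ey.
by exists x.
Qed.

Lemma image_line_scale f (x : K) b : x != 0 -> cone b -> b != 0 ->
  image_line f (x *: b) = image_line f b.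
Proof.
move=> x0 cb b0; have [y ey] := point_ex cb b0.
rewrite (image_lineE f ey) (@image_lineE f y) // ey; apply/eqP.
rewrite eqEsubv -!memvE memvZ ?memv_line // andbT; apply/vlineP.
by exists x^-1; rewrite scalerA mulVf // scale1r.
Qed.

Lemma image_line_local f : regular f -> forall b, cone b -> b != 0 ->
  exists (s : {mpoly K[\dim {:V}]}) (P : 'I_(\dim {:V}) -> {mpoly K[\dim {:V}]}),
  peval s b != 0 /\ forall b', cone b' -> b' != 0 -> peval s b' != 0 ->
    poly_map P b' != 0 /\ image_line f b' = <[poly_map P b']>%VS.
Proof.
move=> rf b cb b0; have [x ex] := point_ex cb b0.
have [U [d [P [[S [hS eS]] Ux hP UP]]]] := rf x.
(* One equation of the closed complement of [U] is nonzero at [x]; its nonvanishing locus is a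
   principal neighbourhood inside [U]. *)
have [s [Ss nsx]] : exists s, S s /\ ~ vanishes_at s (val x).
  apply: contrapT => ns; have : (~` U) (val x); last by [].
  rewrite eS => s Ss; apply: contrapT => nv; apply: ns; by exists s.
have [e hs] := hS s Ss.
exists s, P; split.
  apply/eqP => sb; apply: nsx; apply/(vanishes_atP hs (v := b)) => //.
  by rewrite ex memv_line.
move=> b' cb' b'0 sb'; have [y ey] := point_ex cb' b'0.
have b'y : b' \in val (val y) by rewrite ey memv_line.
have Uy : U (val y).
  apply: contrapT => nU; have : (~` U) (val y) by [].
  by rewrite eS => /(_ s Ss b' b'y) /eqP; rewrite (negPf sb').
have E := UP y Uy b' b'y b'0; rewrite (image_lineE f ey); split=> //.
exact: proj_line_neq0 E.
Qed.

Variable c0 : 'cV[K]_m.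
Hypothesis ker_line : forall v, (forall w, a v w = 0) -> exists x, v = x *: c0.
Variables e0 e1 f0 f1 : 'cV[K]_m.
Hypotheses (e0f0 : a e0 f0 = 1) (e0f1 : a e0 f1 = 0) (e1f0 : a e1 f0 = 0)
  (e1f1 : a e1 f1 = 1) (e0e1 : a e0 e1 = 0).

Lemma cone_pencil p q q' : a p q = 0 -> a p q' = 0 ->
  (forall s t, s *: wedge p q + t *: wedge p q' = 0 -> s = 0 /\ t = 0) ->
  pencil A (wedge p q) (wedge p q').
Proof.
move=> pq pq' ind; split=> // s t; exists p, (s *: q + t *: q').
by rewrite wedgeDr !wedgeZr aformDr !aformZr pq pq' !mulr0 addr0.
Qed.

(** The lifts of [f] and of its inverse come separately from [cone_map]; only their composite, a
    scalar on each bivector, pins the degree down. *)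
Theorem automorphism_cone (f : X -> X) : is_automorphism f -> exists G : V -> V, [/\
  forall b, cone b -> b != 0 -> G b != 0,
  forall (x : X) b, val (val x) = <[b]>%VS -> val (val (f x)) = <[G b]>%VS,
  forall x b, cone b -> G (x *: b) = x *: G b &
  forall p q q', a p q = 0 -> a p q' = 0 ->
    G (wedge p (q + q')) = G (wedge p q) + G (wedge p q')].
Proof.
move=> [rf [g [rg fg gf]]].
have [k [G [Gl Gh Gc]]] := cone_map hA ker_line e0f0 e0f1 e1f0 e1f1 e0e1
  (@image_line_scale f) (image_line_local rf).
have [l [H [Hl Hh Hc]]] := cone_map hA ker_line e0f0 e0f1 e1f0 e1f1 e0e1
  (@image_line_scale g) (image_line_local rg).
have Gp (x : X) b : val (val x) = <[b]>%VS -> val (val (f x)) = <[G b]>%VS.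
  move=> ex; rewrite -(image_lineE f ex).
  by have [] := Gl b (point_cone ex) (proj_line_neq0 ex).
have Hp (x : X) b : val (val x) = <[b]>%VS -> val (val (g x)) = <[H b]>%VS.
  move=> ex; rewrite -(image_lineE g ex).
  by have [] := Hl b (point_cone ex) (proj_line_neq0 ex).
have Gn b : cone b -> b != 0 -> G b != 0 by move=> cb b0; have [] := Gl b cb b0.
have Hn b : cone b -> b != 0 -> H b != 0 by move=> cb b0; have [] := Hl b cb b0.
have HC b : cone b -> b != 0 -> cone (H b).
  by move=> cb b0; have [x ex] := point_ex cb b0; exact: point_cone (Hp x b ex).
have GH b : cone b -> b != 0 -> exists x, G (H b) = x *: b.
  move=> cb b0; have [x ex] := point_ex cb b0.
  have := Gp _ _ (Hp x b ex); rewrite gf ex => e.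
  have /vlineP[y ->] : G (H b) \in <[b]>%VS by rewrite e memv_line.
  by exists y.
have pen : pencil A (wedge e0 e1) (wedge e0 f1).
  apply: cone_pencil => // s t; rewrite -!wedgeZr -wedgeDr.
  have e00 : e0 != 0.
    apply/eqP => e; move: e0f0; rewrite e aform0l => /eqP.
    by rewrite eq_sym oner_eq0.
  move=> /(wedge_eq0 e00)[x ex].
  have := congr1 (a e1) ex; rewrite aformDr !aformZr (aformvv hA) e1f1 (aformC hA e0) e0e1.
  rewrite mulr0 add0r mulr1 oppr0 mulr0 => t0; split=> //.
  have := congr1 (fun v => a v f1) ex; rewrite aformDl !aformZl e1f1 (aformvv hA) e0f1.
  by rewrite !mulr0 addr0 mulr1.
have k1 := degree_one Gn Hn HC Gh Hh Gc Hc GH pen.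
(* The lift is controlled only on nonzero bivectors; the value 0 at 0 makes homogeneity and
   additivity hold without exceptions. *)
pose G' b := if b == 0 then 0 else G b.
have G'Z x b : cone b -> G' (x *: b) = x *: G' b.
  move=> cb; rewrite /G' scaler_eq0; have [->|x0] := eqVneq x 0; first by rewrite /= scale0r.
  have [->|b0] := eqVneq b 0; first by rewrite /= scaler0.
  by rewrite /= Gh // k1 expr1.
exists G'; split.
- by move=> b cb b0; rewrite /G' (negPf b0); exact: Gn.
- by move=> x b ex; rewrite /G' (negPf (proj_line_neq0 ex)); exact: Gp.
- exact: G'Z.
- move=> p q q' pq pq';
  have G'0 : G' 0 = 0 by rewrite /G' eqxx.
  have cpq : cone (wedge p q) by exists p, q.
  have cpq' : cone (wedge p q') by exists p, q'.
  have [ind|nind] := pselect (forall s t : K,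
      s *: wedge p q + t *: wedge p q' = 0 -> s = 0 /\ t = 0).
    have bb := cone_pencil pq pq' ind.
    have := pencil_linear Gn Hn HC Gh Hh Gc Hc GH bb 1; rewrite !scale1r -wedgeDr => E.
    rewrite /G' E; case: eqP => [e|_].
      have [] := ind 1 1; first by rewrite !scale1r -wedgeDr.
      by move/eqP; rewrite oner_eq0.
    case: eqP => [e|_].
      have [] := ind 1 0; first by rewrite e scale0r addr0 scaler0.
      by move/eqP; rewrite oner_eq0.
    case: eqP => [e|//].
    have [] := ind 0 1; first by rewrite e scale0r add0r scaler0.
    by move=> _ /eqP; rewrite oner_eq0.
  (* Proportional bivectors span no pencil; there additivity follows from homogeneity. *)
  have [s [t [e st]]] : exists s t : K, s *: wedge p q + t *: wedge p q' = 0 /\ (s, t) != (0, 0).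
    apply: contrapT => n; apply: nind => s t e; apply: contrapT => nst; apply: n.
    exists s, t; split=> //; apply/eqP => -[s0 t0]; exact: nst.
  rewrite wedgeDr; have [t0|t0] := eqVneq t 0.
    have s0 : s != 0 by move: st; rewrite t0 xpair_eqE eqxx andbT.
    move/eqP: e; rewrite t0 scale0r addr0 scaler_eq0 (negPf s0) /= => /eqP ->.
    by rewrite add0r G'0 add0r.
  have -> : wedge p q' = (- (s / t)) *: wedge p q.
    move/eqP: e; rewrite addrC addr_eq0 => /eqP/(congr1 (fun z => t^-1 *: z)).
    by rewrite scalerA mulVf // scale1r => ->; rewrite scalerN scalerA scaleNr mulrC.
  rewrite -{1}[wedge p q]scale1r -scalerDl !G'Z // scalerDl scale1r //.
Qed.

End Points.

(** * Isometries acting on the hyperplane section *)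

Section LinearAction.
Variables (K : numClosedFieldType) (m : nat) (A : 'M[K]_m).
Hypothesis hA : A^T = - A.
Local Notation V := (ext2 K m).
Local Notation a := (aform A).
Local Notation X := (section_set A).
Implicit Types (S : 'M[K]_m) (b : V).

Definition isometry S := S \in unitmx /\ forall v w, a (S *m v) (S *m w) = a v w.

Lemma isometryM S S' : isometry S -> isometry S' -> isometry (S *m S').
Proof.
move=> [u1 h1] [u2 h2]; split; first by rewrite unitmx_mul u1.
by move=> v w; rewrite -!mulmxA h1 h2.
Qed.

Lemma isometryV S : isometry S -> isometry (invmx S).
Proof.
move=> [u h]; split; first by rewrite unitmx_inv.
by move=> v w; rewrite -h !mulKVmx.
Qed.

Lemma ext2_map_inj S b : S \in unitmx -> ext2_map S b = 0 -> b = 0.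
Proof. by move=> u e; rewrite -[b]ext2_map1 -(mulVmx u) -ext2_map_comp e ext2_map0. Qed.

Lemma vline_scale (x : K) b : x != 0 -> <[x *: b]>%VS = <[b]>%VS.
Proof.
move=> x0; apply/eqP; rewrite eqEsubv -!memvE memvZ ?memv_line //=.
by apply/vlineP; exists x^-1; rewrite scalerA mulVf // scale1r.
Qed.

(** The default makes [act] total; for an isometry the image line is again a point of [X], so the
    default is not taken. *)
Definition act S (x : X) : X :=
  xget x [set y : X | forall b, val (val x) = <[b]>%VS -> val (val y) = <[ext2_map S b]>%VS].

Lemma actP S : isometry S -> forall (x : X) b, val (val x) = <[b]>%VS ->
  val (val (act S x)) = <[ext2_map S b]>%VS.
Proof.
move=> [uS hS] x; rewrite /act; case: xgetP => [y _ //|ny].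
have [b0 [[v [w [eb0 vw]]] b00 ex]] := point_rep hA x.
have [||y ey] := @point_ex _ _ _ hA (ext2_map S b0).
- by exists (S *m v), (S *m w); rewrite eb0 ext2_map_wedge hS.
- by apply: contra_neq b00 => /(ext2_map_inj uS).
case: (ny y) => b; rewrite ex => e.
have [r r0 ->] := line_eq (esym e) b00.
by rewrite ey ext2_mapZ vline_scale.
Qed.

Lemma act_regular S : isometry S -> regular (act S).
Proof.
move=> hS x; pose P i : {mpoly K[\dim {:V}]} :=
  \sum_(j < \dim {:V}) coord (vbasis {:V}) i (ext2_map S (vbasis {:V})`_j) *: 'X_j.
have PE v : poly_map P v = ext2_map S v.
  rewrite [RHS](coord_vbasis (memvf (ext2_map S v))); apply: eq_bigr => i _.
  congr (_ *: _); rewrite {2}(coord_vbasis (memvf v)).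
  rewrite (big_morph (ext2_map S) (@ext2_mapD _ _ _ S) (ext2_map0 S)) linear_sum.
  rewrite /peval /P raddf_sum; apply: eq_bigr => j _.
  by rewrite /= mevalZ mevalXU ext2_mapZ linearZ mulrC.
exists setT, 1%N, P; split=> //; first exact: zariski_openT.
  by move=> i; apply: rpred_sum => j _; apply: rpredZ; rewrite dhomogX /= mdeg1.
by move=> y _ v vy v0; rewrite (actP hS (proj_line vy v0)) PE.
Qed.

Lemma act_comp S S' : isometry S -> isometry S' -> act S \o act S' =1 act (S *m S').
Proof.
move=> hS hS' x; have [b [_ _ ex]] := point_rep hA x; apply: point_inj => /=.
rewrite (actP (isometryM hS hS') ex) (actP hS (actP hS' ex)).
by rewrite ext2_map_comp.
Qed.

Lemma isometry1 : isometry 1%:M.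
Proof. by split=> [|v w]; rewrite ?unitmx1 ?mul1mx. Qed.

Lemma act1 : act 1%:M =1 id.
Proof.
move=> x; have [b [_ _ ex]] := point_rep hA x; apply: point_inj.
by rewrite (actP isometry1 ex) ext2_map1.
Qed.

Lemma act_automorphism S : isometry S -> is_automorphism (act S).
Proof.
move=> hS; split; first exact: act_regular.
exists (act (invmx S)); split; first exact: act_regular (isometryV hS).
  move=> x; have := act_comp (isometryV hS) hS x => /= ->.
  by rewrite mulVmx ?act1 //; case: hS.
move=> x; have := act_comp hS (isometryV hS) x => /= ->.
by rewrite mulmxV ?act1 //; case: hS.
Qed.

End LinearAction.

(** * The odd symplectic group *)

Lemma aform_inj (K : numFieldType) m (A B : 'M[K]_m) :
  (forall v w, aform A v w = aform B v w) -> A = B.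
Proof.
move=> AB; apply/matrixP => i k; have := AB (delta_mx i 0) (delta_mx k 0).
by rewrite /aform trmx_delta -!mulmxA -!colE -!rowE !mxE.
Qed.

Section OddSymplectic.
Variables (K : numClosedFieldType) (d : nat).
Local Notation m := (d + 1)%N.
Variables (A : 'M[K]_m) (J : 'M[K]_d) (P : 'M[K]_m).
Hypotheses (hA : A^T = - A) (hJ : J^T = - J) (uJ : J \in unitmx) (d4 : (4 <= d)%N).
Hypotheses (uP : P \in unitmx) (PA : P^T *m A *m P = block_mx J 0 0 0).
Local Notation a := (aform A).
Local Notation j := (aform J).
Local Notation X := (section_set A).
Local Notation V := (ext2 K m).

Let iota : 'M[K]_(m, d) := lsubmx P.
Let c : 'cV[K]_m := rsubmx P.
Let R : 'M[K]_(d, m) := usubmx (invmx P).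
Let t : 'cV[K]_m := (dsubmx (invmx P))^T.

Let P_block : P = row_mx iota c. Proof. by rewrite hsubmxK. Qed.
Let invP_block : invmx P = col_mx R t^T. Proof. by rewrite trmxK vsubmxK. Qed.

Let inv_blocks : [/\ R *m iota = 1%:M, R *m c = 0, t^T *m iota = 0 & t^T *m c = 1%:M].
Proof.
have := mulVmx uP; rewrite [X in _ *m X]P_block invP_block mul_col_mx !mul_mx_row.
by rewrite scalar_mx_block -/(block_mx _ _ _ _) => /eq_block_mx[].
Qed.

Let Ri : R *m iota = 1%:M. Proof. by case: inv_blocks. Qed.
Let Rc : R *m c = 0. Proof. by case: inv_blocks. Qed.
Let ct : dot c t = 1.
Proof. by rewrite dotC /dot; case: inv_blocks => _ _ _ ->; rewrite mxE. Qed.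
Let it x : dot (iota *m x) t = 0.
Proof. by rewrite dotC /dot mulmxA; case: inv_blocks => _ _ -> _; rewrite mul0mx mxE. Qed.

Let dec v : v = iota *m (R *m v) + dot v t *: c.
Proof.
rewrite -{1}[v]mul1mx -(mulmxV uP) {1}P_block invP_block mul_row_col mulmxDl -!mulmxA.
by congr (_ + _); rewrite [t^T *m v]mx11_scalar mul_mx_scalar dotC.
Qed.

Let form_blocks : [/\ iota^T *m A *m iota = J, iota^T *m A *m c = 0,
  c^T *m A *m iota = 0 & c^T *m A *m c = 0].
Proof.
move: PA; rewrite {1 2}P_block tr_row_mx !mul_col_mx !mul_mx_row -/(block_mx _ _ _ _).
by move=> /eq_block_mx[].
Qed.

Let Ai x y : a (iota *m x) (iota *m y) = j x y.
Proof.
rewrite /aform trmx_mul -!mulmxA (mulmxA A) (mulmxA iota^T) (mulmxA iota^T).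
by case: form_blocks => -> _ _ _; rewrite mulmxA.
Qed.

Let Ac v : a c v = 0.
Proof.
rewrite (dec v) aformDr aformZr /aform (mulmxA (c^T *m A) iota).
by case: form_blocks => _ _ -> ->; rewrite mul0mx !mxE mulr0 addr0.
Qed.

Lemma frame_mapE (T : 'M[K]_d) (be : K) (al : 'cV[K]_d) v :
  P *m block_mx T 0 (be *: al^T) be%:M *m invmx P *m v = frame_map iota c t R T be al v.
Proof.
rewrite invP_block P_block -!mulmxA (mul_col_mx R) mul_block_col mul_row_col mul0mx addr0.
rewrite /frame_map; congr (_ + _).
rewrite -scalemxAl mul_scalar_mx -scalerDr -scalemxAr; rewrite -scalerA; congr (_ *: _).
rewrite [X in c *m X]mx11_scalar mul_mx_scalar; congr (_ *: _).
by rewrite mxE -/(dot al (R *m v)) -/(dot t v) [dot t v]dotC.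
Qed.

Definition conj_frame (M : 'M[K]_m) : 'M[K]_m := P *m M *m invmx P.

Lemma conj_frameM M N : conj_frame (M *m N) = conj_frame M *m conj_frame N.
Proof. by rewrite /conj_frame !mulmxA mulmxKV. Qed.

Lemma conj_frameZ (s : K) M : conj_frame (s *: M) = s *: conj_frame M.
Proof. by rewrite /conj_frame -scalemxAr -scalemxAl. Qed.

Lemma conj_frame_iota (T : 'M[K]_d) (u : 'rV[K]_d) (be : 'M[K]_1) (x : 'cV[K]_d) :
  conj_frame (block_mx T 0 u be) *m (iota *m x) = iota *m (T *m x) + c *m (u *m x).
Proof.
rewrite /conj_frame invP_block P_block -!mulmxA (mul_col_mx R) !mulmxA.
case: inv_blocks => -> _ -> _; rewrite mul1mx mul0mx.
by rewrite -!mulmxA mul_block_col mul_row_col !mulmx0 !addr0.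
Qed.

Lemma conj_frame_c (T : 'M[K]_d) (u : 'rV[K]_d) (be : 'M[K]_1) :
  conj_frame (block_mx T 0 u be) *m c = c *m be.
Proof.
rewrite /conj_frame invP_block P_block -!mulmxA (mul_col_mx R).
case: inv_blocks => _ -> _ ->; rewrite mul_block_col !mulmx0 !mulmx1 !add0r.
by rewrite mul_row_col mulmx0 add0r.
Qed.

Lemma odd_symplecticP (M : OddSp J) : exists (T : Sp J) (u : 'rV[K]_d) (b : units K),
  val (val M) = block_mx (val (val T)) 0 u (val b)%:M.
Proof. by have := valP M; rewrite inE => -[T [u [b e]]]; exists T, u, b. Qed.

Lemma SpP (T : Sp J) : (val (val T))^T *m J *m val (val T) = J.
Proof. by have := valP T; rewrite inE => /eqP. Qed.

Lemma conj_isometry (M : OddSp J) : isometry A (conj_frame (val (val M))).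
Proof.
have [T [u [b eM]]] := odd_symplecticP M.
split.
  by rewrite !unitmx_mul uP unitmx_inv uP (valP (val M)).
suff E : (conj_frame (val (val M)))^T *m A *m conj_frame (val (val M)) = A.
  by move=> v w; rewrite -[in RHS]E /aform trmx_mul !mulmxA.
have eA : A = (invmx P)^T *m block_mx J 0 0 0 *m invmx P.
  by rewrite -PA !mulmxA -trmx_mul mulmxV // trmx1 mul1mx -mulmxA mulmxV // mulmx1.
rewrite /conj_frame !trmx_mul -!mulmxA (mulmxA P^T) (mulmxA _ P) PA.
rewrite [in RHS]eA -!mulmxA; congr (_ *m _); rewrite !mulmxA; congr (_ *m _).
rewrite eM tr_block_mx !mulmx_block !(mulmx0, mul0mx, addr0, trmx0).
by rewrite SpP.
Qed.

Definition Phi_aut (M : OddSp J) : Aut X :=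
  exist (fun f => is_true `[< is_automorphism f >]) _
    (asboolT (act_automorphism hA (conj_isometry M))).

Lemma Phi_autM : {morph Phi_aut : M N / (M * N)%g}.
Proof.
move=> M N; apply: val_inj; apply/funext => x /=.
rewrite [RHS](act_comp hA (conj_isometry M) (conj_isometry N)).
by rewrite -conj_frameM.
Qed.

Lemma unit_mx_scale (s : K) : s *: J = J -> s = 1.
Proof.
move=> e; have d0 : (0 < d)%N by apply: leq_trans d4.
have := congr1 (fun M => (M *m invmx J) (Ordinal d0) (Ordinal d0)) e.
by rewrite -scalemxAl mulmxV // !mxE eqxx mulr1.
Qed.

Let c_neq0 : c != 0.
Proof.
apply/eqP => c0; have := ct; rewrite c0 -(scale0r (0 : 'cV_m)) dotZl mul0r => /eqP.
by rewrite eq_sym oner_eq0.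
Qed.

(** A trivial action preserves every isotropic plane; intersecting such planes makes the matrix a
    scalar, and preservation of [J] makes its square 1. *)
Lemma Phi_aut_kernel (M : OddSp J) : Phi_aut M = 1%g -> M \in OddSp_pm1 J.
Proof.
have [T [u [b eM]]] := odd_symplecticP M; move=> /(congr1 val) e1.
set T' := val (val T) in eM; set b' := val b in eM; set S := conj_frame (val (val M)).
have hS : isometry A S := conj_isometry M.
have Sact (v w : 'cV[K]_m) : a v w = 0 -> wedge v w != 0 ->
    exists x y : K, S *m v = x *: v + y *: w.
  move=> vw vw0; have cb : cone A (wedge v w) by exists v, w.
  have [x ex] := point_ex hA cb vw0.
  have := actP hA hS ex; rewrite -[act S x]/(val (Phi_aut M) x) e1 /= ex => e.
  have Sw0 : wedge (S *m v) (S *m w) != 0.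
    rewrite -ext2_map_wedge; apply: contra_neq vw0; exact: ext2_map_inj hS.1.
  rewrite ext2_map_wedge in e; have [r r0 er] := line_eq e Sw0.
  apply: (in_star_span vw0); exists (r *: (S *m w)); by rewrite wedgeZr.
have RS (x : 'cV[K]_d) : R *m (S *m (iota *m x)) = T' *m x.
  by rewrite /S eM conj_frame_iota mulmxDr !mulmxA Ri mul1mx Rc !mul0mx addr0.
have tS (x : 'cV[K]_d) : dot (S *m (iota *m x)) t = (u *m x) 0 0.
  rewrite /S eM conj_frame_iota dotDl it add0r [u *m x]mx11_scalar mul_mx_scalar.
  by rewrite dotZl ct mulr1 -mx11_scalar.
have Sc : S *m c = b' *: c by rewrite /S eM conj_frame_c mul_mx_scalar.
have eig (x : 'cV[K]_d) : x != 0 -> T' *m x = b' *: x /\ u *m x = 0.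
  move=> x0; have [z [xz _ xz0 _]] := common_perp_indep hJ uJ d4 x0 x0.
  have RiK (y : 'cV[K]_d) : R *m (iota *m y) = y by rewrite mulmxA Ri mul1mx.
  have w1 (k : K) : wedge (iota *m x + k *: c) (iota *m z) != 0.
    apply: contraNneq xz0 => e; rewrite -(ext2_map0 R) -e ext2_map_wedge.
    by rewrite mulmxDr -scalemxAr Rc scaler0 addr0 !RiK.
  have iso (k : K) : a (iota *m x + k *: c) (iota *m z) = 0.
    by rewrite aformDl aformZl Ac mulr0 addr0 Ai.
  (* With [X, Z] the images of [x, z]: the plane of [X, Z] gives [u x = 0], that of [X, c] makes [x]
     an eigenvector of [T'], and that of [X + c, Z] identifies the eigenvalue with [b']. *)
  have [x1 [y1 E1]] := Sact _ _ (iso 0) (w1 0).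
  rewrite scale0r addr0 in E1.
  have [x2 [y2 E2]] := Sact _ _ (iso 1) (w1 1).
  have w2 : wedge (iota *m x) c != 0.
    rewrite wedgeC oppr_eq0; apply: contraNneq x0 => e.
    have [r er] := wedge_eq0 c_neq0 e.
    by rewrite -(RiK x) er -scalemxAr Rc scaler0.
  have iso2 : a (iota *m x) c = 0 by rewrite (aformC hA c) Ac oppr0.
  have [x3 [y3 E3]] := Sact _ _ iso2 w2.
  have T1 := congr1 (mulmx R) E1; rewrite RS mulmxDr -!scalemxAr !RiK in T1.
  have T3 := congr1 (mulmx R) E3; rewrite RS mulmxDr -!scalemxAr !RiK Rc scaler0 addr0 in T3.
  have u1 := congr1 (fun w : 'cV[K]_m => dot w t) E1.
  rewrite /= tS dotDl !dotZl !it !mulr0 addr0 in u1.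
  have ux : u *m x = 0 by apply/matrixP => i k; rewrite (ord1 i) (ord1 k) u1 mxE.
  split=> //; rewrite mulmxDr scale1r Sc in E2.
  have T2 := congr1 (mulmx R) E2; rewrite !mulmxDr RS -!scalemxAr mulmxDr !RiK Rc in T2.
  rewrite scaler0 !addr0 T3 in T2.
  have b2 := congr1 (fun w : 'cV[K]_m => dot w t) E2.
  rewrite /= dotDl tS ux !dotDl !dotZl dotDl !it ct mxE add0r mulr0 addr0 add0r !mulr1 in b2.
  have := congr1 (fun y => wedge y z) T2; rewrite wedgeDl !wedgeZl wedgevv scaler0 addr0.
  move/eqP; rewrite -subr_eq0 -scalerBl scaler_eq0 (negPf xz0) orbF subr_eq0 => /eqP x32.
  by rewrite T3 x32 b2.
have eT : T' = b'%:M.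
  apply/matrixP => i k; have nz : (delta_mx k 0 : 'cV[K]_d) != 0.
    by apply/eqP => /matrixP/(_ k 0); rewrite !mxE !eqxx => /eqP; rewrite oner_eq0.
  have [/matrixP/(_ i 0) + _] := eig _ nz; rewrite -colE !mxE eqxx andbT => ->.
  by rewrite mulr_natr.
have eu : u = 0.
  apply/matrixP => i k; have nz : (delta_mx k 0 : 'cV[K]_d) != 0.
    by apply/eqP => /matrixP/(_ k 0); rewrite !mxE !eqxx => /eqP; rewrite oner_eq0.
  have [_ /matrixP/(_ i 0)] := eig _ nz; by rewrite -colE !mxE.
have : b' ^+ 2 = 1.
  apply: (unit_mx_scale); rewrite -[RHS](SpP T) -/T' eT.
  by rewrite tr_scalar_mx mul_scalar_mx mul_mx_scalar scalerA expr2.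
move/eqP; rewrite sqrf_eq1 inE eM eT eu => /orP[]/eqP ->.
  by rewrite -scalar_mx_block eqxx.
by rewrite -scalar_mx_block raddfN /= eqxx orbT.
Qed.

Lemma Phi_aut_pm1 (M N : OddSp J) : val (val M) = - val (val N) -> Phi_aut M = Phi_aut N.
Proof.
move=> e; apply: val_inj; apply/funext => x.
have [b [_ _ ex]] := point_rep hA x; apply: point_inj => /=.
rewrite (actP hA (conj_isometry M) ex) (actP hA (conj_isometry N) ex) e.
rewrite -scaleN1r conj_frameZ ext2_map_scalar sqrrN expr1n scale1r //.
Qed.

Lemma Phi_aut_ker (M : OddSp J) : M \in OddSp_pm1 J <-> Phi_aut M = 1%g.
Proof.
split; last exact: Phi_aut_kernel.
have one : Phi_aut 1%g = 1%g by exact: morph_one Phi_autM.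
rewrite inE => /orP[]/eqP e; rewrite -one; last by apply: Phi_aut_pm1; rewrite e.
by congr Phi_aut; apply: val_inj; apply: val_inj.
Qed.

Lemma odd_symplectic_of (T : 'M[K]_d) (u : 'rV[K]_d) (b : K) : T^T *m J *m T = J -> b != 0 ->
  exists M : OddSp J, val (val M) = block_mx T 0 u b%:M.
Proof.
move=> TJ b0.
have uT : T \in unitmx.
  by move: uJ; rewrite -{1}TJ !unitmx_mul => /andP[].
have uM : block_mx T 0 u b%:M \in unitmx.
  by rewrite unitmxE det_lblock unitrM -unitmxE uT det_scalar1 unitfE b0.
pose gT : GL K d := exist (fun S => is_true (S \in unitmx)) T uT.
have pT : gT \in preserves_form J by rewrite inE /= TJ.
pose M : GL K m := exist (fun S => is_true (S \in unitmx)) (block_mx T 0 u b%:M) uM.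
have pM : M \in odd_symplectic J.
  rewrite inE; exists (exist (fun S => is_true (S \in preserves_form J)) gT pT), u.
  by exists (exist (fun x => is_true (x != 0)) b b0).
by exists (exist (fun S => is_true (S \in odd_symplectic J)) M pM).
Qed.

Lemma Phi_aut_surj (f : Aut X) : exists M, Phi_aut M = f.
Proof.
have [|e [h eh]] := @darboux_vectors K d J 2 hJ.
  by have := uJ; rewrite -row_free_unit => /eqP ->.
have kl v : (forall w, a v w = 0) -> exists x, v = x *: c.
  by move=> kv; exists (dot v t); have := ker_c uJ dec Ai Ac kv.
have E i k : (i < 2)%N -> (k < 2)%N -> a (iota *m e i) (iota *m h k) = (i == k)%:R.
  by move=> iN kN; rewrite Ai; case: (eh i k iN kN).
have E1 : a (iota *m e 0%N) (iota *m e 1%N) = 0 by rewrite Ai; case: (eh 0%N 1%N).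
have [G [Gn Gp GZ Gadd]] := automorphism_cone hA kl (E 0%N 0%N erefl erefl) (E 0%N 1%N erefl erefl)
  (E 1%N 0%N erefl erefl) (E 1%N 1%N erefl erefl) E1 (asboolW (valP f)).
have co0 : cone A 0 by exists c, c; rewrite wedgevv Ac.
have G00 : G 0 = 0 by rewrite -(scale0r (0 : V)) GZ // !scale0r.
have Gc b : cone A b -> cone A (G b).
  move=> cb; have [->|b0] := eqVneq b 0; first by rewrite G00.
  have [x ex] := point_ex hA cb b0; exact: point_cone hA _ _ (Gp x b ex).
have Ginj b b' (s : K) : cone A b -> cone A b' -> b != 0 -> G b = s *: G b' ->
    exists y : K, b = y *: b'.
  move=> cb cb' b0 Gbb'; have := Gn b cb b0.
  rewrite Gbb' scaler_eq0 negb_or => /andP[s0 Gb'0].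
  have b'0 : b' != 0 by apply: contraNneq Gb'0 => ->; rewrite G00.
  have [x ex] := point_ex hA cb b0; have [x' ex'] := point_ex hA cb' b'0.
  have xx' : x = x'.
    have [_ [g [_ fg _]]] := asboolW (valP f); apply: (can_inj fg); apply: point_inj.
    by rewrite (Gp x b ex) (Gp x' b' ex') Gbb' vline_scale.
  have [y _ ey] : exists2 y, y != 0 & b = y *: b' by apply: line_eq => //; rewrite -ex xx'.
  by exists y.
have [T [be [s [al [uT be0 s0 TJ GT]]]]] := cone_linear hA hJ uJ d4 (leqnn _) Ri Rc ct it dec Ai Ac
  Gn Gc GZ Gadd Ginj.
(* Scaling the whole matrix by [r] leaves its projective action unchanged and multiplies the form by
   [r^2], turning the similitude [T] into a symplectic matrix. *)
pose r := (sqrtC s)^-1.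
have r0 : r != 0 by rewrite invr_eq0 sqrtC_eq0.
have rs : r ^+ 2 * s = 1 by rewrite exprVn sqrtCK mulVf.
have TJ' : (r *: T)^T *m J *m (r *: T) = J.
  rewrite [(r *: T)^T]linearZ /= -!scalemxAl -scalemxAr scalerA -expr2; apply: aform_inj => v w.
  rewrite -[RHS]mul1r -rs -mulrA -TJ /aform trmx_mul -(scalemxAr _ v^T) -scalemxAl mxE.
  by rewrite !mulmxA.
have [M eM] := @odd_symplectic_of _ ((r * be^-1) *: al^T) (r * be^-1) TJ'
  (mulf_neq0 r0 (invr_neq0 be0)).
exists M; apply: val_inj; apply/funext => x; apply: point_inj.
have [b [[v [w [eb vw]]] b0 ex]] := point_rep hA x.
rewrite [LHS](actP hA (conj_isometry M) ex) (Gp x b ex) eb GT //.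
have -> : val (val M) = r *: block_mx T 0 (be^-1 *: al^T) be^-1%:M.
  by rewrite eM scale_block_mx scaler0 scalerA scale_scalar_mx.
rewrite conj_frameZ ext2_map_scalar !vline_scale ?expf_neq0 //.
by rewrite ext2_map_wedge !frame_mapE.
Qed.

Definition frame_diag (M : OddSp J) : SpxUnits J :=
  xget 1%g [set x : SpxUnits J | exists u, val (val M) = block_mx (val (val x.1)) 0 u (val x.2)%:M].

Lemma frame_diagP M : exists u,
  val (val M) = block_mx (val (val (frame_diag M).1)) 0 u (val (frame_diag M).2)%:M.
Proof.
rewrite /frame_diag; case: xgetP => [x _ //|nx].
by have [T [u [b eM]]] := odd_symplecticP M; case: (nx (T, b)); exists u.
Qed.

Lemma frame_diagE M (x : SpxUnits J) u :
  val (val M) = block_mx (val (val x.1)) 0 u (val x.2)%:M -> frame_diag M = x.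
Proof.
have [u' ->] := frame_diagP M => /eq_block_mx[e1 _ _ /matrixP/(_ 0 0)].
rewrite !mxE !mulr1n => e2; case: (frame_diag M) x e1 e2 => [T b] [T' b'] /= e1 e2.
by congr (_, _); [do 2!apply: val_inj | apply: val_inj].
Qed.

Lemma frame_diagM : {morph frame_diag : M N / (M * N)%g}.
Proof.
move=> M N; have [u eM] := frame_diagP M; have [u' eN] := frame_diagP N.
apply: (@frame_diagE _ _ (u *m val (val (frame_diag N).1) + val (frame_diag M).2 *: u')).
rewrite /= eM eN mulmx_block !(mul0mx, mulmx0, addr0, add0r).
by rewrite mul_scalar_mx -scalar_mxM.
Qed.

Lemma frame_diag_surj x : exists M, frame_diag M = x.
Proof.
have [M eM] := odd_symplectic_of 0 (SpP x.1) (valP x.2).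
by exists M; exact: frame_diagE eM.
Qed.

Lemma frame_diag_pm1 M : M \in OddSp_pm1 J -> frame_diag M \in SpxUnits_pm1 J.
Proof.
have [u eM] := frame_diagP M; rewrite !inE eM => /orP[]/eqP.
  rewrite scalar_mx_block => /eq_block_mx[-> _ _ /matrixP/(_ 0 0)].
  by rewrite !mxE !mulr1n => ->; rewrite !eqxx.
rewrite -raddfN /= scalar_mx_block => /eq_block_mx[-> _ _ /matrixP/(_ 0 0)].
by rewrite !mxE !mulr1n raddfN /= => ->; rewrite !eqxx orbT.
Qed.

Theorem Aut_OddSp : isomorphic (Aut X) (quotient_group (OddSp_pm1 J)).
Proof. exact: isomorphic_sym (first_isomorphism Phi_autM Phi_aut_surj Phi_aut_ker). Qed.

Lemma translation_ex (u : 'rV[K]_d) : exists M : OddSp J, val (val M) = block_mx 1%:M 0 u 1%:M.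
Proof. by apply: odd_symplectic_of; rewrite ?oner_neq0 // trmx1 mul1mx mulmx1. Qed.

(** The diagonal blocks modulo sign factor through [Aut X], because [Phi_aut] has kernel [+-1]; the
    normal subgroup is the kernel of the resulting map [k]. *)
Theorem Aut_extension : exists N : normalClosed (Aut X),
  isomorphic (subgroup N) (Algebra.to_multiplicative 'rV[K]_d) /\
  isomorphic (quotient_group N) (quotient_group (SpxUnits_pm1 J)).
Proof.
pose Q := quotient_group (SpxUnits_pm1 J).
pose q (M : OddSp J) : Q := \pi_Q%qT (frame_diag M).
have qM : {morph q : M N / (M * N)%g} by move=> M N; rewrite /q frame_diagM pi_mul.
have qS y : exists M, q M = y.
  by have [M eM] := frame_diag_surj (repr y); exists M; rewrite /q eM reprK.
have [k kM kE] : exists2 k : Aut X -> Q, {morph k : x y / (x * y)%g} &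
    forall M, k (Phi_aut M) = q M.
  apply: (factor_morphism Phi_autM qM Phi_aut_surj) => M /Phi_aut_ker /frame_diag_pm1.
  by move/pi_eq1.
have [N NP] := kernel_normal kM.
exists N; split; last first.
  apply: (first_isomorphism kM) => [y|//].
  by have [M <-] := qS y; exists (Phi_aut M); rewrite kE.
have [U UE] := choice translation_ex.
have UD u u' : U (u + u') = (U u * U u')%g.
  apply: val_inj; apply: val_inj; rewrite /= !UE mulmx_block.
  by rewrite !(mul0mx, mulmx0, addr0, add0r) !mulmx1 !mul1mx addrC.
have UN u : Phi_aut (U u) \in N.
  apply/NP; rewrite kE; apply/pi_eq1.
  by rewrite (@frame_diagE _ 1%g u) ?gpred1 // UE.
pose h (u : Algebra.to_multiplicative 'rV[K]_d) : subgroup N :=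
  exist (fun f => is_true (f \in N)) _ (UN u).
apply: isomorphic_sym; apply: (@isomorphic_of _ _ h).
- by move=> u u'; apply: val_inj; rewrite /= -Phi_autM -UD.
- move=> u u' /(congr1 val) /= e; apply: subr0_eq.
  have := Phi_autM (U (u - u')) (U u'); rewrite -UD subrK e.
  move/(congr1 (fun x => x * (Phi_aut (U u'))^-1)%g); rewrite mulgV mulgK => /esym.
  move/Phi_aut_ker; rewrite inE UE => /orP[]/eqP.
    by rewrite scalar_mx_block => /eq_block_mx[].
  by rewrite -raddfN /= scalar_mx_block => /eq_block_mx[].
- move=> [f fN]; have [M eM] := Phi_aut_surj f.
  have /pi_eq1 : q M = 1%g by rewrite -kE eM; apply/NP.
  have [u eMu] := frame_diagP M; rewrite inE => /orP[]/andP[/eqP eT /eqP eb].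
    exists u; apply: val_inj; rewrite -[RHS]eM; congr Phi_aut.
    by apply: val_inj; apply: val_inj; rewrite UE eMu eT eb.
  (* With both diagonal blocks equal to -1, the opposite matrix is unipotent with row [- u] and acts
     in the same way. *)
  exists (- u); apply: val_inj; rewrite -[RHS]eM; apply: Phi_aut_pm1.
  by rewrite UE eMu eT eb opp_block_mx oppr0 opprK -raddfN /= opprK.
Qed.

End OddSymplectic.

Local Open Scope complex_scope.

Theorem proposition5p2 (R : realType) (n : nat) (hn : (2 <= n)%N)
    (A : 'M[R[i]]_(2 * n + 1)) (hA : A^T = - A) (rankA : \rank A = (2 * n)%N)
    (J : 'M[R[i]]_(2 * n)) (hJ : J^T = - J) (nondegJ : J \in unitmx) :
  let X := grassmannian R[i] (2 * n + 1) `&` hyperplane A in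
  (exists N : normalClosed (Aut X),
     isomorphic (subgroup N) (Algebra.to_multiplicative 'rV[R[i]]_(2 * n)) /\
     isomorphic (quotient_group N) (quotient_group (SpxUnits_pm1 J)))
  /\ isomorphic (Aut X) (quotient_group (OddSp_pm1 J)).
Proof.
move=> X; have d4 : (4 <= 2 * n)%N by rewrite -[4%N]/(2 * 2)%N leq_pmul2l.
have [P uP PA] := odd_frame hA rankA hJ nondegJ.
split; first exact: (Aut_extension hA hJ nondegJ d4 uP PA).
exact: (Aut_OddSp hA hJ nondegJ d4 uP PA).
Qed.
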